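(* Let $N\ge1$ be an integer, $-\min(2,N)<l<0$, $\alpha>0$, and $q_c(l)=\frac{N\alpha}{2+l}$. Let $\varphi\in L^q(\mathbb R^N)$ with $1<q<\infty$, $q>q_c(l)$, or $\varphi\in C_0(\mathbb R^N)$ (in which case one reads $q=\infty$). In the case $q<\infty$ let $r>q$ satisfy $$\frac1{q(\alpha+1)}+\frac l{N(\alpha+1)}<\frac1r<\frac{N+l}{N(\alpha+1)} .$$ For $\lambda>0$ let $u\in C([0,T_{\max}(\lambda\varphi));L^q(\mathbb R^N))\cap C((0,T_{\max}(\lambda\varphi));L^r(\mathbb R^N))$ (respectively $u\in C([0,T_{\max}(\lambda\varphi));C_0(\mathbb R^N))$ if $\varphi\in C_0(\mathbb R^N)$) be the maximal solution of $$u(t)=e^{t\Delta}u_0+\int_0^te^{(t-\sigma)\Delta}\left(|\cdot|^l|u(\sigma)|^\alpha u(\sigma)\right)d\sigma$$ with initial data $u_0=\lambda\varphi$. Then there exists a constant $C=C(N,l,\alpha,q)>0$ such that $$T_{\max}(\lambda\varphi)\ \ge\ C\left(\lambda\|\varphi\|_q\right)^{-\left(\frac{2+l}{2\alpha}-\frac N{2q}\right)^{-1}}\qquad\text{for all }\lambda>0 .$$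
   Context: The integral equation is the mild formulation of the Hardy parabolic equation $\partial_tu=\Delta u+|\cdot|^l|u|^\alpha u$ on $\mathbb R^N$; $e^{t\Delta}$ is the heat semigroup on $\mathbb R^N$, $\|\cdot\|_q$ the $L^q(\mathbb R^N)$ norm, $1/\infty=0$, and $C_0(\mathbb R^N)$ the space of continuous functions vanishing at infinity. It is known that the integral equation is locally well-posed for such data in $C([0,T];L^q(\mathbb R^N))\cap C((0,T];L^r(\mathbb R^N))$ (respectively $C([0,T];C_0(\mathbb R^N))$), so there is a unique maximal solution, and $T_{\max}(u_0)\in(0,\infty]$ is its existence time. *)

(* Defs.v *)
From HB Require Import structures.
From mathcomp Require Import all_boot all_order all_algebra.
From mathcomp Require Import all_classical all_reals all_analysis.

Set Implicit Arguments.
Unset Strict Implicit.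
Unset Printing Implicit Defensive.

Import Order.TTheory GRing.Theory Num.Theory.
Import numFieldNormedType.Exports.

Local Open Scope classical_set_scope.
Local Open Scope ring_scope.

(* Product sigma-algebra on row vectors, following the library's instance on
   tuples. For the Borel sigma-algebra of R it is the Borel sigma-algebra of
   R^n. *)
Definition measure_row_display : measure_display -> measure_display.
Proof. exact. Qed.

Section measurable_row.
Context {d} {T : sigmaRingType d} (n : nat).

Let coords : 'I_n -> 'rV[T]_n -> T := fun i x => x ord0 i.

Let row_set0 : g_sigma_preimage coords set0.
Proof. exact: sigma_algebra0. Qed.

Let row_setC A : g_sigma_preimage coords A -> g_sigma_preimage coords (~` A).
Proof. exact: sigma_algebraC. Qed.

Let row_bigcup (F : _^nat) : (forall i, g_sigma_preimage coords (F i)) ->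
  g_sigma_preimage coords (\bigcup_i (F i)).
Proof. exact: sigma_algebra_bigcup. Qed.

HB.instance Definition _ := @isMeasurable.Build (measure_row_display d)
  'rV[T]_n (g_sigma_preimage coords) row_set0 row_setC row_bigcup.

End measurable_row.

Lemma measurable_coord d (T : sigmaRingType d) n (i : 'I_n) :
  measurable_fun [set: 'rV[T]_n] (fun x : 'rV[T]_n => x ord0 i).
Proof.
move=> _ Y mY; rewrite setTI; apply: sub_sigma_algebra => /=.
rewrite -bigcup_seq/=; exists i => /=; first by rewrite mem_index_enum.
by exists Y => //; rewrite setTI.
Qed.

Lemma measurable_fun_rowP d1 d2 (T1 : measurableType d1) (T2 : measurableType d2)
    n (f : T1 -> 'rV[T2]_n) :
  measurable_fun [set: T1] f <->
  forall i, measurable_fun [set: T1] (fun x => f x ord0 i).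
Proof.
split=> [mf i|mf].
  exact: (measurableT_comp (@measurable_coord _ T2 n i) mf).
move=> _ A mA; rewrite setTI.
suff: preimage_set_system [set: T1] f measurable `<=` measurable.
  by apply; exists A => //; rewrite setTI.
rewrite {1}/measurable/= -(g_sigma_preimage_comp (fun i (x : 'rV[T2]_n) => x ord0 i) f).
apply: smallest_sub; first exact: sigma_algebra_measurable.
rewrite -bigcup_seq; apply: bigcup_sub => i _ B [C mC <-].
exact: mf.
Qed.

Definition cons_row (K : Type) n (p : K * 'rV[K]_n) : 'rV[K]_n.+1 :=
  \row_i if unlift ord0 i is Some j then p.2 ord0 j else p.1.

Lemma measurable_cons_row d (T : measurableType d) n :
  measurable_fun [set: T * 'rV[T]_n] (@cons_row T n).
Proof.
apply/measurable_fun_rowP => i.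
rewrite [X in measurable_fun _ X](_ : _ = fun p : T * 'rV[T]_n =>
  if unlift ord0 i is Some j then p.2 ord0 j else p.1); last first.
  by apply/funext => p; rewrite mxE.
case: (unlift ord0 i) => [j|]; last exact: measurable_fst.
exact: (measurableT_comp (@measurable_coord _ T n j) measurable_snd).
Qed.

Section lebesgue_row_step.
Context {R : realType}.
Variables (n : nat) (m : {sigma_finite_measure set 'rV[R]_n -> \bar R}).
Local Open Scope ereal_scope.

Definition lebesgue_row_step : set 'rV[R]_n.+1 -> \bar R :=
  pushforward (lebesgue_measure \x m) (@cons_row R n).

Let mcons : measurable_fun [set: measurableTypeR R * 'rV[R]_n] (@cons_row R n).
Proof. exact: (@measurable_cons_row _ (R : measurableType _)). Qed.

Let mcons_pre A : measurable A -> measurable (@cons_row R n @^-1` A).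
Proof. by move=> mA; rewrite -[X in measurable X]setTI; exact: mcons. Qed.

Let step0 : lebesgue_row_step set0 = 0.
Proof. by rewrite /lebesgue_row_step /pushforward preimage_set0 measure0. Qed.

Let step_ge0 A : 0 <= lebesgue_row_step A.
Proof. by apply: integral_ge0 => x _; exact: measure_ge0. Qed.

Let step_sigma_additive : semi_sigma_additive lebesgue_row_step.
Proof.
move=> F mF tF mUF; rewrite /lebesgue_row_step /pushforward preimage_bigcup.
apply: measure_semi_sigma_additive => [i||].
- exact: mcons_pre.
- apply/trivIsetP => /= i j _ _ ij; rewrite -preimage_setI.
  by move/trivIsetP : tF => /(_ _ _ _ _ ij) ->//; rewrite preimage_set0.
- by rewrite -preimage_bigcup; exact: mcons_pre.
Qed.

HB.instance Definition _ := isMeasure.Build _ _ _ lebesgue_row_step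
  step0 step_ge0 step_sigma_additive.

Lemma lebesgue_row_step_box (A : set R) (B : set 'rV[R]_n) :
  measurable A -> measurable B ->
  measurable [set z : 'rV[R]_n.+1 | A (z ord0 ord0) /\
     B (\row_j z ord0 (lift ord0 j))] /\
  lebesgue_row_step [set z : 'rV[R]_n.+1 | A (z ord0 ord0) /\
     B (\row_j z ord0 (lift ord0 j))] = lebesgue_measure A * m B.
Proof.
move=> mA mB; split.
  have m1 := @measurable_coord _ (R : measurableType _) n.+1 ord0.
  have m2 : measurable_fun [set: 'rV[R]_n.+1]
      (fun z : 'rV[R]_n.+1 => (\row_j z ord0 (lift ord0 j)) : 'rV[R]_n).
    apply/measurable_fun_rowP => i; under eq_fun do rewrite mxE.
    exact: measurable_coord.
  apply: (@measurableI _ _ ((fun z : 'rV[R]_n.+1 => z ord0 ord0) @^-1` A)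
     ((fun z : 'rV[R]_n.+1 => \row_j z ord0 (lift ord0 j)) @^-1` B)).
    by rewrite -[X in measurable X]setTI; exact: m1.
  by rewrite -[X in measurable X]setTI; exact: m2.
rewrite /lebesgue_row_step /pushforward -product_measure1E//; congr (_ _).
apply/seteqP; split=> -[x y] /=.
  rewrite /= mxE unlift_none => -[Ax]; rewrite (_ : \row_j _ = y)//.
  by apply/rowP => j; rewrite !mxE liftK.
rewrite mxE unlift_none => -[Ax By]; split=> //; rewrite (_ : \row_j _ = y)//.
by apply/rowP => j; rewrite !mxE liftK.
Qed.

Let step_sigma_finite : sigma_finite setT lebesgue_row_step.
Proof.
have /sigma_finiteP[F [TF ndF Foo]] := sigma_finiteT (@lebesgue_measure R).
have /sigma_finiteP[G [TG ndG Goo]] := sigma_finiteT m.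
exists (fun k => [set z : 'rV[R]_n.+1 | F k (z ord0 ord0) /\
     G k (\row_j z ord0 (lift ord0 j))]).
  apply/esym; rewrite -subTset => z _.
  have [i _ Fi] : (\bigcup_i F i) (z ord0 ord0) by rewrite -TF.
  have [j _ Gj] : (\bigcup_i G i) (\row_j z ord0 (lift ord0 j)) by rewrite -TG.
  exists (maxn i j) => //; split.
    by move: Fi; exact/subsetPset/ndF/leq_maxl.
  by move: Gj; exact/subsetPset/ndG/leq_maxr.
move=> k; have [mF Fk] := Foo k; have [mG Gk] := Goo k.
have [mB ->] := lebesgue_row_step_box mF mG; split => //.
by rewrite lte_mul_pinfty// ge0_fin_numE.
Qed.

HB.instance Definition _ := Measure_isSigmaFinite.Build _ _ _ lebesgue_row_step
  step_sigma_finite.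

End lebesgue_row_step.

(* N-dimensional Lebesgue measure: the Dirac mass on the one-point space R^0,
   then one product with the one-dimensional Lebesgue measure per coordinate. *)
Fixpoint lebesgue_row {R : realType} n :
    {sigma_finite_measure set 'rV[R]_n -> \bar R} :=
  match n with
  | 0 => \d_(0 : 'rV[R]_0)
  | n'.+1 => lebesgue_row_step (lebesgue_row n')
  end.

Lemma lebesgue_row_box {R : realType} n (A : 'I_n -> set R) :
  (forall i, measurable (A i)) ->
  measurable [set x : 'rV[R]_n | forall i, A i (x ord0 i)] /\
  lebesgue_row n [set x : 'rV[R]_n | forall i, A i (x ord0 i)] =
  (\prod_(i < n) lebesgue_measure (A i))%E.
Proof.
elim: n A => [|n IH] A mA.
  rewrite (_ : [set _ | _] = setT); last by apply/seteqP; split=> // x _ [].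
  by split=> //=; rewrite big_ord0 diracE in_setT.
have [mB EB] := IH (fun j => A (lift ord0 j)) (fun j => mA _).
have [mC EC] := lebesgue_row_step_box (lebesgue_row n) (mA ord0) mB.
rewrite (_ : [set x : 'rV[R]_n.+1 | forall i, A i (x ord0 i)] =
  [set z : 'rV[R]_n.+1 | A ord0 (z ord0 ord0) /\
    [set x : 'rV[R]_n | forall i, A (lift ord0 i) (x ord0 i)]
      (\row_j z ord0 (lift ord0 j))]).
  by split => //; rewrite [LHS]EC EB big_ord_recl.
apply/seteqP; split=> z /= => [h|[h0 h] i].
  by split=> // i; rewrite mxE.
by case: (unliftP ord0 i) => [j ->|->//]; have := h j; rewrite mxE.
Qed.

Section hardy_heat.
Context {R : realType} {N : nat}.
Notation RN := 'rV[R]_N.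
Notation mu := (lebesgue_row N : {measure set RN -> \bar R}).

(* The norm `|x| of the library on row vectors is the sup norm. *)
Definition enorm (x : RN) : R := Num.sqrt (\sum_(i < N) x ord0 i ^+ 2).

Definition heat_kernel (t : R) (x : RN) : R :=
  (4 * pi * t) `^ (- (N%:R / 2)) * expR (- (enorm x ^+ 2 / (4 * t))).

(* e^{t Delta} f for t >= 0 *)
Definition heat (t : R) (f : RN -> R) : RN -> R :=
  if 0 < t then fun x => \int[mu]_y (heat_kernel t (x - y) * f y) else f.

(* `^ is 0 at base 0, so |.|^l is set to 0 at the origin, a null set. *)
Definition hardy_nonlinearity (l alpha : R) (f : RN -> R) : RN -> R :=
  fun x => enorm x `^ l * `|f x| `^ alpha * f x.

(* sigma |-> e^{(t - sigma) Delta} (|.|^l |u(sigma)|^alpha u(sigma)) *)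
Definition duhamel_integrand (l alpha : R) (u : R -> RN -> R) (t sigma : R) :
    RN -> R :=
  heat (t - sigma) (hardy_nonlinearity l alpha (u sigma)).

(* Continuous functions vanishing at infinity. *)
Definition C0 : set (RN -> R) := [set f | continuous f /\
  forall e : R, 0 < e -> exists M : R, forall x, M < enorm x -> `|f x| < e].

Definition Lp (p : \bar R) : set (RN -> R) := [set f | f \in Lfun mu p].

(* u is in C(I; E), where the norm of E is the L^p norm; elements of L^p are
   represented by measurable functions, so that continuity in time is stated
   with the seminorm on representatives. *)
Definition time_continuous (p : \bar R) (E : set (RN -> R)) (I : set R)
    (u : R -> RN -> R) : Prop :=
  (forall t, I t -> E (u t)) /\
  (forall t, I t ->
    ('N[mu]_p[ (fun x => (u s x - u t x)%R%:E) ] @[s --> within I (nbhs t)] --> 0)%E).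

Definition time_interval (T : \bar R) : set R := [set t | 0 <= t /\ (t%:E < T)%E].
Definition open_time_interval (T : \bar R) : set R :=
  [set t | 0 < t /\ (t%:E < T)%E].

(* The time integral is a Bochner integral in the space whose norm is the L^p
   norm: the norms of the integrand are integrable on ]0, t[, and the value of
   the integral is, for almost every x, the integral of the values at x. *)
Definition mild_equation (p : \bar R) (l alpha : R) (u0 : RN -> R) (T : \bar R)
    (u : R -> RN -> R) : Prop :=
  forall t, time_interval T t ->
    (\int[lebesgue_measure]_(sigma in `]0%R, t[)
       'N[mu]_p[EFin \o duhamel_integrand l alpha u t sigma] < +oo)%E /\
    {ae mu, forall x,
      lebesgue_measure.-integrable `]0, t[
        (fun sigma => (duhamel_integrand l alpha u t sigma x)%:E) /\
      u t x = heat t u0 x +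
        \int[lebesgue_measure]_(sigma in `]0, t[)
           duhamel_integrand l alpha u t sigma x}.

Definition Lq_solution (q r l alpha : R) (u0 : RN -> R) (T : \bar R)
    (u : R -> RN -> R) : Prop :=
  [/\ (0 < T)%E,
      time_continuous q%:E (Lp q%:E) (time_interval T) u,
      time_continuous r%:E (Lp r%:E) (open_time_interval T) u &
      mild_equation q%:E l alpha u0 T u].

Definition C0_solution (l alpha : R) (u0 : RN -> R) (T : \bar R)
    (u : R -> RN -> R) : Prop :=
  [/\ (0 < T)%E,
      time_continuous +oo%E C0 (time_interval T) u &
      mild_equation +oo%E l alpha u0 T u].

(* u is a solution on [0, T[ and no solution lives longer: T is the existence
   time of the maximal solution. *)
Definition maximal_solution (sol : \bar R -> (R -> RN -> R) -> Prop)
    (T : \bar R) (u : R -> RN -> R) : Prop :=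
  sol T u /\ forall T' v, sol T' v -> (T' <= T)%E.

End hardy_heat.

(* Main.v *)
(* Write [g = - l] and [f v = |v|^al v]. If the norm of [u0] is at most [A], a
   solution is built on [0 <= t < T] with [T = C A^(-1/beta)],
   [beta = (2+l)/(2 al) - N/(2q)]; the existence time is then at least [T]. No contraction is needed. For the datum [|u0|] the equation
   with nonlinearity [|y|^(-g) f(w)] is monotone in [w], so that its iteration
   from [0] increases; the smoothing estimates of the heat semigroup (the weight
   being split at [|y| = sqrt t]) keep the iterates in the class
   [w(t,x) <= 8 A t^(-N/2q)], [||w(t)||_q <= 8 A] when [T] is as above, and the
   limit [w] is a solution by monotone convergence. The equation with datum
   [|u0| - u0] and nonlinearity [|y|^(-g) (f(w) - f(w - z))] is monotone in [z]
   for the same reason, has a solution [0 <= z <= 2 w], and [u = w - z] solves the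
   original equation. Continuity in time comes from the semigroup property and the
   strong continuity of the semigroup. The pointwise bound on [w] controls every
   L^r norm with [r > q], hence [C] does not depend on [r]. *)
Require Import Defs.
From mathcomp Require Import all_boot all_order all_algebra finmap.
From mathcomp Require Import all_classical all_reals all_analysis.
From mathcomp Require Import measurable_realfun ess_sup_inf ring lra.

Import Order.TTheory GRing.Theory Num.Theory.
Import numFieldNormedType.Exports.

Set Implicit Arguments.
Unset Strict Implicit.
Unset Printing Implicit Defensive.

Local Open Scope classical_set_scope.
Local Open Scope ring_scope.

(** Only q > 1 and q > q_c(l) are available, so q / (al + 1) may be less than 1 and w^(al+1), for w
    in L^q, need not even be locally integrable. This dictates a class with two bounds: w^(al+1) is
    split as w^(al+1-th) w^th, the first factor controlled by the pointwise decay t^(-N/2q), the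
    second by the L^q norm, for a suitable auxiliary exponent [th]. Each Duhamel estimate then
    carries the same factor M^(al+1) t^dl, where dl = 1 - g/2 - N al/(2q) is positive because q is
    subcritical (in C_0, read N/(2q) as 0). With M = 8 A the class is stable as soon as 8 K M^al
    T^dl <= 1; since dl / al = beta, this is T = C A^(-1/beta). Integrals are taken of functions
    with values in [0, +oo], where Tonelli's theorem and monotone convergence require no
    integrability; [fine] is applied once finiteness is known. A norm is a predicate (the norm of f
    is at most B) with the crude constant 4 in the triangle inequality, whence 8 = 4 (1 + 1). *)

(** * Young's and Jensen's inequalities *)

Section weighted_jensen.
Context {R : realType}.

(** Young's inequality for a / b and 1 with conjugate exponents q and q / (q - 1), multiplied by b.
    The free parameter b is optimized in [weighted_jensen]. *)
Lemma young_powR (a b q : R) : 0 <= a -> 0 < b -> 1 <= q ->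
  a <= (1 - q^-1) * b + b `^ (1 - q) / q * a `^ q.
Proof.
move=> a0 b0 q1; have q0 : 0 < q by lra.
have [q1'|qn1] := eqVneq q 1.
  by rewrite q1' invr1 subrr powRr0 powRr1//; lra.
have q1' : 0 < q - 1 by move: qn1; rewrite -subr_eq0 => ?; rewrite lt_neqAle eq_sym; apply/andP; split => //; lra.
have q'0 : 0 < q / (q - 1) by rewrite divr_gt0.
have := @conjugate_powR R (a / b) 1 q (q / (q - 1)).
rewrite (divr_ge0 a0 (ltW b0)) => /(_ isT ler01 q0 q'0).
have -> : q^-1 + (q / (q - 1))^-1 = 1 by field; rewrite !gt_eqF.
move=> /(_ erefl); rewrite mulr1 powR1 => H.
have bE : b `^ (1 - q) = b / b `^ q.
  by rewrite powRB ?(gt_eqF b0) ?implybT// (powRr1 (ltW b0)).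
have abE : (a / b) `^ q = a `^ q / b `^ q.
  rewrite powRM ?invr_ge0 ?(ltW b0)// -(powR_inv1 (ltW b0)) -powRrM mulN1r.
  by rewrite powRN.
have bq0 : 0 < b `^ q by rewrite powR_gt0.
move: H; rewrite ler_pdivrMr// abE => /le_trans; apply.
rewrite bE le_eqVlt; apply/orP; left; apply/eqP; field.
by rewrite !gt_eqF.
Qed.

Local Open Scope ereal_scope.

Lemma young_poweR (a : \bar R) (b q : R) : 0 <= a -> (0 < b)%R -> (1 <= q)%R ->
  a <= ((1 - q^-1) * b)%:E + (b `^ (1 - q) / q)%:E * a `^ q.
Proof.
move=> a0 b0 q1; have q0 : (0 < q)%R by apply: lt_le_trans q1.
case: a a0 => [a|_|//].
  by rewrite lee_fin => a0; rewrite poweR_EFin -EFinM -EFinD lee_fin; exact: young_powR.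
by rewrite poweRyr ?gt_eqF// gt0_muley ?lte_fin ?divr_gt0 ?powR_gt0.
Qed.

(** Jensen's inequality for the measure k dmu, of mass at most I: Young's inequality is integrated
    against k, and b is then chosen. It is the common source of the L^q contraction of the
    semigroup, of Hoelder's inequality and of Minkowski's integral inequality below. *)
Lemma weighted_jensen d (T : measurableType d) (mu : {measure set T -> \bar R})
    (D : set T) (k f : T -> \bar R) (q I : R) :
  measurable D -> measurable_fun D k -> measurable_fun D f ->
  (forall x, D x -> 0 <= k x) -> (forall x, D x -> 0 <= f x) ->
  (1 <= q)%R -> (0 < I)%R -> \int[mu]_(x in D) k x <= I%:E ->
  (\int[mu]_(x in D) (k x * f x)) `^ q <=
    (I `^ (q - 1))%:E * \int[mu]_(x in D) (k x * f x `^ q).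
Proof.
move=> mD mk mf k0 f0 q1 I0 kI; have q0 : (0 < q)%R by apply: lt_le_trans q1.
have mfq : measurable_fun D (fun x => f x `^ q).
  exact: (measurableT_comp (measurable_poweR _)).
have kfq0 x : D x -> 0 <= k x * f x `^ q by move=> Dx; rewrite mule_ge0 ?poweR_ge0 ?k0.
have kf0 x : D x -> 0 <= k x * f x by move=> Dx; rewrite mule_ge0 ?k0 ?f0.
set J := \int[mu]_(x in D) (k x * f x `^ q).
have J0 : 0 <= J by exact: integral_ge0.
have key b : (0 < b)%R -> \int[mu]_(x in D) (k x * f x) <=
    ((1 - q^-1) * b * I)%:E + (b `^ (1 - q) / q)%:E * J.
  move=> b0.
  have c0 : (0 <= (1 - q^-1) * b)%R by rewrite mulr_ge0 ?(ltW b0)// subr_ge0 invf_le1.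
  have c'0 : (0 <= b `^ (1 - q) / q)%R by rewrite divr_ge0 ?powR_ge0 ?(ltW q0).
  apply: (@le_trans _ _ (\int[mu]_(x in D) (((1 - q^-1) * b)%:E * k x +
     (b `^ (1 - q) / q)%:E * (k x * f x `^ q)))).
    apply: ge0_le_integral => //.
    - exact: emeasurable_funM.
    - apply: emeasurable_funD; first exact: measurable_funeM.
      by apply: measurable_funeM; exact: emeasurable_funM.
    - move=> x Dx; apply: (@le_trans _ _ (k x * (((1 - q^-1) * b)%:E + (b `^ (1 - q) / q)%:E * f x `^ q))).
        by rewrite lee_wpmul2l ?k0// young_poweR// f0.
      rewrite ge0_muleDr ?lee_fin// ?mule_ge0 ?poweR_ge0// ?lee_fin//.
      by rewrite muleC muleCA.
  rewrite ge0_integralD//=; last 4 first.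
  - by move=> x Dx; rewrite mule_ge0 ?k0 ?lee_fin.
  - exact: measurable_funeM.
  - by move=> x Dx; rewrite mule_ge0 ?lee_fin ?kfq0.
  - by apply: measurable_funeM; exact: emeasurable_funM.
  rewrite !ge0_integralZl//; [|exact: emeasurable_funM].
  by rewrite leeD2r// [leRHS]EFinM lee_wpmul2l ?lee_fin.
have Iq0 : (0 < I `^ (q - 1))%R by rewrite powR_gt0.
have [Jy|Jfin] := eqVneq J +oo.
  by rewrite Jy gt0_muley ?lte_fin// leey.
have {Jfin} : J \is a fin_num by rewrite ge0_fin_numE// lt_neqAle Jfin leey.
move: J0 key; rewrite -/J; case: J => [J||]//; rewrite lee_fin => J0 key _.
have [J00|Jn0] := eqVneq J 0%R.
  suff -> : \int[mu]_(x in D) (k x * f x) = 0 by rewrite poweR0r ?gt_eqF// mule_ge0 ?lee_fin ?powR_ge0.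
  apply/eqP; rewrite eq_le integral_ge0// andbT; apply/lee_addgt0Pr => e e0.
  (* When J = 0 only the term linear in b survives, and b can be taken arbitrarily small. *)
  have eI : (0 < e / I)%R by rewrite divr_gt0.
  apply: (le_trans (key _ eI)); rewrite J00 mule0 adde0 add0e lee_fin.
  rewrite -mulrA divfK ?gt_eqF// ler_piMl ?(ltW e0)//.
  have : (0 < q^-1)%R by rewrite invr_gt0. lra.
have {}J0 : (0 < J)%R by rewrite lt_neqAle eq_sym Jn0.
(* The value of b that minimizes the bound [key]: the derivative in b vanishes when b^q = J / I. *)
pose b := ((J / I) `^ q^-1)%R.
have b0 : (0 < b)%R by rewrite powR_gt0// divr_gt0.
have bq : (b `^ q = J / I)%R.
  by rewrite /b -powRrM mulVf ?gt_eqF// powRr1// divr_ge0 ?(ltW I0) ?(ltW J0).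
have bI : \int[mu]_(x in D) (k x * f x) <= (b * I)%:E.
  apply: (le_trans (key _ b0)); rewrite -EFinM -EFinD lee_fin.
  rewrite powRB ?(gt_eqF b0) ?implybT// (powRr1 (ltW b0)) bq.
  rewrite le_eqVlt; apply/orP; left; apply/eqP; field.
  by rewrite !gt_eqF.
apply: (@le_trans _ _ ((b * I)%:E `^ q)).
  apply: gt0_ler_poweR => //; rewrite ?(ltW q0)// in_itv/= leey andbT ?integral_ge0//.
  by rewrite lee_fin (mulr_ge0 (ltW b0) (ltW I0)).
rewrite poweR_EFin -EFinM lee_fin (powRM _ (ltW b0) (ltW I0)) bq.
rewrite powRB ?(gt_eqF I0) ?implybT// (powRr1 (ltW I0)).
rewrite le_eqVlt; apply/orP; left; apply/eqP; field.
by rewrite !gt_eqF.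
Qed.

End weighted_jensen.

(** * Integration over row vectors, one coordinate at a time *)

Section lebesgue_row_integral.
Context {R : realType}.
Local Open Scope ereal_scope.

Lemma ge0_integral_row_cons n (f : 'rV[R]_n.+1 -> \bar R) :
  measurable_fun [set: 'rV[R]_n.+1] f -> (forall x, 0 <= f x) ->
  \int[lebesgue_row n.+1]_z f z =
  \int[lebesgue_measure]_a \int[lebesgue_row n]_x f (cons_row (a, x)).
Proof.
move=> mf f0.
have mc : measurable_fun [set: measurableTypeR R * 'rV[R]_n] (@cons_row R n).
  exact: (@measurable_cons_row _ (R : measurableType _)).
transitivity (\int[pushforward (lebesgue_measure \x lebesgue_row n) (@cons_row R n)]_z f z).
  by [].
rewrite ge0_integral_pushforward// preimage_setT.
rewrite fubini_tonelli1//=; exact: (measurableT_comp mf mc).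
Qed.

Lemma integral_row_prod n (f : 'I_n -> R -> R) :
  (forall i, measurable_fun [set: R] (f i)) -> (forall i x, (0 <= f i x)%R) ->
  \int[lebesgue_row n]_x (\prod_(i < n) f i (x ord0 i))%:E =
  \prod_(i < n) \int[lebesgue_measure]_a (f i a)%:E.
Proof.
elim: n f => [|n IH] f mf f0.
  rewrite big_ord0; under eq_integral do rewrite big_ord0.
  by rewrite /= integral_dirac//= diracE in_setT mul1e.
have mprod m (g : 'I_m -> R -> R) : (forall i, measurable_fun [set: R] (g i)) ->
    measurable_fun [set: 'rV[R]_m] (fun x : 'rV[R]_m => \prod_(i < m) g i (x ord0 i))%R.
  move=> mg; apply: measurable_prod => i _.
  exact: (measurableT_comp (mg i) (@measurable_coord _ _ _ i)).
rewrite ge0_integral_row_cons; last 2 first.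
- by apply/measurable_EFinP; exact: mprod.
- by move=> x; rewrite lee_fin prodr_ge0.
rewrite big_ord_recl -IH//.
have inner a : \int[lebesgue_row n]_x
      (\prod_(i < n.+1) f i (cons_row (a, x) ord0 i))%:E =
    (f ord0 a)%:E * \int[lebesgue_row n]_x
      (\prod_(i < n) f (lift ord0 i) (x ord0 i))%:E.
  rewrite -ge0_integralZl//.
  - apply: eq_integral => x _; rewrite big_ord_recl mxE unlift_none EFinM.
    by congr (_ * _%:E); apply: eq_bigr => i _; rewrite mxE liftK.
  - by apply/measurable_EFinP; exact: (mprod _ (fun i => f (lift ord0 i))).
  - by move=> x _; rewrite lee_fin prodr_ge0.
  - by rewrite lee_fin.
under eq_integral do rewrite inner.
rewrite ge0_integralZr//.
- by apply/measurable_EFinP; exact: mf.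
- by move=> x _; rewrite lee_fin.
- by apply: integral_ge0 => x _; rewrite lee_fin prodr_ge0.
Qed.

End lebesgue_row_integral.
(** * Heat kernel *)

Section gaussian.
Context {R : realType}.

(** The heat kernel in dimension one, that is, the centred normal density of variance 2 t. *)
Definition gauss1 (t x : R) : R :=
  (4 * pi * t) `^ (- 2^-1) * expR (- (x ^+ 2 / (4 * t))).

Lemma gauss1_ge0 t x : 0 <= gauss1 t x.
Proof. by rewrite mulr_ge0 ?powR_ge0 ?expR_ge0. Qed.

Lemma gauss1N t x : gauss1 t (- x) = gauss1 t x.
Proof. by rewrite /gauss1 sqrrN. Qed.

Lemma gauss1_normal_pdf t m y : 0 < t ->
  gauss1 t (y - m) = normal_pdf m (Num.sqrt (2 * t)) y.
Proof.
move=> t0; have t20 : 0 < 2 * t by rewrite mulr_gt0.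
rewrite normal_pdfE ?gt_eqF ?sqrtr_gt0// /normal_peak /normal_fun.
rewrite sqr_sqrtr ?(ltW t20)// /gauss1; congr (_ * expR _).
  rewrite powRN powR12_sqrt; last by rewrite !mulr_ge0 ?pi_ge0 ?(ltW t0).
  by congr (Num.sqrt _)^-1; rewrite -mulr_natr; ring.
by rewrite -mulNr -mulr_natr; congr (_ / _); ring.
Qed.

Lemma measurable_gauss1 t : measurable_fun [set: R] (gauss1 t).
Proof.
apply: measurable_funM => //; apply: measurableT_comp => //.
by apply: measurable_funN; exact: measurable_funM.
Qed.

Lemma integral_gauss1 t x : 0 < t ->
  (\int[lebesgue_measure]_y (gauss1 t (x - y))%:E = 1)%E.
Proof.
move=> t0; rewrite -(integral_normal_pdf x (Num.sqrt (2 * t))).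
by apply: eq_integral => y _; rewrite -gauss1_normal_pdf// -gauss1N opprB.
Qed.

(** Completion of the square in y: the product is a Gaussian in y, centred at the weighted mean of x
    and z, times the kernel at time t + s. Integrating in y yields the semigroup law. *)
Lemma gauss1M t s x y z : 0 < t -> 0 < s ->
  gauss1 t (x - y) * gauss1 s (y - z) = gauss1 (t + s) (x - z) *
    gauss1 (t * s / (t + s)) ((s * x + t * z) / (t + s) - y).
Proof.
move=> t0 s0; have ts0 : 0 < t + s by rewrite addr_gt0.
have pi0 := pi_gt0 R.
rewrite /gauss1 mulrACA [RHS]mulrACA -!expRD -!powRM; last 4 first.
- by rewrite !mulr_ge0 ?ltW.
- by rewrite !mulr_ge0 ?invr_ge0 ?ltW.
- by rewrite !mulr_ge0 ?ltW.
- by rewrite !mulr_ge0 ?ltW.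
congr (_ `^ _ * expR _).
  by field; rewrite gt_eqF.
by field; rewrite !gt_eqF.
Qed.

Lemma integral_gauss1M t s x z : 0 < t -> 0 < s ->
  (\int[lebesgue_measure]_y (gauss1 t (x - y) * gauss1 s (y - z))%:E =
   (gauss1 (t + s) (x - z))%:E)%E.
Proof.
move=> t0 s0; under eq_integral do rewrite gauss1M// EFinM.
rewrite ge0_integralZl//.
- by rewrite integral_gauss1 ?mule1// divr_gt0 ?mulr_gt0 ?addr_gt0.
- apply/measurable_EFinP; apply: (measurableT_comp (measurable_gauss1 _)).
  by apply: measurable_funB.
- by move=> y _; rewrite lee_fin gauss1_ge0.
- by rewrite lee_fin gauss1_ge0.
Qed.

End gaussian.

Section heat_kernel.
Context {R : realType} {N : nat}.
Notation RN := 'rV[R]_N.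
Notation mu := (lebesgue_row N : {measure set RN -> \bar R}).
Notation G := (@heat_kernel R N).

Lemma enorm_ge0 (x : RN) : 0 <= enorm x.
Proof. exact: sqrtr_ge0. Qed.

Lemma enorm_sqr (x : RN) : enorm x ^+ 2 = \sum_(i < N) x ord0 i ^+ 2.
Proof. by rewrite sqr_sqrtr// sumr_ge0// => i _; rewrite sqr_ge0. Qed.

Lemma enormN (x : RN) : enorm (- x) = enorm x.
Proof. by congr Num.sqrt; apply: eq_bigr => i _; rewrite mxE sqrrN. Qed.

Lemma enormC (x y : RN) : enorm (x - y) = enorm (y - x).
Proof. by rewrite -enormN opprB. Qed.

Lemma heat_kernel_prod t (x : RN) : 0 < t ->
  G t x = \prod_(i < N) gauss1 t (x ord0 i).
Proof.
move=> t0; have pi0 := pi_gt0 R.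
rewrite /heat_kernel big_split /=; congr (_ * _).
  rewrite prodr_const card_ord -powR_mulrn ?powR_ge0// -powRrM.
  by congr (_ `^ _); rewrite mulNr mulrC.
by rewrite enorm_sqr mulr_suml -sumrN expR_sum.
Qed.

Lemma heat_kernel_ge0 t (x : RN) : 0 <= G t x.
Proof. by rewrite mulr_ge0 ?powR_ge0 ?expR_ge0. Qed.

Lemma heat_kernelN t (x : RN) : G t (- x) = G t x.
Proof. by rewrite /heat_kernel enormN. Qed.

Lemma heat_kernelC t (x y : RN) : G t (x - y) = G t (y - x).
Proof. by rewrite -heat_kernelN opprB. Qed.

Lemma heat_kernel_ub t (x : RN) : 0 < t -> G t x <= (4 * pi * t) `^ (- (N%:R / 2)).
Proof.
move=> t0; rewrite /heat_kernel ler_piMr ?powR_ge0// -[leRHS]expR0 ler_expR.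
by rewrite oppr_le0 divr_ge0 ?sqr_ge0// mulr_ge0 ?ltW.
Qed.

(** Half of the Gaussian exponent is spent on the factor exp(-d^2/(8t)); the other half is the
    exponent of the kernel at time 2t, and 2^(N/2) is the ratio of the normalizations. *)
Lemma heat_kernel_far t (x : RN) (d : R) : 0 < t -> 0 <= d -> d <= enorm x ->
  G t x <= 2 `^ (N%:R / 2) * expR (- (d ^+ 2 / (8 * t))) * G (2 * t) x.
Proof.
move=> t0 d0 dx; have pi0 := pi_gt0 R; rewrite /heat_kernel.
have -> : 4 * pi * (2 * t) = 2 * (4 * pi * t) by ring.
rewrite (powRM _ (ler0n _ 2)) ?mulr_ge0 ?(ltW pi0) ?(ltW t0)//.
rewrite [leRHS](_ : _ = (2 `^ (N%:R / 2) * 2 `^ (- (N%:R / 2))) *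
  ((4 * pi * t) `^ (- (N%:R / 2)) *
  (expR (- (d ^+ 2 / (8 * t))) * expR (- (enorm x ^+ 2 / (4 * (2 * t))))))); last by ring.
rewrite -powRD ?pnatr_eq0 ?implybT// subrr powRr0 mul1r ler_wpM2l ?powR_ge0//.
rewrite -expRD ler_expR -opprD lerN2.
have -> : 4 * (2 * t) = 8 * t by ring.
rewrite -mulrDl ler_pdivrMr ?mulr_gt0//.
have -> : enorm x ^+ 2 / (4 * t) * (8 * t) = 2 * enorm x ^+ 2 by field; rewrite gt_eqF.
have : d ^+ 2 <= enorm x ^+ 2 by rewrite ler_sqr ?nnegrE ?enorm_ge0.
lra.
Qed.

Lemma measurable_enorm d (T : measurableType d) (f : T -> RN) :
  measurable_fun [set: T] f -> measurable_fun [set: T] (fun x => enorm (f x)).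
Proof.
move=> mf; rewrite (_ : (fun x => _) = (fun x => (\sum_(i < N) f x ord0 i ^+ 2) `^ 2^-1)).
  2: by apply/funext => x; rewrite powR12_sqrt// sumr_ge0// => i _; rewrite sqr_ge0.
apply: (measurableT_comp (measurable_powR _)).
apply: measurable_sum => i; apply: measurable_funX.
exact: (measurableT_comp (@measurable_coord _ _ N i) mf).
Qed.

Lemma measurable_rowB d (T : measurableType d) (f g : T -> RN) :
  measurable_fun [set: T] f -> measurable_fun [set: T] g ->
  measurable_fun [set: T] (fun x => f x - g x).
Proof.
move=> mf mg; apply/measurable_fun_rowP => i; under eq_fun do rewrite !mxE.
by apply: measurable_funB; exact: (measurableT_comp (@measurable_coord _ _ N i)).
Qed.

Lemma measurable_heat_kernel d (T : measurableType d) (f : T -> R) (g : T -> RN) :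
  measurable_fun [set: T] f -> measurable_fun [set: T] g ->
  measurable_fun [set: T] (fun x => G (f x) (g x)).
Proof.
move=> mf mg; apply: measurable_funM.
  apply: (measurableT_comp (measurable_powR _)).
  exact: measurable_funM.
apply: measurableT_comp => //; apply: measurable_funN.
apply: measurable_funM; first by apply: measurable_funX; exact: measurable_enorm.
apply: (measurableT_comp (f := fun x : R => x^-1)).
  (* Measurability of the inverse is reduced to that of a real power; both sides are 0 at 0. *)
  rewrite (_ : (fun x => x^-1) = (fun x => x * (x ^+ 2) `^ (-1))).
    apply: measurable_funM => //; apply: (measurableT_comp (measurable_powR _)).
    exact: measurable_funX.
  apply/funext => x; rewrite powR_inv1 ?sqr_ge0//.
  have [->|x0] := eqVneq x 0; first by rewrite mul0r invr0.
  by field.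
exact: measurable_funM.
Qed.

Lemma integral_heat_kernel t (x : RN) : 0 < t ->
  (\int[mu]_y (G t (x - y))%:E = 1)%E.
Proof.
move=> t0; under eq_integral do rewrite heat_kernel_prod//.
under eq_integral => y _ do under eq_bigr => i _ do rewrite !mxE.
rewrite (integral_row_prod (f := fun i y => gauss1 t (x ord0 i - y))).
- by rewrite big1// => i _; rewrite integral_gauss1.
- move=> i; apply: (measurableT_comp (measurable_gauss1 _)).
  exact: measurable_funB.
- by move=> *; exact: gauss1_ge0.
Qed.

Lemma integral_heat_kernelC t (y : RN) : 0 < t ->
  (\int[mu]_x (G t (x - y))%:E = 1)%E.
Proof.
move=> t0; rewrite -(integral_heat_kernel y t0).
by apply: eq_integral => x _; rewrite heat_kernelC.
Qed.

Lemma integral_heat_kernelM t s (x z : RN) : 0 < t -> 0 < s ->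
  (\int[mu]_y (G t (x - y) * G s (y - z))%:E = (G (t + s) (x - z))%:E)%E.
Proof.
move=> t0 s0; have ts0 : 0 < t + s by rewrite addr_gt0.
under eq_integral do rewrite !heat_kernel_prod// -big_split/=.
under eq_integral => y _ do under eq_bigr => i _ do rewrite !mxE.
rewrite (integral_row_prod (f := fun i y => gauss1 t (x ord0 i - y) * gauss1 s (y - z ord0 i))).
- rewrite heat_kernel_prod// -prodEFin; apply: eq_bigr => i _.
  by rewrite integral_gauss1M// !mxE.
- move=> i; apply: measurable_funM;
  by apply: (measurableT_comp (measurable_gauss1 _)); exact: measurable_funB.
- by move=> *; rewrite mulr_ge0 ?gauss1_ge0.
Qed.

End heat_kernel.

(** * Integrals of powers on intervals *)

Section power_integrals.
Context {R : realType}.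
Notation leb := (@lebesgue_measure R).

(** The integrand may blow up at both ends: the fundamental theorem of calculus is applied on
    segments that exhaust ]s, t[, followed by monotone convergence. *)
Lemma integral_itvoo_le (f F : R -> R) (s t A : R) :
  {in `]s, t[, forall x, is_derive x (1 : R) F (f x)} ->
  {in `]s, t[, forall x, {for x, continuous f}} ->
  {in `]s, t[, forall x, 0 <= f x} ->
  {in `]s, t[ &, forall x y, F y - F x <= A} -> 0 <= A ->
  (\int[leb]_(x in `]s, t[) (f x)%:E <= A%:E)%E.
Proof.
move=> dF cf f0 FA A0.
have [ts|st] := leP t s.
  by rewrite set_itv_ge ?bnd_simp -?leNgt// integral_set0.
(* A denominator greater than 2 makes each segment [s + d n, t - d n] nondegenerate, from n = 0
   on. *)
pose d n : R := (t - s) / (n.+3)%:R.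
have d0 n : 0 < d n by rewrite divr_gt0// subr_gt0.
have d2 n : d n < (t - s) / 2.
  by rewrite ltr_pM2l ?subr_gt0// ltf_pV2 ?posrE// ltr_nat.
pose I n := `[s + d n, t - d n]%classic.
have dI n x : s + d n <= x <= t - d n -> x \in `]s, t[.
  move=> /andP[h1 h2]; have := d0 n; have := d2 n => *; rewrite in_itv/=; lra.
have dF1 x : x \in `]s, t[ -> derivable F x 1 by move=> /dF[].
have cF x : x \in `]s, t[ -> {for x, continuous F}.
  by move=> /dF1 h; apply/differentiable_continuous/derivable1_diffP.
have UI : \bigcup_n I n = `]s, t[%classic.
  apply/seteqP; split => [x [n _]|x] /=.
    by rewrite in_itv/= => /dI.
  rewrite in_itv/= => /andP[sx xt].
  pose m := Num.min (x - s) (t - x).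
  have m0 : 0 < m by rewrite lt_min !subr_gt0 sx xt.
  have : 0 <= (t - s) / m by rewrite divr_ge0 ?ltW// subr_gt0.
  move=> /Num.Theory.archi_boundP; set n := Num.bound _ => nP.
  exists n => //; rewrite /I /= in_itv/=.
  have : d n <= m.
    rewrite /d ler_pdivrMr// mulrC -ler_pdivrMr//.
    by apply: (le_trans (ltW nP)); rewrite ler_nat; do 3 apply: leqW.
  by rewrite le_min => /andP[? ?]; apply/andP; split; lra.
have mf n : measurable_fun (I n) (fun x => (f x)%:E).
  apply/measurable_EFinP; apply: subspace_continuous_measurable_fun; first exact: measurable_itv.
  apply: continuous_in_subspaceT => x; rewrite inE /I /= in_itv/= => /dI.
  exact: cf.
have ndI : nondecreasing_seq I.
  move=> m n mn; apply/subsetPset => x; rewrite /I /= !in_itv/= => /andP[h1 h2].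
  have : d n <= d m.
    by rewrite ler_pM2l ?subr_gt0// lef_pV2 ?posrE// ler_nat !ltnS.
  by move=> ?; apply/andP; split; lra.
have mI n : measurable (I n) by exact: measurable_itv.
have If0 n x : I n x -> (0 <= (f x)%:E)%E.
  by rewrite /I /= in_itv/= lee_fin => /dI/f0.
rewrite -UI.
have /cvg_lim <-// := ge0_nondecreasing_set_cvg_integral (mu := leb) ndI mI mf If0.
apply: lime_le; first by apply: ereal_nondecreasing_is_cvgn;
  exact: ge0_nondecreasing_set_nondecreasing_integral.
apply: nearW => n.
have ab : s + d n < t - d n by have := d2 n; lra.
have da : s + d n \in `]s, t[ by apply: (@dI n); rewrite lexx ltW.
have db : t - d n \in `]s, t[ by apply: (@dI n); rewrite lexx ltW.
rewrite (@continuous_FTC2 _ f F)//.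
- by rewrite -EFinB lee_fin FA.
- apply: continuous_in_subspaceT => x; rewrite inE /I /= in_itv/= => /dI.
  exact: cf.
- split.
  + move=> x; rewrite in_itv/= => /andP[/ltW h1 /ltW h2].
    by apply/dF1/(@dI n); rewrite h1 h2.
  + by apply: cvg_at_right_filter; exact: cF.
  + by apply: cvg_at_left_filter; exact: cF.
- move=> x; rewrite in_itv/= => /andP[/ltW h1 /ltW h2].
  have /dF[_ E] : x \in `]s, t[ by apply: (@dI n); rewrite h1 h2.
  by rewrite derive1E.
Qed.

Lemma integral_powRr_le (s t b : R) : s <= t -> b < 1 ->
  (\int[leb]_(x in `]s, t[) ((x - s) `^ (- b))%:E <=
   ((t - s) `^ (1 - b) / (1 - b))%:E)%E.
Proof.
move=> st b1; have b0 : 0 < 1 - b by lra.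
have dD x : x \in `]s, t[ -> is_derive x (1 : R)
    (fun y => (y - s) `^ (1 - b) / (1 - b)) ((x - s) `^ (- b)).
  rewrite in_itv/= => /andP[sx xt]; have xs : 0 < x - s by lra.
  have D1 : is_derive x (1 : R) (fun y : R => y - s) 1.
    by rewrite -[X in is_derive _ _ _ X]subr0; apply: is_deriveB.
  have D2 := is_derive1_powR (1 - b) xs.
  have D3 := @is_derive1_comp _ (fun y => y `^ (1 - b)) (fun y : R => y - s) x _ _ D2 D1.
  have -> : (fun y => (y - s) `^ (1 - b) / (1 - b)) =
    (1 - b)^-1 \*: ((fun y => y `^ (1 - b)) \o (fun y : R => y - s)).
    by apply/funext => y /=; rewrite mulrC.
  have -> : (x - s) `^ (- b) = (1 - b)^-1 *: ((1 - b) * (x - s) `^ (1 - b - 1) *: 1).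
    rewrite /GRing.scale/= mulr1 mulrA mulVf ?gt_eqF// mul1r.
    by congr (_ `^ _); ring.
  exact: is_deriveZ.
apply: (integral_itvoo_le (F := fun y => (y - s) `^ (1 - b) / (1 - b))) => //.
- move=> x /[dup] xst; rewrite in_itv/= => /andP[sx xt].
  have xs : 0 < x - s by lra.
  apply: (@continuous_comp _ _ _ (fun y : R => y - s) (fun y => y `^ (- b))).
    by apply: continuousB; [exact: cvg_id|exact: cvg_cst].
  have [D _] := is_derive1_powR (- b) xs.
  exact/differentiable_continuous/derivable1_diffP.
- by move=> x _; rewrite powR_ge0.
- move=> x y; rewrite !in_itv/= => /andP[sx xt] /andP[sy yt].
  rewrite lerBlDr (@le_trans _ _ ((t - s) `^ (1 - b) / (1 - b)))//.
    rewrite ler_pM2r ?invr_gt0//; apply: ge0_ler_powR; rewrite ?nnegrE; lra.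
  by rewrite lerDl divr_ge0 ?powR_ge0 ?ltW.
- by rewrite divr_ge0 ?powR_ge0 ?ltW.
Qed.

Lemma integral_powRl_le (s t b : R) : s <= t -> b < 1 ->
  (\int[leb]_(x in `]s, t[) ((t - x) `^ (- b))%:E <=
   ((t - s) `^ (1 - b) / (1 - b))%:E)%E.
Proof.
move=> st b1; have b0 : 0 < 1 - b by lra.
have dD x : x \in `]s, t[ -> is_derive x (1 : R)
    (fun y => - ((t - y) `^ (1 - b) / (1 - b))) ((t - x) `^ (- b)).
  rewrite in_itv/= => /andP[sx xt]; have xs : 0 < t - x by lra.
  have D1 : is_derive x (1 : R) (fun y : R => t - y) (-1).
    by rewrite -[X in is_derive _ _ _ X]add0r; apply: is_deriveB.
  have D2 := is_derive1_powR (1 - b) xs.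
  have D3 := @is_derive1_comp _ (fun y => y `^ (1 - b)) (fun y : R => t - y) x _ _ D2 D1.
  have -> : (fun y => - ((t - y) `^ (1 - b) / (1 - b))) =
    (- (1 - b)^-1) \*: ((fun y => y `^ (1 - b)) \o (fun y : R => t - y)).
    by apply/funext => y /=; rewrite /GRing.scale/= mulrC mulNr.
  have -> : (t - x) `^ (- b) = (- (1 - b)^-1) *: ((1 - b) * (t - x) `^ (1 - b - 1) *: (-1)).
    rewrite /GRing.scale/= mulrN1 mulrNN mulrA mulVf ?gt_eqF// mul1r.
    by congr (_ `^ _); ring.
  exact: is_deriveZ.
apply: (integral_itvoo_le (F := fun y => - ((t - y) `^ (1 - b) / (1 - b)))) => //.
- move=> x /[dup] xst; rewrite in_itv/= => /andP[sx xt].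
  have xs : 0 < t - x by lra.
  apply: (@continuous_comp _ _ _ (fun y : R => t - y) (fun y => y `^ (- b))).
    by apply: continuousB; [exact: cvg_cst|exact: cvg_id].
  have [D _] := is_derive1_powR (- b) xs.
  exact/differentiable_continuous/derivable1_diffP.
- by move=> x _; rewrite powR_ge0.
- move=> x y; rewrite !in_itv/= => /andP[sx xt] /andP[sy yt].
  rewrite opprK addrC lerBlDr (@le_trans _ _ ((t - s) `^ (1 - b) / (1 - b)))//.
    rewrite ler_pM2r ?invr_gt0//; apply: ge0_ler_powR; rewrite ?nnegrE; lra.
  by rewrite lerDl divr_ge0 ?powR_ge0 ?ltW.
- by rewrite divr_ge0 ?powR_ge0 ?ltW.
Qed.

End power_integrals.

(** * The singular weight on balls *)

Section power_ball.
Context {R : realType} {N : nat}.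
Notation RN := 'rV[R]_N.
Notation mu := (lebesgue_row N : {measure set RN -> \bar R}).
Notation leb := (@lebesgue_measure R).

Lemma ler_coord_enorm (x : RN) i : `|x ord0 i| <= enorm x.
Proof.
rewrite -sqrtr_sqr ler_sqrt; last by rewrite sumr_ge0// => j _; rewrite sqr_ge0.
by rewrite (bigD1 i)//= lerDl sumr_ge0// => j _; rewrite sqr_ge0.
Qed.

(** Each coordinate hyperplane is a box with one side reduced to a point. Away from them a negative
    power of a coordinate has its true value, whereas at 0 it would be 0 and the comparison in
    [integral_enorm_powR_le] could fail. *)
Lemma ae_coord_neq0 : {ae mu, forall x : RN, forall i, x ord0 i != 0}.
Proof.
apply: filter_forall => i.
pose A j : set R := if j == i then [set 0] else setT.
have mA j : measurable (A j) by rewrite /A; case: ifP => // _; exact: measurable_set1.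
have [mB EB] := lebesgue_row_box mA.
exists [set x : RN | forall j, A j (x ord0 j)]; split => //.
  rewrite [LHS]EB (bigD1 i)//= {1}/A eqxx lebesgue_measure_set1.
  by rewrite mul0e.
move=> x /= /negP; rewrite negbK => /eqP x0 j; rewrite /A.
by case: eqP => [->|].
Qed.

Lemma integral_abs_powR_le (r b : R) : 0 < r -> b < 1 ->
  (\int[leb]_(x in `](- r)%R, r[) (`|x| `^ (- b))%:E <= (2 * (r `^ (1 - b) / (1 - b)))%:E)%E.
Proof.
move=> r0 b1.
have mf (D : set R) : measurable_fun D (fun x : R => (`|x| `^ (- b))%:E).
  apply/measurable_EFinP; apply: measurable_funTS.
  exact: (measurableT_comp (measurable_powR _)).
have E : (`]- r, r[%classic : set R) `<=` `]- r, 0[%classic `|` [set 0] `|` `]0, r[%classic.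
  move=> x /=; rewrite !in_itv/= => /andP[rx xr].
  have [x0|x0|->] := ltgtP x 0; last by left; right.
    by left; left; rewrite rx.
  by right; rewrite xr.
have m1 : measurable (`]- r, 0[%classic `|` [set (0:R)]) by apply: measurableU; [exact: measurable_itv|exact: measurable_set1].
apply: (@le_trans _ _ (\int[leb]_(x in `](- r)%R, 0%R[%classic `|` [set 0%R] `|` `]0%R, r[%classic) (`|x| `^ (- b))%:E)%E).
  apply: ge0_subset_integral => //; last exact: mf.
  by apply: measurableU.
rewrite ge0_integral_setU//; last 2 first.
- exact: mf.
- apply/disj_set2P/seteqP; split=> [x []|//] /=; rewrite !in_itv/=.
  by move=> [/andP[_ x0]|->] /andP[]; [move=> /(lt_trans x0)|]; rewrite ltxx.
rewrite ge0_integral_setU//; last 2 first.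
- exact: mf.
- apply/disj_set2P/seteqP; split=> [x []|//] /=; rewrite in_itv/=.
  by move=> /andP[_ x0] x0'; move: x0; rewrite x0' ltxx.
rewrite integral_set1 adde0 mulr_natl mulr2n EFinD; apply: leeD.
  have := @integral_powRl_le R (- r) 0 b.
  rewrite sub0r opprK => /(_ _ b1) h; apply: le_trans (h _); last by lra.
  rewrite le_eqVlt; apply/orP; left; apply/eqP; apply: eq_integral => x.
  by rewrite inE/= in_itv/= => /andP[_ x0]; rewrite sub0r ltr0_norm.
have := @integral_powRr_le R 0 r b.
rewrite subr0 => /(_ _ b1) h; apply: le_trans (h _); last by lra.
rewrite le_eqVlt; apply/orP; left; apply/eqP; apply: eq_integral => x.
by rewrite inE/= in_itv/= => /andP[x0 _]; rewrite subr0 gtr0_norm.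
Qed.

Definition eball (r : R) : set RN := [set y | enorm y < r].

Lemma measurable_eball r : measurable (eball r).
Proof.
rewrite -[X in measurable X]setTI.
apply: (@measurable_fun_ltr _ _ _ setT (@enorm R N) (cst r)) => //.
exact: (measurable_enorm (f := id)).
Qed.

(** The product over the N coordinates of the integrals of |s|^(-a/N) on ]-1, 1[. *)
Definition Kball (a : R) : R := (2 / (1 - a / N%:R)) ^+ N.

(** In place of polar coordinates, |y|^(-a) is written as N factors |y|^(-a/N), each at most
    |y_i|^(-a/N), and the ball is enlarged to the cube ]-r, r[^N, on which the integral is a
    product. *)
Lemma integral_enorm_powR_le (r a : R) : (0 < N)%N -> 0 < r -> 0 <= a -> a < N%:R ->
  (\int[mu]_(y in eball r) (enorm y `^ (- a))%:E <=
   (Kball a * r `^ (N%:R - a))%:E)%E.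
Proof.
move=> N0 r0 a0 aN; have Npos : 0 < N%:R :> R by rewrite ltr0n.
have aN1 : a / N%:R < 1 by rewrite ltr_pdivrMr// mul1r.
pose h (s : R) : R := \1_(`]- r, r[%classic : set R) s * `|s| `^ (- (a / N%:R)).
have h0 s : 0 <= h s by rewrite mulr_ge0 ?powR_ge0.
have mh : measurable_fun [set: R] h.
  apply: measurable_funM; first exact: measurable_indic.
  exact: (measurableT_comp (measurable_powR _)).
have mE := measurable_eball r.
have mP : measurable_fun [set: RN] (fun y : RN => (enorm y `^ (- a))%:E).
  apply/measurable_EFinP; apply: (measurableT_comp (measurable_powR _)).
  exact: (measurable_enorm (f := id)).
have mprod : measurable_fun [set: RN] (fun x : RN => (\prod_(i < N) h (x ord0 i))%:E).
  apply/measurable_EFinP; apply: measurable_prod => i _.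
  exact: (measurableT_comp mh (@measurable_coord _ _ _ i)).
rewrite integral_mkcond.
apply: (@le_trans _ _ (\int[mu]_y (\prod_(i < N) h (y ord0 i))%:E)%E).
  apply: ae_ge0_le_integral => //.
  - by move=> y _; rewrite erestrict_ge0// => z _; rewrite lee_fin powR_ge0.
  - apply/(measurable_restrictT _ mE); exact: measurable_funTS.
  - by move=> y _; rewrite lee_fin prodr_ge0.
  - apply: filterS ae_coord_neq0 => y yn0 _; rewrite /patch.
    case: ifPn => [|_]; last by rewrite lee_fin prodr_ge0.
    rewrite inE/= => yr; rewrite lee_fin.
    have e0 : 0 < enorm y.
      by apply: lt_le_trans (ler_coord_enorm y (Ordinal N0)); rewrite normr_gt0.
    rewrite (_ : enorm y `^ (- a) = \prod_(i < N) enorm y `^ (- (a / N%:R))).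
      2: by rewrite prodr_const card_ord -powR_mulrn ?powR_ge0// -powRrM mulNr divfK// gt_eqF.
    apply: ler_prod => i _; rewrite powR_ge0/= /h indicE mem_set/=; last first.
      rewrite in_itv/= -ltr_norml; exact: le_lt_trans (ler_coord_enorm y i) yr.
    rewrite mul1r !powRN lef_pV2 ?posrE ?powR_gt0 ?normr_gt0//.
    apply: ge0_ler_powR; rewrite ?nnegrE ?enorm_ge0 ?ler_coord_enorm//.
    by rewrite divr_ge0.
rewrite (integral_row_prod (f := fun=> h))//.
rewrite (_ : \int[leb]_x (h x)%:E = \int[leb]_(x in `](- r)%R, r[) (`|x| `^ (- (a / N%:R)))%:E)%E; last first.
  rewrite [RHS]integral_mkcond; apply: eq_integral => x _.
  by rewrite /h patchE indicE; case: ifP => _; rewrite ?mul1r ?mul0r.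
have := @integral_abs_powR_le r (a / N%:R) r0 aN1.
set I := integral _ _ _; have : (0 <= I)%E by apply: integral_ge0 => x _; rewrite lee_fin powR_ge0.
case: I => [I||]//; rewrite !lee_fin => I0 Ile.
rewrite prodEFin prodr_const card_ord lee_fin.
have -> : Kball a * r `^ (N%:R - a) =
    (2 * (r `^ (1 - a / N%:R) / (1 - a / N%:R))) ^+ N.
  rewrite mulrCA exprMn mulrC; congr (_ * _).
  rewrite -powR_mulrn ?powR_ge0// -powRrM; congr (_ `^ _).
  by field; rewrite gt_eqF.
by rewrite lerXn2r// ?nnegrE// mulr_ge0// divr_ge0 ?powR_ge0// subr_ge0 ltW.
Qed.

End power_ball.
(** * Heat semigroup on nonnegative functions *)

Section heat_operator.
Context {R : realType} {N : nat}.
Notation RN := 'rV[R]_N.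
Notation mu := (lebesgue_row N : {sigma_finite_measure set RN -> \bar R}).
Notation G := (@heat_kernel R N).
Local Open Scope ereal_scope.

(** The semigroup on functions with values in [0, +oo], where the integral always makes sense; the
    convention for t <= 0 is that of [heat]. *)
Definition heate (t : R) (f : RN -> \bar R) (x : RN) : \bar R :=
  if (0 < t)%R then \int[mu]_y ((G t (x - y))%:E * f y) else f x.

Implicit Types (f g h : RN -> \bar R) (t s : R) (x y : RN).

Lemma measurable_Gr t x : measurable_fun [set: RN] (fun y => (G t (x - y))%:E).
Proof.
by apply/measurable_EFinP; apply: measurable_heat_kernel => //; exact: measurable_rowB.
Qed.

Lemma measurable_Gl t x : measurable_fun [set: RN] (fun y => (G t (y - x))%:E).
Proof.
by apply/measurable_EFinP; apply: measurable_heat_kernel => //; exact: measurable_rowB.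
Qed.

Lemma measurable_GrM t x f : measurable_fun [set: RN] f ->
  measurable_fun [set: RN] (fun y => (G t (x - y))%:E * f y).
Proof. by move=> mf; apply: emeasurable_funM => //; exact: measurable_Gr. Qed.

Lemma GrM_ge0 t x f : (forall x, 0 <= f x) -> forall y, 0 <= (G t (x - y))%:E * f y.
Proof. by move=> f0 y; rewrite mule_ge0// lee_fin heat_kernel_ge0. Qed.

Lemma heate_ge0 t f x : (forall x, 0 <= f x) -> 0 <= heate t f x.
Proof.
move=> f0; rewrite /heate; case: ifPn => // t0; apply: integral_ge0 => y _.
exact: GrM_ge0.
Qed.

Lemma heate0 f : heate 0 f = f.
Proof. by apply/funext => x; rewrite /heate ltxx. Qed.

Lemma le_heate t f g x : measurable_fun [set: RN] f -> measurable_fun [set: RN] g ->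
  (forall x, 0 <= f x) -> (forall x, f x <= g x) -> heate t f x <= heate t g x.
Proof.
move=> mf mg f0 fg; rewrite /heate; case: ifPn => // t0.
apply: ge0_le_integral => //; try exact: measurable_GrM.
- by move=> y _; exact: GrM_ge0.
- by move=> y _; rewrite lee_wpmul2l// lee_fin heat_kernel_ge0.
Qed.

Lemma ae_le_heate t f g x : (0 < t)%R ->
  measurable_fun [set: RN] f -> measurable_fun [set: RN] g ->
  (forall x, 0 <= f x) -> (forall x, 0 <= g x) ->
  {ae mu, forall x, f x <= g x} -> heate t f x <= heate t g x.
Proof.
move=> t0 mf mg f0 g0 fg; rewrite /heate t0.
apply: ae_ge0_le_integral => //; try exact: measurable_GrM.
- by move=> y _; exact: GrM_ge0.
- by move=> y _; exact: GrM_ge0.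
- by apply: filterS fg => y fgy _; rewrite lee_wpmul2l// lee_fin heat_kernel_ge0.
Qed.

Lemma heateD t f g x : measurable_fun [set: RN] f -> measurable_fun [set: RN] g ->
  (forall x, 0 <= f x) -> (forall x, 0 <= g x) ->
  heate t (fun x => f x + g x) x = heate t f x + heate t g x.
Proof.
move=> mf mg f0 g0; rewrite /heate; case: ifPn => // t0.
rewrite -ge0_integralD//; try exact: measurable_GrM.
- by apply: eq_integral => y _; rewrite ge0_muleDr.
- by move=> y _; exact: GrM_ge0.
- by move=> y _; exact: GrM_ge0.
Qed.

Lemma heateZ t (k : R) f x : measurable_fun [set: RN] f ->
  (forall x, 0 <= f x) -> (0 <= k)%R ->
  heate t (fun x => k%:E * f x) x = k%:E * heate t f x.
Proof.
move=> mf f0 k0; rewrite /heate; case: ifPn => // t0.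
rewrite -ge0_integralZl//; try exact: measurable_GrM.
- by apply: eq_integral => y _; rewrite muleCA.
- by move=> y _; exact: GrM_ge0.
Qed.

Lemma heate_cst t (k : R) x : (0 <= k)%R -> heate t (cst k%:E) x = k%:E.
Proof.
move=> k0; rewrite /heate; case: ifPn => // t0.
rewrite ge0_integralZr ?lee_fin//; first by rewrite integral_heat_kernel// mul1e.
- exact: measurable_Gr.
- by move=> y _; rewrite lee_fin heat_kernel_ge0.
Qed.

(** In a Duhamel integral the time, the datum and the point vary together, so all three depend on a
    parameter here; the measurability is that of a partial integral in Tonelli's theorem. *)
Lemma measurable_heate_param d (T : measurableType d) (F : T * RN -> \bar R)
    (tau : T -> R) (xi : T -> RN) :
  measurable_fun [set: T * RN] F -> (forall p, 0 <= F p) ->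
  measurable_fun [set: T] tau -> measurable_fun [set: T] xi ->
  measurable_fun [set: T] (fun p => heate (tau p) (fun y => F (p, y)) (xi p)).
Proof.
move=> mF F0 mtau mxi; rewrite /heate.
apply: measurable_fun_ifT.
- exact: measurable_fun_ltr.
- apply: (measurable_fun_fubini_tonelli_F (m2 := mu)
    (fun p : T * RN => (G (tau p.1) (xi p.1 - p.2))%:E * F p)).
    apply: emeasurable_funM => //; apply/measurable_EFinP.
    apply: measurable_heat_kernel; first exact: measurableT_comp.
    by apply: measurable_rowB => //; exact: measurableT_comp.
  by move=> p; rewrite mule_ge0// lee_fin heat_kernel_ge0.
- by apply: (measurableT_comp mF); exact: measurable_fun_pair.
Qed.

Lemma measurable_heate t f : measurable_fun [set: RN] f -> (forall x, 0 <= f x) ->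
  measurable_fun [set: RN] (heate t f).
Proof.
move=> mf f0; apply: (@measurable_heate_param _ RN (fun p => f p.2) (cst t) id) => //.
exact: measurableT_comp.
Qed.

Lemma heateM t s f x : (0 <= t)%R -> (0 <= s)%R ->
  measurable_fun [set: RN] f -> (forall x, 0 <= f x) ->
  heate t (heate s f) x = heate (t + s) f x.
Proof.
rewrite le_eqVlt => /predU1P[<-|t0]; first by rewrite heate0 add0r.
rewrite le_eqVlt => /predU1P[<-|s0]; first by rewrite heate0 addr0.
move=> mf f0; rewrite /heate t0 s0 addr_gt0//.
transitivity (\int[mu]_y \int[mu]_z ((G t (x - y))%:E * ((G s (y - z))%:E * f z))).
  apply: eq_integral => y _; rewrite ge0_integralZl//.
  - exact: measurable_GrM.
  - by move=> z _; exact: GrM_ge0.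
  - by rewrite lee_fin heat_kernel_ge0.
rewrite (fubini_tonelli (m1 := mu) (m2 := mu) (fun p : RN * RN =>
  (G t (x - p.1))%:E * ((G s (p.1 - p.2))%:E * f p.2)))/=; last 2 first.
- apply: emeasurable_funM; [|apply: emeasurable_funM].
  + apply/measurable_EFinP; apply: measurable_heat_kernel => //.
    exact: measurable_rowB.
  + apply/measurable_EFinP; apply: measurable_heat_kernel => //.
    exact: measurable_rowB.
  + exact: measurableT_comp.
- by move=> p; rewrite !mule_ge0// lee_fin heat_kernel_ge0.
apply: eq_integral => z _; rewrite -(integral_heat_kernelM x z t0 s0).
under eq_integral do rewrite muleA.
rewrite ge0_integralZr//=.
- apply/measurable_EFinP; apply: measurable_funM; apply/measurable_EFinP.
    exact: measurable_Gr.
  exact: measurable_Gl.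
- by move=> y _; rewrite lee_fin mulr_ge0 ?heat_kernel_ge0.
Qed.

Lemma integral_heate t f : measurable_fun [set: RN] f -> (forall x, 0 <= f x) ->
  \int[mu]_x heate t f x = \int[mu]_x f x.
Proof.
move=> mf f0; rewrite /heate; case: (boolP (0 < t)%R) => // t0.
rewrite (fubini_tonelli (m1 := mu) (m2 := mu) (fun p : RN * RN => (G t (p.1 - p.2))%:E * f p.2))/=; last 2 first.
- apply: emeasurable_funM; last exact: measurableT_comp.
  apply/measurable_EFinP; apply: measurable_heat_kernel => //.
  exact: measurable_rowB.
- by move=> p; rewrite mule_ge0// lee_fin heat_kernel_ge0.
apply: eq_integral => z _; rewrite ge0_integralZr//.
- by rewrite integral_heat_kernelC// mul1e.
- exact: measurable_Gl.
- by move=> y _; rewrite lee_fin heat_kernel_ge0.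
Qed.

Lemma measurable_poweR_comp f (q : R) : measurable_fun [set: RN] f ->
  measurable_fun [set: RN] (fun x => f x `^ q).
Proof. by move=> mf; exact: (measurableT_comp (measurable_poweR _)). Qed.

Lemma heate_jensen (q : R) t f x : (1 <= q)%R ->
  measurable_fun [set: RN] f -> (forall x, 0 <= f x) ->
  heate t f x `^ q <= heate t (fun y => f y `^ q) x.
Proof.
move=> q1 mf f0; rewrite /heate; case: ifPn => // t0.
have := @weighted_jensen R _ _ mu setT (fun y => (G t (x - y))%:E) f q 1 measurableT
  (measurable_Gr t x) mf.
rewrite powR1 mul1e; apply => //.
- by move=> y _; rewrite lee_fin heat_kernel_ge0.
- by rewrite integral_heat_kernel.
Qed.

Lemma heate_sup t f x : (0 < t)%R -> measurable_fun [set: RN] f -> (forall x, 0 <= f x) ->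
  heate t f x <= ((4 * pi * t) `^ (- (N%:R / 2)))%:E * \int[mu]_y f y.
Proof.
move=> t0 mf f0; rewrite /heate t0 -ge0_integralZl ?lee_fin ?powR_ge0//.
apply: ge0_le_integral => //.
- by move=> y _; exact: GrM_ge0.
- exact: measurable_GrM.
- exact: measurable_funeM.
- by move=> y _; rewrite lee_wpmul2r// lee_fin heat_kernel_ub.
Qed.

(** The bound on the L^q norm of a nonnegative function, with q-th powers on both sides so that no
    root of an integral appears. *)
Definition Lq_le (q : R) f (B : R) := \int[mu]_x f x `^ q <= (B `^ q)%:E.

Lemma Lq_le_mono q f g B C : (0 <= q)%R -> measurable_fun [set: RN] f ->
  measurable_fun [set: RN] g -> (forall x, 0 <= f x) -> (forall x, f x <= g x) ->
  (0 <= B)%R -> (B <= C)%R -> Lq_le q g B -> Lq_le q f C.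
Proof.
move=> q0 mf mg f0 fg B0 BC gB.
apply: (@le_trans _ _ (\int[mu]_x g x `^ q)).
  apply: ge0_le_integral => //; try exact: measurable_poweR_comp.
  - by move=> x _; exact: poweR_ge0.
  - move=> x _; apply: gt0_ler_poweR; rewrite ?in_itv/= ?leey ?andbT//.
    exact: le_trans (fg x).
apply: le_trans gB _; rewrite lee_fin; apply: ge0_ler_powR => //; rewrite nnegrE//.
exact: le_trans BC.
Qed.

(** The constant is 2 times 2: (f + g)^q <= 2^q (f^q + g^q) by comparison with the maximum, and A^q
    + B^q <= 2 (A + B)^q <= (2 (A + B))^q. *)
Lemma Lq_leD q f g A B : (1 <= q)%R -> measurable_fun [set: RN] f ->
  measurable_fun [set: RN] g -> (forall x, 0 <= f x) -> (forall x, 0 <= g x) ->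
  (0 <= A)%R -> (0 <= B)%R -> Lq_le q f A -> Lq_le q g B ->
  Lq_le q (fun x => f x + g x) (4 * (A + B))%R.
Proof.
move=> q1 mf mg f0 g0 A0 B0 fA gB; have q0 : (0 <= q)%R by apply: le_trans q1.
have mfq := measurable_poweR_comp q mf; have mgq := measurable_poweR_comp q mg.
apply: (@le_trans _ _ (\int[mu]_x ((2 `^ q)%:E * (f x `^ q + g x `^ q)))).
  apply: ge0_le_integral => //.
  - by move=> x _; exact: poweR_ge0.
  - by apply: measurable_poweR_comp; exact: emeasurable_funD.
  - by apply: measurable_funeM; exact: emeasurable_funD.
  - move=> x _; apply: (@le_trans _ _ ((2%:E * maxe (f x) (g x)) `^ q)).
      apply: gt0_ler_poweR; rewrite ?in_itv/= ?leey ?andbT ?adde_ge0//.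
        by rewrite mule_ge0// le_max f0.
      rewrite (_ : 2%:E = 1 + 1)// ge0_muleDl// mul1e.
      by rewrite leeD// le_max lexx ?orbT.
    rewrite poweRM ?lee_fin// ?le_max ?f0// poweR_EFin lee_wpmul2l ?lee_fin ?powR_ge0//.
    have [fg|gf] := leP (f x) (g x).
      by rewrite leeDr// poweR_ge0.
    by rewrite leeDl// poweR_ge0.
rewrite ge0_integralZl ?lee_fin ?powR_ge0//; last 2 first.
- exact: emeasurable_funD.
- by move=> x _; rewrite adde_ge0 ?poweR_ge0.
rewrite ge0_integralD//; try by move=> *; exact: poweR_ge0.
apply: (@le_trans _ _ ((2 `^ q)%:E * ((A `^ q)%:E + (B `^ q)%:E))).
  by rewrite lee_wpmul2l ?lee_fin ?powR_ge0// leeD.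
rewrite -EFinD -EFinM lee_fin.
have AB0 : (0 <= A + B)%R by rewrite addr_ge0.
have Aq : (A `^ q <= (A + B) `^ q)%R by apply: ge0_ler_powR; rewrite ?nnegrE//; lra.
have Bq : (B `^ q <= (A + B) `^ q)%R by apply: ge0_ler_powR; rewrite ?nnegrE//; lra.
have -> : (4 * (A + B) = 2 * (2 * (A + B)))%R by ring.
rewrite !powRM ?mulr_ge0//; apply: ler_wpM2l; rewrite ?powR_ge0//.
apply: (@le_trans _ _ (2 * (A + B) `^ q)%R); first lra.
apply: ler_wpM2r; rewrite ?powR_ge0//; apply: le1r_powR => //; lra.
Qed.

(** Jensen's inequality moves the power inside the semigroup, which preserves the integral of
    f^q. *)
Lemma Lq_le_heate q t f B : (1 <= q)%R -> measurable_fun [set: RN] f ->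
  (forall x, 0 <= f x) -> Lq_le q f B -> Lq_le q (heate t f) B.
Proof.
move=> q1 mf f0; apply: le_trans.
have mfq := measurable_poweR_comp q mf.
have fq0 x : 0 <= f x `^ q by exact: poweR_ge0.
rewrite -(integral_heate t mfq)//; apply: ge0_le_integral => //.
- by move=> x _; exact: poweR_ge0.
- by apply: measurable_poweR_comp; exact: measurable_heate.
- exact: measurable_heate.
- by move=> x _; exact: heate_jensen.
Qed.

Lemma poweR_le_EFin (q : R) (a : \bar R) (b : R) : (0 < q)%R -> 0 <= a -> (0 <= b)%R ->
  a `^ q <= (b `^ q)%:E -> a <= b%:E.
Proof.
move=> q0; case: a => [a||]//; last first.
  by move=> _ _; rewrite poweRyr ?gt_eqF// leNgt ltry.
rewrite poweR_EFin !lee_fin => a0 b0 ab; rewrite leNgt; apply/negP => ba.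
move: ab; rewrite leNgt => /negP; apply; apply: gt0_ltr_powR; rewrite ?nnegrE//.
Qed.

Lemma heate_Lq_sup q t f B x : (1 <= q)%R -> (0 < t)%R ->
  measurable_fun [set: RN] f -> (forall x, 0 <= f x) -> (0 <= B)%R ->
  Lq_le q f B -> heate t f x <= ((4 * pi * t) `^ (- (N%:R / (2 * q))) * B)%:E.
Proof.
move=> q1 t0 mf f0 B0 fB; have q0 : (0 < q)%R by apply: lt_le_trans q1.
apply: (@poweR_le_EFin q) => //; first exact: heate_ge0.
  by rewrite mulr_ge0 ?powR_ge0.
apply: le_trans (heate_jensen t x q1 mf f0) _.
apply: le_trans (heate_sup _ t0 _ _) _.
- exact: measurable_poweR_comp.
- by move=> y; exact: poweR_ge0.
rewrite (@powRM _ (_ `^ _)%R) ?powR_ge0// -powRrM EFinM.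
have -> : (- (N%:R / (2 * q)) * q = - (N%:R / 2) :> R)%R by field; rewrite gt_eqF.
by rewrite lee_wpmul2l// lee_fin powR_ge0.
Qed.

(** Interpolation between the conserved integral and the sup bound (4 pi t)^(-N/2) B: the q-th power
    is at most the (q - 1)-th power of the sup bound times the function. *)
Lemma heate_L1_Lq q t f B : (1 <= q)%R -> (0 < t)%R ->
  measurable_fun [set: RN] f -> (forall x, 0 <= f x) -> (0 <= B)%R ->
  \int[mu]_x f x <= B%:E ->
  Lq_le q (heate t f) ((4 * pi * t) `^ (- (N%:R / 2 * (1 - q^-1))) * B).
Proof.
move=> q1 t0 mf f0 B0 fB; have q0 : (0 < q)%R by apply: lt_le_trans q1.
pose c := ((4 * pi * t) `^ (- (N%:R / 2)))%R.
have c0 : (0 <= c)%R by rewrite powR_ge0.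
have Hle x : heate t f x <= (c * B)%:E.
  apply: le_trans (heate_sup _ t0 mf f0) _.
  by rewrite /c EFinM lee_wpmul2l// lee_fin.
apply: (@le_trans _ _ (\int[mu]_x (((c * B) `^ (q - 1))%:E * heate t f x))).
  apply: ge0_le_integral => //.
  - by move=> x _; exact: poweR_ge0.
  - by apply: measurable_poweR_comp; exact: measurable_heate.
  - by apply: measurable_funeM; exact: measurable_heate.
  - move=> x _; move: (Hle x) (heate_ge0 t x f0).
    case: (heate t f x) => [a||]//; rewrite poweR_EFin !lee_fin => acB a0.
    rewrite -(mulr_powRB1 a0 q0) mulrC ler_wpM2r//.
    by apply: ge0_ler_powR; rewrite ?nnegrE ?subr_ge0// mulr_ge0.
rewrite ge0_integralZl ?lee_fin ?powR_ge0//; last 2 first.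
- exact: measurable_heate.
- by move=> x _; exact: heate_ge0.
rewrite integral_heate//.
apply: (@le_trans _ _ (((c * B) `^ (q - 1))%:E * B%:E)).
  by rewrite lee_wpmul2l// lee_fin powR_ge0.
rewrite -EFinM lee_fin /c !(@powRM _ (_ `^ _)%R) ?powR_ge0// -!powRrM.
have BE : (B `^ q = B `^ (q - 1) * B)%R.
  by rewrite mulrC mulr_powRB1.
have qE : (- (N%:R / 2 * (1 - q^-1)) * q = - (N%:R / 2) * (q - 1) :> R)%R.
  by field; rewrite gt_eqF.
by rewrite BE qE mulrA.
Qed.

End heat_operator.
(** * Duhamel integrals *)

Section duhamel.
Context {R : realType} {N : nat}.
Notation RN := 'rV[R]_N.
Notation mu := (lebesgue_row N : {sigma_finite_measure set RN -> \bar R}).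
Notation leb := (@lebesgue_measure R : {sigma_finite_measure set (measurableTypeR R) -> \bar R}).
Local Open Scope ereal_scope.

Definition jmeasurable (F : R -> RN -> \bar R) :=
  measurable_fun [set: measurableTypeR R * RN] (fun p => F p.1 p.2).

(** The lower end s is free so that the equation can be restarted at time s. *)
Definition duh (s t : R) (F : R -> RN -> \bar R) (x : RN) : \bar R :=
  \int[leb]_(sigma in `]s, t[) heate (t - sigma) (F sigma) x.

Lemma jmeasurable_section F s : jmeasurable F -> measurable_fun [set: RN] (F s).
Proof.
by move=> mF; apply: (measurableT_comp mF (g := pair s)); exact: measurable_pair1.
Qed.

Section fixed_F.
Variable F : R -> RN -> \bar R.
Hypotheses (mF : jmeasurable F) (F0 : forall s x, 0 <= F s x).

Lemma measurable_heate_duh d (T : measurableType d) (t s : T -> R) (x : T -> RN) :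
  measurable_fun [set: T] t -> measurable_fun [set: T] s -> measurable_fun [set: T] x ->
  measurable_fun [set: T] (fun p => heate (t p - s p) (F (s p)) (x p)).
Proof.
move=> mt ms mx.
apply: (@measurable_heate_param _ _ _ T (fun p => F (s p.1) p.2) (fun p => t p - s p)%R x) => //.
  apply: (measurableT_comp mF (g := fun p : T * RN => (s p.1, p.2))).
  apply: measurable_fun_pair => //; exact: measurableT_comp.
exact: measurable_funB.
Qed.

Lemma measurable_heate_sigma t x (D : set R) :
  measurable_fun D (fun sigma => heate (t - sigma) (F sigma) x).
Proof.
apply: measurable_funTS.
exact: (@measurable_heate_duh _ (measurableTypeR R) (cst t) id (cst x)).
Qed.

Lemma duh_ge0 s t x : 0 <= duh s t F x.
Proof. by apply: integral_ge0 => r _; exact: heate_ge0. Qed.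

Lemma duh_geo s t x : (t <= s)%R -> duh s t F x = 0.
Proof. by move=> ts; rewrite /duh set_itv_ge ?bnd_simp -?leNgt// integral_set0. Qed.

Lemma measurable_duh s : jmeasurable (fun t => duh s t F).
Proof.
rewrite /jmeasurable (_ : (fun p => _) = fun p : measurableTypeR R * RN => \int[leb]_sigma
    (if (s < sigma < p.1)%R then heate (p.1 - sigma) (F sigma) p.2 else 0)); last first.
  apply/funext => p; rewrite /duh integral_mkcond; apply: eq_integral => sigma _.
  by rewrite patchE mem_setE in_itv.
apply: (measurable_fun_fubini_tonelli_F (m2 := leb)
  (fun p : (measurableTypeR R * RN) * measurableTypeR R =>
   if (s < p.2 < p.1.1)%R then heate (p.1.1 - p.2) (F p.2) p.1.2 else 0)).
  apply: measurable_fun_ifT => //.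
    apply: measurable_and; apply: measurable_fun_ltr => //.
    exact: measurableT_comp.
  apply: (@measurable_heate_duh _ _ (fun p : (measurableTypeR R * RN) * measurableTypeR R => p.1.1)
     (fun p => p.2) (fun p => p.1.2)) => //; exact: measurableT_comp.
by move=> p; case: ifP => // _; exact: heate_ge0.
Qed.

Lemma measurable_duhx s t : measurable_fun [set: RN] (duh s t F).
Proof. exact: (jmeasurable_section t (measurable_duh s)). Qed.

Lemma heate_duh r s t x : (0 <= r)%R ->
  heate r (duh s t F) x = \int[leb]_(sigma in `]s, t[) heate (r + t - sigma) (F sigma) x.
Proof.
rewrite le_eqVlt => /predU1P[<-|r0]; first by rewrite heate0 add0r.
rewrite {1}/heate r0 /duh.
transitivity (\int[mu]_y \int[leb]_sigma
  ((heat_kernel r (x - y))%:E * (if (s < sigma < t)%R then heate (t - sigma) (F sigma) y else 0))).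
  apply: eq_integral => y _; rewrite integral_mkcond -ge0_integralZl//.
  - apply: eq_integral => sigma _; rewrite patchE mem_setE in_itv/=; by case: ifP.
  - apply/(measurable_restrictT _ _).1 => //; exact: measurable_heate_sigma.
  - by move=> sigma _; apply: erestrict_ge0 => ? _; exact: heate_ge0.
  - by rewrite lee_fin heat_kernel_ge0.
rewrite (fubini_tonelli (m1 := mu) (m2 := leb) (fun p : RN * measurableTypeR R =>
  (heat_kernel r (x - p.1))%:E * (if (s < p.2 < t)%R then heate (t - p.2) (F p.2) p.1 else 0)))/=; last 2 first.
- apply: emeasurable_funM.
    apply/measurable_EFinP; apply: measurable_heat_kernel => //.
    exact: measurable_rowB.
  apply: measurable_fun_ifT => //.
    by apply: measurable_and; apply: measurable_fun_ltr.
  apply: (@measurable_heate_duh _ _ (fun p : RN * measurableTypeR R => t) (fun p => p.2) (fun p => p.1)).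
  - exact: measurable_cst.
  - exact: measurable_snd.
  - exact: measurable_fst.
- move=> p; rewrite mule_ge0 ?lee_fin ?heat_kernel_ge0//.
  by case: ifP => // _; exact: heate_ge0.
rewrite [RHS]integral_mkcond; apply: eq_integral => sigma _.
rewrite patchE mem_setE in_itv/=; case: ifP => [/andP[ss st]|_]; last first.
  by under eq_integral do rewrite mule0; rewrite integral0.
rewrite -addrA -heateM ?(ltW r0) ?subr_ge0 ?(ltW st)//; last exact: jmeasurable_section.
by rewrite [RHS]/heate r0.
Qed.

(** By Tonelli and the semigroup law, [heate_duh], what has been accumulated up to time s is
    transported by the heat flow until t. This is the basis of the continuity in time. *)
Lemma duh_split r s t x : (r <= s)%R -> (s <= t)%R ->
  duh r t F x = heate (t - s) (duh r s F) x + duh s t F x.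
Proof.
move=> rs st; rewrite heate_duh ?subr_ge0// subrK /duh.
have mH := measurable_heate_sigma t x.
move: rs; rewrite le_eqVlt => /predU1P[<-|rs].
  by rewrite (@set_itv_ge _ _ (BRight r) (BLeft r)) ?bnd_simp ?ltxx// integral_set0 add0e.
move: st; rewrite le_eqVlt => /predU1P[<-|st].
  by rewrite (@set_itv_ge _ _ (BRight s) (BLeft s)) ?bnd_simp ?ltxx// integral_set0 adde0.
have -> : `]r, t[%classic = `]r, s]%classic `|` `]s, t[%classic :> set R.
  apply/seteqP; split => z /=; rewrite !in_itv/=.
    by move=> /andP[rz zt]; have [zs|zs] := leP z s; [left; rewrite rz|right].
  by move=> [/andP[-> zs]|/andP[sz ->]] /=; rewrite ?andbT; [exact: le_lt_trans st|exact: lt_trans sz].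
rewrite ge0_integral_setU//.
- by congr (_ + _); rewrite integral_itv_bndo_bndc.
- exact: measurable_heate_sigma.
- by move=> z _; exact: heate_ge0.
- apply/disj_set2P/seteqP; split=> [z []|//] /=; rewrite !in_itv/=.
  by move=> /andP[_ zs] /andP[sz _]; move: (le_lt_trans zs sz); rewrite ltxx.
Qed.

End fixed_F.

Lemma le_duh (F E : R -> RN -> \bar R) s t x : jmeasurable F -> jmeasurable E ->
  (forall r x, 0 <= F r x) -> (forall r x, 0 <= E r x) ->
  (forall r x, (s < r < t)%R -> F r x <= E r x) -> duh s t F x <= duh s t E x.
Proof.
move=> mF mE F0 E0 FE; apply: ge0_le_integral => //.
- by move=> r _; exact: heate_ge0.
- exact: measurable_heate_sigma.
- exact: measurable_heate_sigma.
- move=> r; rewrite /= in_itv/= => rst; apply: le_heate => //; try exact: jmeasurable_section.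
  by move=> y; exact: FE.
Qed.

Lemma duhD (F E : R -> RN -> \bar R) s t x : jmeasurable F -> jmeasurable E ->
  (forall r x, 0 <= F r x) -> (forall r x, 0 <= E r x) ->
  duh s t (fun r x => F r x + E r x) x = duh s t F x + duh s t E x.
Proof.
move=> mF mE F0 E0; rewrite /duh -ge0_integralD//.
- apply: eq_integral => r _; rewrite heateD//; exact: jmeasurable_section.
- by move=> r _; exact: heate_ge0.
- exact: measurable_heate_sigma.
- by move=> r _; exact: heate_ge0.
- exact: measurable_heate_sigma.
Qed.

(** Monotone convergence twice: in the space variable for fixed time, then in time. *)
Lemma cvg_duh (F : nat -> R -> RN -> \bar R) (E : R -> RN -> \bar R) s t x :
  (forall n, jmeasurable (F n)) -> jmeasurable E ->
  (forall n r x, 0 <= F n r x) ->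
  (forall r x, (s < r < t)%R -> nondecreasing_seq (fun n => F n r x)) ->
  (forall r x, (s < r < t)%R -> F n r x @[n --> \oo] --> E r x) ->
  duh s t (F n) x @[n --> \oo] --> duh s t E x.
Proof.
move=> mF mE F0 ndF FE.
have E0 r y : (s < r < t)%R -> 0 <= E r y.
  move=> /(FE _ y) FEy; rewrite -(cvg_lim _ FEy)//; apply: lime_ge; last exact: nearW.
  by apply/cvg_ex; exists (E r y).
have step r : (s < r < t)%R ->
    heate (t - r) (F n r) x @[n --> \oo] --> heate (t - r) (E r) x.
  move=> /[dup] rst /andP[_ rt]; rewrite /heate subr_gt0 rt.
  rewrite (_ : \int[mu]_y _ = \int[mu]_y
     limn (fun n => (heat_kernel (t - r) (x - y))%:E * F n r y)); last first.
    apply: eq_integral => y _; apply/esym/cvg_lim => //.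
    by apply: cvgeZl => //; exact: FE.
  apply: (@cvg_monotone_convergence _ _ _ mu setT measurableT
    (fun n y => (heat_kernel (t - r) (x - y))%:E * F n r y)) => //.
  - by move=> n; apply: measurable_GrM; exact: jmeasurable_section.
  - by move=> n y _; exact: GrM_ge0.
  - move=> y _ m n mn; apply: lee_wpmul2l; first by rewrite lee_fin heat_kernel_ge0.
    exact: ndF.
rewrite /duh (_ : \int[leb]_(r in `]s, t[) heate (t - r) (E r) x =
  \int[leb]_(r in `]s, t[) limn (fun n => heate (t - r) (F n r) x)); last first.
  by apply: eq_integral => r; rewrite inE/= in_itv/= => rst; apply/esym/cvg_lim => //; exact: step.
apply: cvg_monotone_convergence => //.
- by move=> n; exact: measurable_heate_sigma.
- by move=> n r _; exact: heate_ge0.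
- move=> r; rewrite /= in_itv/= => rst m n mn.
  apply: le_heate => //; try exact: jmeasurable_section.
  by move=> y; apply: ndF.
Qed.

(** Minkowski's integral inequality in weighted form: [weighted_jensen] for the measure h(r) dr is
    applied to F(r) / h(r), whose L^q norm is at most 1, and Tonelli's theorem exchanges the two
    integrals. *)
Lemma Lq_le_integral (q : R) (F : R -> RN -> \bar R) (h : R -> R) (s t I : R) :
  (1 <= q)%R -> jmeasurable F -> (forall r x, 0 <= F r x) ->
  measurable_fun [set: R] h ->
  (forall r, (s < r < t)%R -> (0 < h r)%R) ->
  (forall r, (s < r < t)%R -> Lq_le q (F r) (h r)) ->
  (0 < I)%R -> \int[leb]_(r in `]s, t[) (h r)%:E <= I%:E ->
  Lq_le q (fun x => \int[leb]_(r in `]s, t[) F r x) I.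
Proof.
move=> q1 mF F0 mh h0 Fh I0 hI; have q0 : (0 < q)%R by apply: lt_le_trans q1.
(* Extending h by 1 outside ]s, t[ makes the divisor positive at every time. *)
pose k r := if (s < r < t)%R then h r else 1%R.
have k0 r : (0 < k r)%R by rewrite /k; case: ifP => // /h0.
have mst : measurable_fun [set: measurableTypeR R] (fun r => (s < r < t)%R).
  by apply: measurable_and; apply: measurable_fun_ltr.
have mk : measurable_fun [set: R] k by exact: measurable_fun_ifT.
have mkV (a : R) : measurable_fun [set: R] (fun r => k r `^ a)%R.
  exact: (measurableT_comp (measurable_powR _)).
have kin r : `]s, t[%classic r -> k r = h r by rewrite /= in_itv/= /k => ->.
pose f r x := (k r `^ (-1))%:E * F r x.
have mf : jmeasurable f.
  apply: emeasurable_funM => //; apply/measurable_EFinP.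
  exact: (measurableT_comp (mkV _)).
have f0 r x : 0 <= f r x by rewrite mule_ge0 ?lee_fin ?powR_ge0.
have mfx x D : measurable_fun D (fun r => f r x).
  apply: measurable_funTS.
  apply: (measurableT_comp mf (g := fun r : measurableTypeR R => (r, x))).
  exact: measurable_pair2.
have kV r : (k r * k r `^ (-1) = 1)%R.
  by rewrite powR_inv1 ?(ltW (k0 _))// divff// gt_eqF.
have FE x r : F r x = (k r)%:E * f r x.
  by rewrite /f muleA -EFinM kV mul1e.
rewrite /Lq_le; under eq_integral do under eq_integral do rewrite FE.
have kI : \int[leb]_(r in `]s, t[) (k r)%:E <= I%:E.
  apply: le_trans hI; rewrite le_eqVlt; apply/orP; left; apply/eqP.
  by apply: eq_integral => r; rewrite inE => /kin ->.
have mkD D : measurable_fun D (fun r => (k r)%:E).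
  by apply/measurable_EFinP; exact: measurable_funTS.
have mg : jmeasurable (fun r x => if (s < r < t)%R then (k r)%:E * f r x `^ q else 0).
  apply: measurable_fun_ifT => //.
    exact: (measurableT_comp mst).
  apply: emeasurable_funM; first by apply/measurable_EFinP; exact: (measurableT_comp mk).
  exact: (measurableT_comp (measurable_poweR _)).
have g0 r x : 0 <= (if (s < r < t)%R then (k r)%:E * f r x `^ q else 0).
  by case: ifP => // _; rewrite mule_ge0 ?poweR_ge0 ?lee_fin ?(ltW (k0 _)).
apply: (@le_trans _ _ (\int[mu]_x ((I `^ (q - 1))%:E *
    \int[leb]_(r in setT) (if (s < r < t)%R then (k r)%:E * f r x `^ q else 0)))).
  apply: ge0_le_integral => //.
  - by move=> x _; exact: poweR_ge0.
  - apply: measurable_poweR_comp.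
    under eq_fun do rewrite integral_mkcond.
    have := @measurable_fun_fubini_tonelli_F _ _ RN (measurableTypeR R) R leb
      (fun p => if (s < p.2 < t)%R then (k p.2)%:E * f p.2 p.1 else 0).
    rewrite /fubini_F/= => h'; under eq_fun do under eq_integral do rewrite patchE mem_setE in_itv/=.
    apply: h'.
      apply: measurable_fun_ifT => //.
        exact: (measurableT_comp mst).
      apply: emeasurable_funM; first by apply/measurable_EFinP; exact: (measurableT_comp mk).
      apply: (measurableT_comp mf (g := fun p : RN * measurableTypeR R => (p.2, p.1))).
      exact: measurable_fun_pair.
    by move=> p; case: ifP => // _; rewrite mule_ge0 ?lee_fin ?(ltW (k0 _)).
  - apply: measurable_funeM.
    exact: (@measurable_fun_fubini_tonelli_G _ _ (measurableTypeR R) RN R leb _ mg (fun p => g0 p.1 p.2)).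
  - move=> x _.
    apply: le_trans (weighted_jensen (mu := leb) (k := fun r => (k r)%:E) (f := fun r => f r x) (D := `]s, t[) _ _ _ _ _ q1 I0 kI) _ => //.
    + exact: mkD.
    + exact: mfx.
    + by move=> r _; rewrite lee_fin ltW.
    + rewrite lee_wpmul2l ?lee_fin ?powR_ge0//.
      rewrite integral_mkcond le_eqVlt; apply/orP; left; apply/eqP; apply: eq_integral => r _.
      by rewrite patchE mem_setE in_itv.
rewrite ge0_integralZl ?lee_fin ?powR_ge0//; last 2 first.
- exact: (@measurable_fun_fubini_tonelli_G _ _ (measurableTypeR R) RN R leb _ mg (fun p => g0 p.1 p.2)).
- by move=> x _; apply: integral_ge0.
rewrite -(fubini_tonelli (m1 := leb) (m2 := mu) _ mg (fun p => g0 p.1 p.2))/=.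
apply: (@le_trans _ _ ((I `^ (q - 1))%:E * I%:E)); last first.
  by rewrite -EFinM lee_fin mulrC mulr_powRB1// ltW.
rewrite lee_wpmul2l ?lee_fin ?powR_ge0//; apply: le_trans kI.
rewrite [leRHS]integral_mkcond; apply: ge0_le_integral => //.
- by move=> r _; exact: integral_ge0.
- exact: (@measurable_fun_fubini_tonelli_F _ _ (measurableTypeR R) RN R mu _ mg (fun p => g0 p.1 p.2)).
- by apply/(measurable_restrictT _ _).1 => //; exact: mkD.
move=> r _; rewrite patchE mem_setE in_itv/=; case: ifP => rst; last by rewrite integral0.
have mFr := jmeasurable_section r mF.
under eq_integral do rewrite poweRM ?lee_fin ?powR_ge0// poweR_EFin muleA -EFinM.
rewrite ge0_integralZl//; last 3 first.
- exact: measurable_poweR_comp.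
- by move=> x _; exact: poweR_ge0.
- by rewrite lee_fin mulr_ge0 ?powR_ge0 ?(ltW (k0 _)).
apply: (@le_trans _ _ ((k r * (k r `^ (-1)) `^ q)%:E * (k r `^ q)%:E)).
  rewrite lee_wpmul2l ?lee_fin ?mulr_ge0 ?powR_ge0 ?(ltW (k0 _))//.
  by have := Fh _ rst; rewrite /k rst.
rewrite -EFinM lee_fin -mulrA -powRM ?powR_ge0 ?(ltW (k0 _))// mulrC (mulrC (_ `^ (-1))%R) kV.
by rewrite powR1 mul1r.
Qed.

End duhamel.
(** * Singular nonlinearity *)

Section nonlinear_estimates.
Context {R : realType} {N : nat}.
Notation RN := 'rV[R]_N.
Notation mu := (lebesgue_row N : {sigma_finite_measure set RN -> \bar R}).
Local Open Scope ereal_scope.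

(** For p = al + 1 this is the nonlinearity on nonnegative functions. *)
Definition kap (g p : R) (V : RN -> \bar R) (y : RN) : \bar R :=
  (enorm y `^ (- g))%:E * V y `^ p.

Definition cutin (r : R) (f : RN -> \bar R) (y : RN) : \bar R :=
  if (enorm y < r)%R then f y else 0.

Definition cutout (r : R) (f : RN -> \bar R) (y : RN) : \bar R :=
  if (enorm y < r)%R then 0 else f y.

Lemma measurable_enorm_lt r : measurable_fun [set: RN] (fun y : RN => (enorm y < r)%R).
Proof. by apply: measurable_fun_ltr => //; exact: (measurable_enorm (f := id)). Qed.

Lemma measurable_cutin r f : measurable_fun [set: RN] f ->
  measurable_fun [set: RN] (cutin r f).
Proof. by move=> mf; apply: measurable_fun_ifT => //; exact: measurable_enorm_lt. Qed.

Lemma measurable_cutout r f : measurable_fun [set: RN] f ->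
  measurable_fun [set: RN] (cutout r f).
Proof. by move=> mf; apply: measurable_fun_ifT => //; exact: measurable_enorm_lt. Qed.

Lemma cutin_ge0 r f : (forall y, 0 <= f y) -> forall y, 0 <= cutin r f y.
Proof. by move=> f0 y; rewrite /cutin; case: ifP. Qed.

Lemma cutout_ge0 r f : (forall y, 0 <= f y) -> forall y, 0 <= cutout r f y.
Proof. by move=> f0 y; rewrite /cutout; case: ifP. Qed.

Lemma cutin_cutout r f : (fun y => cutin r f y + cutout r f y) = f.
Proof.
by apply/funext => y; rewrite /cutin /cutout; case: ifP; rewrite ?adde0 ?add0e.
Qed.

Lemma integral_cutin r f : \int[mu]_y cutin r f y = \int[mu]_(y in eball r) f y.
Proof.
rewrite [RHS]integral_mkcond; apply: eq_integral => y _.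
by rewrite /cutin patchE; congr (if _ then _ else _); rewrite mem_setE.
Qed.

Lemma measurable_singular (g : R) :
  measurable_fun [set: RN] (fun y : RN => (enorm y `^ (- g))%:E).
Proof.
apply/measurable_EFinP; apply: (measurableT_comp (measurable_powR _)).
exact: (measurable_enorm (f := id)).
Qed.

Lemma measurable_kap g p V : measurable_fun [set: RN] V ->
  measurable_fun [set: RN] (kap g p V).
Proof.
move=> mV; apply: emeasurable_funM; first exact: measurable_singular.
exact: measurable_poweR_comp.
Qed.

Lemma kap_ge0 g p V y : 0 <= kap g p V y.
Proof. by rewrite mule_ge0 ?poweR_ge0// lee_fin powR_ge0. Qed.

Lemma le_kap g p V W y : (0 <= p)%R -> (forall y, 0 <= V y) -> (forall y, V y <= W y) ->
  kap g p V y <= kap g p W y.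
Proof.
move=> p0 V0 VW; rewrite lee_wpmul2l ?lee_fin ?powR_ge0//.
apply: gt0_ler_poweR; rewrite ?in_itv/= ?leey ?andbT//.
exact: le_trans (VW y).
Qed.

Lemma poweR_interp (v : \bar R) (m p th : R) : 0 <= v -> v <= m%:E -> (0 < p)%R ->
  (0 <= th)%R -> (th <= p)%R -> v `^ p <= (m `^ (p - th))%:E * v `^ th.
Proof.
case: v => [v||]//; rewrite !poweR_EFin !lee_fin => v0 vm p0 th0 thp.
have [->|vn0] := eqVneq v 0%R; first by rewrite powR0 ?gt_eqF// mulr_ge0 ?powR_ge0.
have {1}-> : (p = (p - th) + th)%R by ring.
rewrite powRD ?vn0 ?implybT// ler_wpM2r ?powR_ge0//.
by apply: ge0_ler_powR; rewrite ?nnegrE ?subr_ge0// (le_trans v0).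
Qed.

Lemma powR_antitone (x y p : R) : (0 < x)%R -> (x <= y)%R -> (0 <= p)%R ->
  (y `^ (- p) <= x `^ (- p))%R.
Proof.
move=> x0 xy p0; have y0 := lt_le_trans x0 xy.
rewrite !powRN lef_pV2 ?posrE ?powR_gt0//.
by apply: ge0_ler_powR; rewrite ?nnegrE ?(ltW x0) ?(ltW y0).
Qed.

Section static.
Variables (g al m : R) (V : RN -> \bar R).
Hypotheses (N0 : (0 < N)%N) (g0 : (0 < g)%R) (gN : (g < N%:R)%R) (al0 : (0 < al)%R).
Hypotheses (mV : measurable_fun [set: RN] V) (V0 : forall y, 0 <= V y).
Hypotheses (m0 : (0 <= m)%R) (Vm : forall y, V y <= m%:E).
Let K := kap g (al + 1) V.
Let mK : measurable_fun [set: RN] K := measurable_kap _ _ mV.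
Let K0 y : 0 <= K y := kap_ge0 _ _ _ y.
Let al1 : (0 < al + 1)%R. Proof. by rewrite addr_gt0. Qed.

Lemma cutout_kap_le (r : R) y : (0 < r)%R -> cutout r K y <= (r `^ (- g) * m `^ al)%:E * V y.
Proof.
move=> r0; rewrite /cutout; case: ifPn => [_|]; first by rewrite mule_ge0// lee_fin mulr_ge0 ?powR_ge0.
rewrite -leNgt => ry; rewrite EFinM -muleA lee_pmul ?lee_fin ?powR_ge0 ?poweR_ge0//.
  by apply: powR_antitone => //; exact: ltW.
have h1 : (1 <= al + 1)%R by rewrite lerDr ltW.
apply: le_trans (poweR_interp (V0 y) (Vm y) al1 ler01 h1) _.
by rewrite addrK poweRe1.
Qed.

Lemma cutout_kap_sup (r : R) y : (0 < r)%R -> cutout r K y <= (r `^ (- g) * m `^ (al + 1))%:E.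
Proof.
move=> r0; apply: le_trans (cutout_kap_le y r0) _.
have -> : (m `^ (al + 1) = m `^ al * m)%R.
  by rewrite [RHS]mulrC -{2}[al](addrK 1%R) mulr_powRB1.
by rewrite mulrA [leRHS]EFinM lee_wpmul2l// lee_fin mulr_ge0 ?powR_ge0.
Qed.

Lemma Lq_le_cutout_kap (q r M : R) : (1 <= q)%R -> (0 < r)%R -> (0 <= M)%R ->
  Lq_le q V M -> Lq_le q (cutout r K) (r `^ (- g) * m `^ al * M)%R.
Proof.
move=> q1 r0 M0 VM; have q0 : (0 < q)%R by apply: lt_le_trans q1.
have c0 : (0 <= r `^ (- g) * m `^ al)%R by rewrite mulr_ge0 ?powR_ge0.
apply: (@Lq_le_mono _ _ q _ (fun y => (r `^ (- g) * m `^ al)%:E * V y) (r `^ (- g) * m `^ al * M)%R) => //.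
- exact: ltW.
- exact: measurable_cutout.
- exact: measurable_funeM.
- exact: cutout_ge0.
- by move=> y; exact: cutout_kap_le.
- by rewrite mulr_ge0.
rewrite /Lq_le; under eq_integral do rewrite poweRM ?lee_fin// poweR_EFin.
rewrite ge0_integralZl ?lee_fin ?powR_ge0//; last 2 first.
- exact: measurable_poweR_comp.
- by move=> y _; exact: poweR_ge0.
by rewrite [in leRHS](powRM _ c0 M0) [leRHS]EFinM lee_wpmul2l// lee_fin powR_ge0.
Qed.

Lemma integral_cutin_kap_sup (r : R) : (0 < r)%R ->
  \int[mu]_y cutin r K y <= (Kball (N := N) g * r `^ (N%:R - g) * m `^ (al + 1))%:E.
Proof.
move=> r0; rewrite integral_cutin.
have mB := @measurable_eball R N r.
apply: (@le_trans _ _ (\int[mu]_(y in eball r) ((enorm y `^ (- g))%:E * (m `^ (al + 1))%:E))).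
  apply: ge0_le_integral => //.
  - exact: measurable_funTS.
  - by apply: emeasurable_funM => //; apply: measurable_funTS; exact: measurable_singular.
  - move=> y _; rewrite lee_wpmul2l ?lee_fin ?powR_ge0// -poweR_EFin.
    by apply: gt0_ler_poweR; rewrite ?in_itv/= ?leey ?andbT ?lee_fin ?(ltW al1).
rewrite ge0_integralZr ?lee_fin ?powR_ge0//; last 2 first.
- by apply: measurable_funTS; exact: measurable_singular.
- by move=> y _; rewrite lee_fin powR_ge0.
rewrite [leRHS]EFinM lee_wpmul2r ?lee_fin ?powR_ge0//.
exact: integral_enorm_powR_le (ltW g0) gN.
Qed.

(** A bound for the norm of |y|^(-g) on the unit ball in L^(q/(q-th)), the space dual to L^(q/th); 1
    - th/q is the inverse of that exponent. *)
Definition K1 (q th : R) := (Kball (N := N) (g * (q / (q - th))) `^ (1 - th / q))%R.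

Lemma Kball_ge0 (a : R) : (a <= N%:R)%R -> (0 <= Kball (N := N) a)%R.
Proof.
move=> aN; rewrite exprn_ge0// divr_ge0// subr_ge0 ler_pdivrMr ?ltr0n// mul1r//.
Qed.

(* Hoelder's inequality with exponents q/th and q/(q-th). *)
Lemma integral_cutin_kap (q th r M : R) : (1 < q)%R -> (0 < r)%R -> (0 <= M)%R ->
  (0 < th)%R -> (th <= al + 1)%R -> (th < q * (1 - g / N%:R))%R ->
  Lq_le q V M ->
  \int[mu]_y cutin r K y <= (K1 q th * r `^ (N%:R * (1 - th / q) - g) *
    (m `^ (al + 1 - th) * M `^ th))%:E.
Proof.
move=> q1 r0 M0 th0 thal thq VM; rewrite integral_cutin.
have q0 : (0 < q)%R by lra.
have Npos : (0 < N%:R :> R)%R by rewrite ltr0n.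
have gN0 : (0 < g / N%:R)%R by rewrite divr_gt0.
have thq' : (th < q)%R by nra.
have gN1 : (0 < 1 - g / N%:R)%R by rewrite subr_gt0 ltr_pdivrMr// mul1r.
set s := (q / th)%R; set s' := (q / (q - th))%R.
have qth : (0 < q - th)%R by rewrite subr_gt0.
have s1 : (1 <= s)%R by rewrite ler_pdivlMr// mul1r ltW.
have s'0 : (0 < s')%R by rewrite divr_gt0.
have s'1 : (1 <= s')%R by rewrite ler_pdivlMr// mul1r; lra.
have gs'N : (g * s' < N%:R)%R.
  rewrite mulrA ltr_pdivrMr//.
  have : (N%:R * th < N%:R * (q * (1 - g / N%:R)))%R by rewrite ltr_pM2l.
  have -> : (N%:R * (q * (1 - g / N%:R)) = N%:R * q - g * q)%R by field; rewrite gt_eqF.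
  lra.
have mB := @measurable_eball R N r.
set I := (Kball (N := N) (g * s') * r `^ (N%:R - g * s'))%R.
have gs'0 : (0 < g * s')%R by rewrite mulr_gt0.
have KB0 : (0 < Kball (N := N) (g * s'))%R.
  by rewrite exprn_gt0// divr_gt0// subr_gt0 ltr_pdivrMr// mul1r.
have I0 : (0 < I)%R by rewrite mulr_gt0 ?powR_gt0.
have kI := integral_enorm_powR_le N0 r0 (ltW gs'0) gs'N.
(* Hoelder's inequality is [weighted_jensen] with weight |y|^(-g s'). The factor |y|^(g (s' - 1))
   restores |y|^(-g), and its s-th power cancels the weight because (s' - 1) s = s'. The double
   opposite gives this positive power the shape of [measurable_singular]. *)
have mf : measurable_fun [set: RN] (fun y : RN => (enorm y `^ (- - (g * (s' - 1))))%:E * V y `^ th).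
  by apply: emeasurable_funM; [exact: measurable_singular|exact: measurable_poweR_comp].
have Vq0 y : 0 <= V y `^ q by exact: poweR_ge0.
have J : \int[mu]_(y in eball r) ((enorm y `^ (- (g * s')))%:E *
    ((enorm y `^ (- - (g * (s' - 1))))%:E * V y `^ th)) <= (I `^ (1 - th / q) * M `^ th)%:E.
  apply: (@poweR_le_EFin _ s) => //.
  - by rewrite divr_gt0.
  - by apply: integral_ge0 => y _; rewrite !mule_ge0 ?poweR_ge0// lee_fin powR_ge0.
  - by rewrite mulr_ge0 ?powR_ge0.
  apply: le_trans (weighted_jensen (mu := mu) mB _ _ _ _ s1 I0 kI) _.
  - by apply: measurable_funTS; exact: measurable_singular.
  - exact: measurable_funTS.
  - by move=> y _; rewrite lee_fin powR_ge0.
  - by move=> y _; rewrite mule_ge0 ?poweR_ge0// lee_fin powR_ge0.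
  apply: (@le_trans _ _ ((I `^ (s - 1))%:E * (M `^ q)%:E)).
    rewrite lee_wpmul2l ?lee_fin ?powR_ge0//; apply: le_trans VM.
    rewrite -(integral_cutin r (fun y => _)).
    apply: ge0_le_integral => //.
    - move=> y _; apply: cutin_ge0 => z; rewrite mule_ge0 ?poweR_ge0// lee_fin powR_ge0//.
    - apply: measurable_cutin; apply: emeasurable_funM; first exact: measurable_singular.
      exact: (measurableT_comp (measurable_poweR _)).
    - exact: measurable_poweR_comp.
    - move=> y _; rewrite /cutin; case: ifP => // _.
      rewrite poweRM ?poweR_ge0 ?lee_fin ?powR_ge0// -poweRrM.
      have -> : (th * s = q)%R by rewrite /s mulrCA divff ?gt_eqF// mulr1.
      rewrite muleA -[leRHS]mul1e lee_wpmul2r// poweR_EFin -EFinM lee_fin opprK.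
      have [->|yn0] := eqVneq (enorm y) 0%R.
        by rewrite powR0 ?mul0r// oppr_eq0 gt_eqF.
      rewrite -powRrM -powRD ?yn0 ?implybT//.
      rewrite (_ : (- (g * s') + _ = 0)%R) ?powRr0//.
      by rewrite /s /s'; field; rewrite !gt_eqF.
  rewrite -EFinM lee_fin powRM ?powR_ge0// -!powRrM.
  have -> : (th * s = q)%R by rewrite /s mulrCA divff ?gt_eqF// mulr1.
  have -> : ((1 - th / q) * s = s - 1)%R by rewrite /s; field; rewrite !gt_eqF.
  by [].
apply: (@le_trans _ _ ((m `^ (al + 1 - th))%:E * (I `^ (1 - th / q) * M `^ th)%:E)); last first.
  rewrite -EFinM lee_fin /I powRM ?powR_ge0 ?(ltW KB0)// -powRrM.
  have -> : ((N%:R - g * s') * (1 - th / q) = N%:R * (1 - th / q) - g)%R.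
    by rewrite /s'; field; rewrite !gt_eqF.
  by rewrite /K1 -/s' le_eqVlt; apply/orP; left; apply/eqP; ring.
apply: le_trans (lee_wpmul2l _ J); last by rewrite lee_fin powR_ge0.
rewrite -ge0_integralZl ?lee_fin ?powR_ge0//; last 2 first.
- apply: measurable_funTS; apply: emeasurable_funM => //; exact: measurable_singular.
- by move=> y _; rewrite !mule_ge0 ?poweR_ge0// lee_fin powR_ge0.
apply: ge0_le_integral => //.
- exact: measurable_funTS.
- apply: measurable_funTS; apply: measurable_funeM.
  by apply: emeasurable_funM => //; exact: measurable_singular.
move=> y _; rewrite /K /kap.
have -> : (enorm y `^ (- g) = enorm y `^ (- (g * s')) * enorm y `^ (- - (g * (s' - 1))))%R.
  rewrite opprK; have [->|yn0] := eqVneq (enorm y) 0%R.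
    have h1 : (- g != 0)%R by rewrite oppr_eq0 gt_eqF.
    have h2 : (- (g * s') != 0)%R by rewrite oppr_eq0 gt_eqF.
    by rewrite (powR0 h1) (powR0 h2) mul0r.
  by rewrite -powRD ?yn0 ?implybT//; congr (_ `^ _)%R; ring.
rewrite EFinM -!muleA [leRHS]muleCA lee_wpmul2l ?lee_fin ?powR_ge0//.
rewrite [leRHS]muleCA lee_wpmul2l ?lee_fin ?powR_ge0//.
exact: poweR_interp (ltW th0) thal.
Qed.

End static.
End nonlinear_estimates.

(** * Smoothing estimates for the singular nonlinearity *)

Section smoothing_estimates.
Context {R : realType} {N : nat}.
Notation RN := 'rV[R]_N.
Notation mu := (lebesgue_row N : {sigma_finite_measure set RN -> \bar R}).
Notation leb := (@lebesgue_measure R : {sigma_finite_measure set (measurableTypeR R) -> \bar R}).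
Local Open Scope ereal_scope.

Lemma powR_4pi_le (t x : R) : (0 < t)%R -> (0 <= x)%R ->
  ((4 * pi * t) `^ (- x) <= t `^ (- x))%R.
Proof. by move=> t0 x0; apply: powR_antitone => //; have := pi_ge2 R; nra. Qed.

Lemma powR_sqrt (t x : R) : ((t `^ 2^-1) `^ x = t `^ (x / 2))%R.
Proof. by rewrite -powRrM mulrC. Qed.

Lemma powR_addr (t x y : R) : (0 < t)%R -> (t `^ x * t `^ y = t `^ (x + y))%R.
Proof. by move=> t0; rewrite powRD// (gt_eqF t0) implybT. Qed.

Section static.
Variables (g al m t : R) (V : RN -> \bar R).
Hypotheses (N0 : (0 < N)%N) (g0 : (0 < g)%R) (gN : (g < N%:R)%R) (al0 : (0 < al)%R).
Hypotheses (mV : measurable_fun [set: RN] V) (V0 : forall y, 0 <= V y).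
Hypotheses (m0 : (0 <= m)%R) (Vm : forall y, V y <= m%:E) (t0 : (0 < t)%R).
Let K := kap g (al + 1) V.
Let rho := (t `^ 2^-1)%R.
Let rho0 : (0 < rho)%R. Proof. by rewrite powR_gt0. Qed.
Let mK : measurable_fun [set: RN] K := measurable_kap _ _ mV.
Let K0 y : 0 <= K y := kap_ge0 _ _ _ y.
Let mi := measurable_cutin rho mK.
Let mo := measurable_cutout rho mK.
Let i0 := cutin_ge0 rho K0.
Let o0 := cutout_ge0 rho K0.

(** Both halves scale alike: inside the ball of radius sqrt t the kernel bound t^(-N/2) meets the
    integral t^((N-g)/2) of the weight, outside it the weight itself is at most t^(-g/2). *)
Lemma heate_kap_sup x :
  heate t K x <= ((1 + Kball (N := N) g) * (t `^ (- (g / 2)) * m `^ (al + 1)))%:E.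
Proof.
rewrite -(cutin_cutout rho K) heateD//.
rewrite [leRHS](_ : _ = (Kball (N := N) g * (t `^ (- (g / 2)) * m `^ (al + 1)))%:E +
  (t `^ (- (g / 2)) * m `^ (al + 1))%:E); last by rewrite -EFinD; congr _%:E; ring.
apply: leeD.
  apply: le_trans (heate_sup x t0 mi i0) _.
  apply: (@le_trans _ _ (((4 * pi * t) `^ (- (N%:R / 2)))%:E *
     (Kball (N := N) g * rho `^ (N%:R - g) * m `^ (al + 1))%:E)).
    rewrite lee_wpmul2l ?lee_fin ?powR_ge0//.
    exact: integral_cutin_kap_sup.
  rewrite -EFinM lee_fin powR_sqrt.
  have -> : (- (g / 2) = - (N%:R / 2) + (N%:R - g) / 2)%R by field.
  rewrite -(powR_addr _ _ t0) [leRHS](_ : _ = t `^ (- (N%:R / 2)) *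
    (Kball (N := N) g * t `^ ((N%:R - g) / 2) * m `^ (al + 1)))%R; last by ring.
  rewrite ler_wpM2r ?mulr_ge0 ?powR_ge0//; first by rewrite (Kball_ge0 N0)// ltW.
  exact: powR_4pi_le.
apply: (@le_trans _ _ (heate t (cst (rho `^ (- g) * m `^ (al + 1))%:E) x)).
  apply: le_heate => // y; exact: cutout_kap_sup.
rewrite heate_cst ?mulr_ge0 ?powR_ge0// powR_sqrt lee_fin.
by rewrite mulNr.
Qed.

Variables (q th M : R).
Hypotheses (q1 : (1 < q)%R) (M0 : (0 <= M)%R) (th0 : (0 < th)%R)
  (thal : (th <= al + 1)%R) (thq : (th < q * (1 - g / N%:R))%R).
Hypothesis VM : Lq_le q V M.
Let q0 : (0 < q)%R. Proof. exact: lt_trans q1. Qed.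
Let a := (N%:R / (2 * q))%R.
(** The time exponent of the inner half: the loss N/2 (1 - 1/q) of the passage from L^1 to L^q,
    minus the gain (N (1 - th/q) - g)/2 due to the radius sqrt t. *)
Let c := (a * (th - 1) + g / 2)%R.
Let Npos : (0 < N%:R :> R)%R. Proof. by rewrite ltr0n. Qed.
Let a0 : (0 < a)%R. Proof. by rewrite divr_gt0// mulr_gt0. Qed.

(** The inner half is in L^1 by [integral_cutin_kap] and is smoothed to L^q; the outer half is
    already in L^q, where the semigroup is a contraction. *)
Lemma heate_kap_Lq : Lq_le q (heate t K)
  (4 * (K1 (N := N) g q th * (t `^ (- c) * (m `^ (al + 1 - th) * M `^ th)) +
        t `^ (- (g / 2)) * (m `^ al * M)))%R.
Proof.
rewrite -(cutin_cutout rho K).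
have -> : heate t (fun y => cutin rho K y + cutout rho K y) =
   (fun x => heate t (cutin rho K) x + heate t (cutout rho K) x).
  by apply/funext => x; rewrite heateD.
have q1' := ltW q1.
apply: Lq_leD => //; try exact: measurable_heate; try by move=> x; exact: heate_ge0.
- by rewrite !mulr_ge0 ?powR_ge0.
- by rewrite !mulr_ge0 ?powR_ge0.
- have := heate_L1_Lq q1' t0 mi i0 _ (integral_cutin_kap N0 g0 gN al0 mV V0 Vm q1 rho0 M0 th0 thal thq VM).
  rewrite !mulr_ge0 ?powR_ge0// => /(_ isT) H.
  apply: (Lq_le_mono _ _ _ _ (fun x => lexx _) _ _ H) => //.
  + exact: ltW.
  + exact: measurable_heate.
  + exact: measurable_heate.
  + by move=> x; exact: heate_ge0.
  + by rewrite !mulr_ge0 ?powR_ge0.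
  rewrite powR_sqrt.
  have -> : (- c = - (N%:R / 2 * (1 - q^-1)) + (N%:R * (1 - th / q) - g) / 2)%R.
    by rewrite /c /a; field; rewrite gt_eqF.
  rewrite -(powR_addr _ _ t0) [leRHS](_ : _ = t `^ (- (N%:R / 2 * (1 - q^-1))) *
    (K1 (N := N) g q th * t `^ ((N%:R * (1 - th / q) - g) / 2) * (m `^ (al + 1 - th) * M `^ th)))%R; last by ring.
  rewrite ler_wpM2r ?mulr_ge0 ?powR_ge0//; apply: powR_4pi_le => //.
  by rewrite mulr_ge0 ?subr_ge0 ?invf_le1 ?(ltW q1) ?divr_ge0.
- apply: Lq_le_heate => //.
  have := Lq_le_cutout_kap g0 al0 mV V0 Vm q1' rho0 M0 VM.
  by rewrite powR_sqrt mulNr mulrA.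
Qed.

(** The same two halves smoothed up to the sup norm, each at the price of an additional factor
    t^(-a), a = N/(2q). *)
Lemma heate_kap_Lq_sup x : heate t K x <=
  (K1 (N := N) g q th * (t `^ (- (a + c)) * (m `^ (al + 1 - th) * M `^ th)) +
        t `^ (- (a + g / 2)) * (m `^ al * M))%:E.
Proof.
rewrite -(cutin_cutout rho K) heateD// EFinD.
have q1' := ltW q1.
apply: leeD.
- apply: le_trans (heate_sup x t0 mi i0) _.
  apply: (@le_trans _ _ (((4 * pi * t) `^ (- (N%:R / 2)))%:E *
     (K1 (N := N) g q th * rho `^ (N%:R * (1 - th / q) - g) *
    (m `^ (al + 1 - th) * M `^ th))%:E)).
    rewrite lee_wpmul2l ?lee_fin ?powR_ge0//.
    exact: integral_cutin_kap.
  rewrite -EFinM lee_fin powR_sqrt.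
  have -> : (- (a + c) = - (N%:R / 2) + (N%:R * (1 - th / q) - g) / 2)%R.
    by rewrite /c /a; field; rewrite gt_eqF.
  rewrite -(powR_addr _ _ t0) [leRHS](_ : _ = t `^ (- (N%:R / 2)) *
    (K1 (N := N) g q th * t `^ ((N%:R * (1 - th / q) - g) / 2) * (m `^ (al + 1 - th) * M `^ th)))%R; last by ring.
  rewrite ler_wpM2r ?mulr_ge0 ?powR_ge0//; exact: powR_4pi_le.
- have := heate_Lq_sup x q1' t0 mo o0 _ (Lq_le_cutout_kap g0 al0 mV V0 Vm q1' rho0 M0 VM).
  rewrite !mulr_ge0 ?powR_ge0// => /(_ isT) /le_trans; apply.
  rewrite lee_fin powR_sqrt -/a mulNr opprD -(powR_addr _ _ t0).
  rewrite [leRHS](_ : _ = t `^ (- a) * (t `^ (- (g / 2)) * m `^ al * M))%R; last by ring.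
  rewrite ler_wpM2r ?mulr_ge0 ?powR_ge0//.
  exact: powR_4pi_le (ltW a0).
Qed.

End static.

(** At every r one of t - r and r - s is at least half of t - s; the corresponding factor is bounded
    by its value there, and a single power remains to be integrated. *)
Lemma integral_beta_le (s t b c : R) : (s < t)%R -> (0 <= b)%R -> (b < 1)%R ->
  (0 <= c)%R -> (c < 1)%R ->
  \int[leb]_(r in `]s, t[) ((t - r) `^ (- c) * (r - s) `^ (- b))%:E <=
  ((2 `^ c / (1 - b) + 2 `^ b / (1 - c)) * (t - s) `^ (1 - b - c))%:E.
Proof.
move=> st b0 b1 c0 c1; set L := ((t - s) / 2)%R.
have ts0 : (0 < t - s)%R by rewrite subr_gt0.
have L0 : (0 < L)%R by rewrite divr_gt0.
have LE x : (L `^ (- x) = 2 `^ x * (t - s) `^ (- x))%R.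
  rewrite /L powRM ?(ltW ts0) ?invr_ge0// -(powR_inv1 (ler0n _ 2)) -powRrM mulrC.
  by rewrite mulN1r opprK.
have mr : measurable_fun `]s, t[ (fun r : R => ((r - s) `^ (- b))%:E).
  apply/measurable_EFinP; apply: measurable_funTS.
  by apply: (measurableT_comp (measurable_powR _)); exact: measurable_funB.
have ml : measurable_fun `]s, t[ (fun r : R => ((t - r) `^ (- c))%:E).
  apply/measurable_EFinP; apply: measurable_funTS.
  by apply: (measurableT_comp (measurable_powR _)); exact: measurable_funB.
apply: (@le_trans _ _ (\int[leb]_(r in `]s, t[) ((L `^ (- c))%:E * ((r - s) `^ (- b))%:E +
   (L `^ (- b))%:E * ((t - r) `^ (- c))%:E))).
  apply: ge0_le_integral => //.
  - by move=> r _; rewrite lee_fin mulr_ge0 ?powR_ge0.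
  - by apply/measurable_EFinP; apply: measurable_funM; apply/measurable_EFinP.
  - by apply: emeasurable_funD; exact: measurable_funeM.
  - move=> r; rewrite /= in_itv/= => /andP[sr rt]; rewrite -!EFinM -EFinD lee_fin.
    have [h|h] := leP L (t - r)%R.
      apply: ler_wpDr; first by rewrite mulr_ge0 ?powR_ge0.
      by rewrite ler_wpM2r ?powR_ge0//; exact: powR_antitone.
    apply: ler_wpDl; first by rewrite mulr_ge0 ?powR_ge0.
    rewrite mulrC ler_wpM2r ?powR_ge0//; apply: powR_antitone => //.
    by move: h; rewrite /L; lra.
rewrite ge0_integralD//=; last 4 first.
- by move=> r _; rewrite -EFinM lee_fin mulr_ge0 ?powR_ge0.
- exact: measurable_funeM.
- by move=> r _; rewrite -EFinM lee_fin mulr_ge0 ?powR_ge0.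
- exact: measurable_funeM.
rewrite !ge0_integralZl//; try by rewrite lee_fin powR_ge0.
- apply: (@le_trans _ _ ((L `^ (- c))%:E * ((t - s) `^ (1 - b) / (1 - b))%:E +
    (L `^ (- b))%:E * ((t - s) `^ (1 - c) / (1 - c))%:E)).
    apply: leeD; rewrite lee_wpmul2l ?lee_fin ?powR_ge0//.
      by apply: integral_powRr_le => //; exact: ltW.
    by apply: integral_powRl_le => //; exact: ltW.
  rewrite -!EFinM -EFinD lee_fin !LE.
  have e1 : ((t - s) `^ (1 - b - c) = (t - s) `^ (- c) * (t - s) `^ (1 - b))%R.
    by rewrite powR_addr//; congr (_ `^ _)%R; ring.
  have e2 : ((t - s) `^ (1 - b - c) = (t - s) `^ (- b) * (t - s) `^ (1 - c))%R.
    by rewrite powR_addr//; congr (_ `^ _)%R; ring.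
  rewrite mulrDl {1}e1 e2 le_eqVlt; apply/orP; left; apply/eqP.
  by field; apply/andP; split; rewrite gt_eqF// subr_gt0.
- by move=> r _; rewrite lee_fin powR_ge0.
- by move=> r _; rewrite lee_fin powR_ge0.
Qed.

End smoothing_estimates.

(** * Estimates of the Duhamel integral *)

Section duhamel_estimates.
Context {R : realType} {N : nat}.
Notation RN := 'rV[R]_N.
Notation mu := (lebesgue_row N : {sigma_finite_measure set RN -> \bar R}).
Notation leb := (@lebesgue_measure R : {sigma_finite_measure set (measurableTypeR R) -> \bar R}).
Local Open Scope ereal_scope.

Lemma jmeasurable_kap g p (w : R -> RN -> \bar R) : jmeasurable w ->
  jmeasurable (fun r => kap g p (w r)).
Proof.
move=> mw; apply: emeasurable_funM.
  by apply: (measurableT_comp (measurable_singular g)); exact: measurable_snd.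
exact: (measurableT_comp (measurable_poweR _)).
Qed.

Lemma jmeasurable_heate t (F : R -> RN -> \bar R) : jmeasurable F ->
  (forall s x, 0 <= F s x) -> jmeasurable (fun r => heate (t - r) (F r)).
Proof.
move=> mF F0; apply: (@measurable_heate_duh R N F mF F0 _ _ (cst t) fst snd).
- exact: measurable_cst.
- exact: measurable_fst.
- exact: measurable_snd.
Qed.

Lemma measurable_kernel_time (s t b c : R) :
  measurable_fun [set: R] (fun r : R => (t - r) `^ (- c) * (r - s) `^ (- b))%R.
Proof.
apply: measurable_funM; apply: (measurableT_comp (measurable_powR _));
exact: measurable_funB.
Qed.

(** The constant of [integral_beta_le], an upper bound for Euler's Beta function at (1 - b, 1 -
    c). *)
Definition Bt (b c : R) := (2 `^ c / (1 - b) + 2 `^ b / (1 - c))%R.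

Lemma Bt_gt0 b c : (b < 1)%R -> (c < 1)%R -> (0 < Bt b c)%R.
Proof. by move=> b1 c1; rewrite addr_gt0// divr_gt0 ?powR_gt0 ?subr_gt0. Qed.

Variables (g al : R).
Hypotheses (N0 : (0 < N)%N) (g0 : (0 < g)%R) (gN : (g < N%:R)%R) (g2 : (g < 2)%R)
  (al0 : (0 < al)%R).
Let Npos : (0 < N%:R :> R)%R. Proof. by rewrite ltr0n. Qed.
Let KB0 : (0 <= Kball (N := N) g)%R. Proof. by rewrite (Kball_ge0 N0)// ltW. Qed.

Variables (s t M : R) (w : R -> RN -> \bar R).
Hypotheses (M0 : (0 < M)%R) (mw : jmeasurable w) (w0 : forall r x, 0 <= w r x).
Let mws r := jmeasurable_section r mw.
Let mk := jmeasurable_kap g (al + 1) mw.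
Let k0 r := @kap_ge0 R N g (al + 1) (w r).

Lemma duh_kap_bounded x : (s <= t)%R ->
  (forall r x, (s < r < t)%R -> w r x <= M%:E) ->
  duh s t (fun r => kap g (al + 1) (w r)) x <=
    ((1 + Kball (N := N) g) / (1 - g / 2) * (M `^ (al + 1) * (t - s) `^ (1 - g / 2)))%:E.
Proof.
move=> st wM.
have ml : measurable_fun `]s, t[ (fun r : R => ((t - r) `^ (- (g / 2)))%:E).
  apply/measurable_EFinP; apply: measurable_funTS.
  by apply: (measurableT_comp (measurable_powR _)); exact: measurable_funB.
have c0 : (0 <= (1 + Kball (N := N) g) * M `^ (al + 1))%R.
  by rewrite mulr_ge0 ?powR_ge0 ?addr_ge0.
apply: (@le_trans _ _ (\int[leb]_(r in `]s, t[)
    (((1 + Kball (N := N) g) * M `^ (al + 1))%:E * ((t - r) `^ (- (g / 2)))%:E))).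
  apply: ge0_le_integral => //.
  - by move=> r _; exact: heate_ge0.
  - exact: measurable_heate_sigma.
  - exact: measurable_funeM.
  - move=> r; rewrite /= in_itv/= => /[dup] rst /andP[_ rt].
    apply: le_trans (heate_kap_sup N0 g0 gN al0 (mws r) (w0 r) (ltW M0) (wM r^~ rst) _ x) _.
      by rewrite subr_gt0.
    by rewrite -EFinM lee_fin le_eqVlt; apply/orP; left; apply/eqP; ring.
rewrite ge0_integralZl//; last by move=> r _; rewrite lee_fin powR_ge0.
apply: (@le_trans _ _ (((1 + Kball (N := N) g) * M `^ (al + 1))%:E *
  ((t - s) `^ (1 - g / 2) / (1 - g / 2))%:E)).
  rewrite lee_wpmul2l ?lee_fin//; apply: integral_powRl_le => //.
  by rewrite ltr_pdivrMr// mul1r.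
by rewrite -EFinM lee_fin le_eqVlt; apply/orP; left; apply/eqP; ring.
Qed.

Variables (q th : R).
Hypotheses (q1 : (1 < q)%R) (th0 : (0 < th)%R)
  (thal : (th <= al + 1)%R) (thq : (th < q * (1 - g / N%:R))%R)
  (thb : (al + 1 - 2 * q / N%:R < th)%R) (thc : (1 - q * g / N%:R < th)%R)
  (thc1 : (th < 1 + q * (2 - g) / N%:R)%R) (qqc : (N%:R * al / (2 - g) < q)%R).
Let q0 : (0 < q)%R. Proof. exact: lt_trans q1. Qed.
Let a := (N%:R / (2 * q))%R.
Let c := (a * (th - 1) + g / 2)%R.
Let b := (a * (al + 1 - th))%R.
Let dl := (1 - g / 2 - a * al)%R.
Let a0 : (0 < a)%R. Proof. by rewrite divr_gt0// mulr_gt0. Qed.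
Let aE : (2 * q / N%:R = a^-1)%R. Proof. by rewrite /a invf_div. Qed.

(** The exponents b of r - s and c of t - r must lie in [0, 1[ for the time integral to be
    controlled by [integral_beta_le]: [thal] and [thb] bound b, [thc] and [thc1] bound c. *)
Lemma b_ge0 : (0 <= b)%R.
Proof. by rewrite mulr_ge0 ?(ltW a0)// subr_ge0. Qed.

Lemma b_lt1 : (b < 1)%R.
Proof.
by rewrite /b mulrC -ltr_pdivlMr// div1r -aE ltrBlDl -ltrBlDr.
Qed.

Lemma c_gt0 : (0 < c)%R.
Proof.
have -> : c = (a * (th - (1 - q * g / N%:R)))%R.
  by rewrite /c /a; field; rewrite !gt_eqF.
by rewrite mulr_gt0// subr_gt0.
Qed.

Lemma c_lt1 : (c < 1)%R.
Proof.
have -> : c = (1 + a * (th - (1 + q * (2 - g) / N%:R)))%R.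
  by rewrite /c /a; field; rewrite !gt_eqF.
by rewrite gtrDl pmulr_rlt0// subr_lt0.
Qed.

(** A restatement of q > N al / (2 - g), that is, of q > q_c(l). *)
Lemma dl_gt0 : (0 < dl)%R.
Proof.
have g20 : (0 < 2 - g)%R by rewrite subr_gt0.
have -> : dl = ((2 - g) / (2 * q) * (q - N%:R * al / (2 - g)))%R.
  by rewrite /dl /a; field; rewrite !gt_eqF.
by rewrite mulr_gt0 ?subr_gt0// divr_gt0// mulr_gt0.
Qed.

Let aal0 : (0 <= a * al)%R. Proof. by rewrite mulr_ge0 ?ltW. Qed.
Let aal1 : (a * al < 1)%R. Proof. by have := dl_gt0; rewrite /dl; have := g0; lra. Qed.
Let gh0 : (0 <= g / 2)%R. Proof. by rewrite divr_ge0// ltW. Qed.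
Let gh1 : (g / 2 < 1)%R. Proof. by rewrite ltr_pdivrMr// mul1r. Qed.

Hypothesis wa : forall r x, (s < r < t)%R -> w r x <= (M * (r - s) `^ (- a))%:E.
Hypothesis wL : forall r, (s < r < t)%R -> Lq_le q (w r) M.
Hypothesis st : (s < t)%R.

Let ma r : (0 <= M * (r - s) `^ (- a))%R.
Proof. by rewrite mulr_ge0 ?powR_ge0 ?ltW. Qed.

Let Mpow r (p : R) : (0 <= p)%R ->
  ((M * (r - s) `^ (- a)) `^ p = M `^ p * (r - s) `^ (- (a * p)))%R.
Proof. by move=> p0; rewrite powRM ?powR_ge0 ?(ltW M0)// -powRrM mulNr. Qed.

Let E1 r : ((M * (r - s) `^ (- a)) `^ (al + 1 - th) * M `^ th =
  M `^ (al + 1) * (r - s) `^ (- b))%R.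
Proof. by rewrite Mpow ?subr_ge0// mulrAC (powR_addr _ _ M0) subrK. Qed.

Let E2 r : ((M * (r - s) `^ (- a)) `^ al * M = M `^ (al + 1) * (r - s) `^ (- (a * al)))%R.
Proof.
rewrite Mpow ?(ltW al0)// mulrAC -{2}(powRr1 (ltW M0)) (powR_addr _ _ M0)//.
Qed.

Definition duhamel_constant : R :=
  (4 * (K1 (N := N) g q th * Bt b c + Bt (a * al) (g / 2)))%R.

Lemma duhamel_constant_gt0 : (0 < duhamel_constant)%R.
Proof.
rewrite mulr_gt0// ltr_wpDl ?Bt_gt0// mulr_ge0 ?powR_ge0// ltW// Bt_gt0//.
  exact: b_lt1.
exact: c_lt1.
Qed.

(** A bound for the L^q norm of the Duhamel integrand at time r, used as the time weight in
    [Lq_le_integral]. *)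
Let h (r : R) := (4 * M `^ (al + 1) * (K1 (N := N) g q th * ((t - r) `^ (- c) * (r - s) `^ (- b)) +
   ((t - r) `^ (- (g / 2)) * (r - s) `^ (- (a * al)))))%R.

Let mh : measurable_fun [set: R] h.
Proof.
apply: measurable_funM => //; apply: measurable_funD; last exact: measurable_kernel_time.
by apply: measurable_funM => //; exact: measurable_kernel_time.
Qed.

(** Since b + c = a al + g/2, both products of powers integrate to multiples of the same (t -
    s)^dl. *)
Let integral_kernel (k k' : R) : (0 <= k)%R -> (0 <= k')%R ->
  \int[leb]_(r in `]s, t[) (k * ((t - r) `^ (- c) * (r - s) `^ (- b)) +
   k' * ((t - r) `^ (- (g / 2)) * (r - s) `^ (- (a * al))))%:E <=
  ((k * Bt b c + k' * Bt (a * al) (g / 2)) * (t - s) `^ dl)%:E.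
Proof.
move=> kk k'k.
have m b' c' : measurable_fun `]s, t[ (fun r : R => ((t - r) `^ (- c') * (r - s) `^ (- b'))%:E).
  by apply/measurable_EFinP; apply: measurable_funTS; exact: measurable_kernel_time.
have p b' c' r : 0 <= ((t - r) `^ (- c') * (r - s) `^ (- b'))%:E.
  by rewrite lee_fin mulr_ge0 ?powR_ge0.
under eq_integral do rewrite EFinD !(EFinM k) !(EFinM k').
rewrite ge0_integralD//=; last 4 first.
- by move=> r _; rewrite mule_ge0.
- exact: (measurable_funeM k%:E (m b c)).
- by move=> r _; rewrite mule_ge0.
- exact: (measurable_funeM k'%:E (m _ _)).
have Z (j b' c' : R) : (0 <= j)%R ->
    \int[leb]_(r in `]s, t[) (j%:E * ((t - r) `^ (- c') * (r - s) `^ (- b'))%:E) =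
    j%:E * \int[leb]_(r in `]s, t[) ((t - r) `^ (- c') * (r - s) `^ (- b'))%:E.
  by move=> j0; rewrite ge0_integralZl//; exact: m.
rewrite !Z// mulrDl EFinD -(mulrA k) -(mulrA k') !(EFinM k) !(EFinM k').
apply: leeD; rewrite lee_wpmul2l//.
- have -> : dl = (1 - b - c)%R by rewrite /dl /b /c; ring.
  exact: integral_beta_le st b_ge0 b_lt1 (ltW c_gt0) c_lt1.
- have -> : dl = (1 - a * al - g / 2)%R by rewrite /dl; ring.
  exact: integral_beta_le st aal0 aal1 gh0 gh1.
Qed.

Lemma integral_heate_kap_Lq : \int[leb]_(r in `]s, t[) (h r)%:E <=
  (duhamel_constant * (M `^ (al + 1) * (t - s) `^ dl))%:E.
Proof.
have M40 : (0 <= 4 * M `^ (al + 1))%R by rewrite mulr_ge0 ?powR_ge0.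
have := @integral_kernel (4 * M `^ (al + 1) * K1 (N := N) g q th)%R (4 * M `^ (al + 1))%R.
rewrite !mulr_ge0 ?powR_ge0// => /(_ isT isT) H.
apply: le_trans (le_trans _ H) _.
  rewrite le_eqVlt; apply/orP; left; apply/eqP; apply: eq_integral => r _.
  by rewrite /h; congr _%:E; ring.
rewrite lee_fin /duhamel_constant le_eqVlt; apply/orP; left; apply/eqP; ring.
Qed.

Lemma heate_kap_Lq_time r : (s < r < t)%R ->
  Lq_le q (heate (t - r) (kap g (al + 1) (w r))) (h r).
Proof.
move=> /[dup] rst /andP[_ rt]; have tr : (0 < t - r)%R by rewrite subr_gt0.
have := heate_kap_Lq N0 g0 gN al0 (mws r) (w0 r) (fun z => @wa r z rst) tr q1 (ltW M0) th0 thal thq (@wL r rst).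
rewrite E1 E2 -/a -/c /h => H.
by rewrite [X in Lq_le _ _ X](_ : _ =
  (4 * (K1 (N := N) g q th * ((t - r) `^ (- c) * (M `^ (al + 1) * (r - s) `^ (- b))) +
    (t - r) `^ (- (g / 2)) * (M `^ (al + 1) * (r - s) `^ (- (a * al)))))%R)//; ring.
Qed.

Lemma h_gt0 r : (s < r < t)%R -> (0 < h r)%R.
Proof.
move=> /andP[sr rt]; rewrite mulr_gt0 ?mulr_gt0 ?powR_gt0// ltr_wpDl ?mulr_ge0 ?powR_ge0//.
by rewrite mulr_gt0 ?powR_gt0 ?subr_gt0.
Qed.

Lemma duh_kap_Lq : Lq_le q (duh s t (fun r => kap g (al + 1) (w r)))
  (duhamel_constant * (M `^ (al + 1) * (t - s) `^ dl)).
Proof.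
apply: (@Lq_le_integral R N q (fun r => heate (t - r) (kap g (al + 1) (w r))) h) => //.
- exact: ltW.
- exact: jmeasurable_heate.
- by move=> *; exact: heate_ge0.
- exact: h_gt0.
- exact: heate_kap_Lq_time.
- by rewrite mulr_gt0 ?duhamel_constant_gt0// mulr_gt0 ?powR_gt0 ?subr_gt0.
- exact: integral_heate_kap_Lq.
Qed.

Definition duhamel_sup_constant : R :=
  (2 `^ a * (K1 (N := N) g q th * Bt b c + (1 + Kball (N := N) g) * Bt (a * al) (g / 2)))%R.

(** Smoothing from L^q to the sup norm costs (t - r)^(-a), which together with the other powers need
    not be integrable at r = t. It is therefore used only for t - r >= L, half of the interval; for
    r closer to t the pointwise bound on w serves, where (r - s)^(-a) is at most L^(-a). *)
Lemma duh_kap_sup x : duh s t (fun r => kap g (al + 1) (w r)) x <=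
  (duhamel_sup_constant * (M `^ (al + 1) * (t - s) `^ dl) * (t - s) `^ (- a))%:E.
Proof.
pose L := ((t - s) / 2)%R.
have ts0 : (0 < t - s)%R by rewrite subr_gt0.
have L0 : (0 < L)%R by rewrite divr_gt0.
have LE : (L `^ (- a) = 2 `^ a * (t - s) `^ (- a))%R.
  rewrite /L powRM ?(ltW ts0) ?invr_ge0// -(powR_inv1 (ler0n _ 2)) -powRrM mulrC.
  by rewrite mulN1r opprK.
pose k1 := (M `^ (al + 1) * L `^ (- a) * K1 (N := N) g q th)%R.
pose k2 := (M `^ (al + 1) * L `^ (- a) * (1 + Kball (N := N) g))%R.
have k10 : (0 <= k1)%R by rewrite !mulr_ge0 ?powR_ge0.
have k20 : (0 <= k2)%R by rewrite !mulr_ge0 ?powR_ge0// addr_ge0.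
apply: le_trans (le_trans _ (integral_kernel k10 k20)) _; last first.
  by rewrite lee_fin /k1 /k2 LE /duhamel_sup_constant le_eqVlt; apply/orP; left; apply/eqP; ring.
apply: ge0_le_integral => //.
- by move=> r _; exact: heate_ge0.
- exact: measurable_heate_sigma.
- apply/measurable_EFinP; apply: measurable_funTS.
  by apply: measurable_funD; apply: measurable_funM => //; exact: measurable_kernel_time.
move=> r; rewrite /= in_itv/= => /[dup] rst /andP[sr rt].
have tr : (0 < t - r)%R by rewrite subr_gt0.
have rs : (0 < r - s)%R by rewrite subr_gt0.
have Mp : (0 <= M `^ (al + 1))%R by rewrite powR_ge0.
set A := ((t - r) `^ (- c) * (r - s) `^ (- b))%R.
set B := ((t - r) `^ (- (g / 2)) * (r - s) `^ (- (a * al)))%R.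
have A0 : (0 <= A)%R by rewrite mulr_ge0 ?powR_ge0.
have B0 : (0 <= B)%R by rewrite mulr_ge0 ?powR_ge0.
have K10 : (0 <= K1 (N := N) g q th)%R by exact: powR_ge0.
have [Lt|tL] := leP L (t - r)%R.
  apply: le_trans (heate_kap_Lq_sup N0 g0 gN al0 (mws r) (w0 r) (fun z => @wa r z rst) tr q1 (ltW M0) th0 thal thq (@wL r rst) x) _.
  rewrite E1 E2 -/a -/c lee_fin !opprD -!(powR_addr _ _ tr).
  apply: (@le_trans _ _ ((t - r) `^ (- a) * (M `^ (al + 1) * (K1 (N := N) g q th * A + B)))%R).
    by rewrite /A /B /c opprD -!(powR_addr _ _ tr) le_eqVlt; apply/orP; left; apply/eqP; ring.
  apply: (@le_trans _ _ (L `^ (- a) * (M `^ (al + 1) * (K1 (N := N) g q th * A + B)))%R).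
    rewrite ler_wpM2r//; first by rewrite mulr_ge0// addr_ge0// mulr_ge0.
    exact: powR_antitone (ltW a0).
  rewrite /k1 /k2 mulrA -!(mulrA (M `^ (al + 1) * _)%R) -mulrDr (mulrC (L `^ _)%R).
  rewrite ler_wpM2l ?mulr_ge0 ?powR_ge0// lerD2l ler_peMl//.
  by rewrite lerDl.
have Lr : (L <= r - s)%R by move: tL; rewrite /L; lra.
apply: le_trans (heate_kap_sup N0 g0 gN al0 (mws r) (w0 r) (ma r) (fun z => @wa r z rst) tr x) _.
have al10 : (0 <= al + 1)%R by rewrite addr_ge0// ltW.
rewrite Mpow// lee_fin mulrDr mulr1 opprD -(powR_addr _ _ rs).
apply: ler_wpDl; first by rewrite mulr_ge0.
rewrite /k2 /B.
apply: (@le_trans _ _ ((r - s) `^ (- a) * (M `^ (al + 1) * (1 + Kball (N := N) g) * B))%R).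
  by rewrite /B le_eqVlt; apply/orP; left; apply/eqP; ring.
rewrite [leRHS](_ : _ = L `^ (- a) * (M `^ (al + 1) * (1 + Kball (N := N) g) * B))%R; last first.
  by rewrite /B; ring.
rewrite ler_wpM2r//.
  by apply: mulr_ge0 => //; apply: mulr_ge0 => //; exact: addr_ge0.
exact: powR_antitone (ltW a0).
Qed.

End duhamel_estimates.
(** * Strong continuity of the heat semigroup *)

Section heat_norms.
Context {R : realType} {N : nat}.
Notation RN := 'rV[R]_N.
Notation mu := (lebesgue_row N : {sigma_finite_measure set RN -> \bar R}).
Local Open Scope ereal_scope.
Implicit Types (f g h : RN -> \bar R).

Definition nnmeas f := measurable_fun [set: RN] f /\ forall x, 0 <= f x.

Lemma nnmeasD f g : nnmeas f -> nnmeas g -> nnmeas (fun x => f x + g x).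
Proof.
move=> [mf f0] [mg g0]; split; first exact: emeasurable_funD.
by move=> x; rewrite adde_ge0.
Qed.

Lemma nnmeas_heate t f : nnmeas f -> nnmeas (heate t f).
Proof.
by move=> [mf f0]; split; [exact: measurable_heate|move=> x; exact: heate_ge0].
Qed.

Lemma nnmeasZ (k : R) f : (0 <= k)%R -> nnmeas f -> nnmeas (fun x => k%:E * f x).
Proof.
move=> k0 [mf f0]; split; first exact: measurable_funeM.
by move=> x; rewrite mule_ge0 ?lee_fin.
Qed.

(* Norms (of nonnegative functions, "the norm of f is at most B") on which the
   heat semigroup is nonexpansive, up to a constant in the triangle inequality. *)
Record heat_norm (NB : (RN -> \bar R) -> R -> Prop) := HeatNorm {
  hn_le : forall f g A B, nnmeas f -> nnmeas g -> (forall x, f x <= g x) ->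
    (0 <= A)%R -> (A <= B)%R -> NB g A -> NB f B ;
  hn_add : forall f g A B, nnmeas f -> nnmeas g -> (0 <= A)%R -> (0 <= B)%R ->
    NB f A -> NB g B -> NB (fun x => f x + g x) (4 * (A + B))%R ;
  hn_heat : forall f A t, nnmeas f -> NB f A -> NB (heate t f) A ;
  hn_scale : forall f A k, nnmeas f -> (0 <= A)%R -> (0 <= k)%R ->
    NB f A -> NB (fun x => k%:E * f x) (k * A)%R ;
  hn_zero : NB (cst 0) 0%R }.

Definition Linf_le f (B : R) := forall x, f x <= B%:E.

Lemma heat_norm_sup : heat_norm Linf_le.
Proof.
split.
- by move=> f g A B _ _ fg _ AB gA x; apply: le_trans (fg x) _; apply: le_trans (gA x) _; rewrite lee_fin.
- move=> f g A B _ _ A0 B0 fA gB x; apply: (@le_trans _ _ (A%:E + B%:E)); first exact: leeD.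
  by rewrite -EFinD lee_fin; lra.
- move=> f A t [mf f0] fA x.
  have A0 : (0 <= A)%R by have := le_trans (f0 x) (fA x); rewrite lee_fin.
  rewrite -(heate_cst t x A0); exact: le_heate.
- by move=> f A k _ A0 k0 fA x; rewrite EFinM lee_wpmul2l ?lee_fin.
- by move=> x /=.
Qed.

Lemma heat_norm_Lq q : (1 <= q)%R -> heat_norm (Lq_le q).
Proof.
move=> q1; have q0 : (0 <= q)%R by apply: le_trans q1.
split.
- by move=> f g A B [mf f0] [mg g0] fg A0 AB; exact: Lq_le_mono.
- by move=> f g A B [mf f0] [mg g0] A0 B0; exact: Lq_leD.
- by move=> f A t [mf f0]; exact: Lq_le_heate.
- move=> f A k [mf f0] A0 k0 fA; rewrite /Lq_le.
  under eq_integral do rewrite poweRM ?lee_fin// poweR_EFin.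
  rewrite ge0_integralZl ?lee_fin ?powR_ge0//; last 2 first.
  + exact: measurable_poweR_comp.
  + by move=> y _; exact: poweR_ge0.
  by rewrite (powRM _ k0 A0) [leRHS]EFinM lee_wpmul2l// lee_fin powR_ge0.
- have qn0 : q != 0%R by rewrite gt_eqF// (lt_le_trans _ q1).
  rewrite /Lq_le; under eq_integral do rewrite poweR0r//.
  by rewrite integral0 lee_fin powR_ge0.
Qed.

Section strong_continuity.
Variable NB : (RN -> \bar R) -> R -> Prop.
Hypothesis HN : heat_norm NB.

(* [|f - g| <= h] with [h] small, without subtraction of infinite values. *)
Definition dist_le f g (e : R) := exists h, [/\ nnmeas h,
  forall x, f x <= g x + h x, forall x, g x <= f x + h x & NB h e].

Lemma dist_le_refl f e : (0 <= e)%R -> dist_le f f e.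
Proof.
move=> e0; have m0 : nnmeas (cst 0) by split => //; exact: measurable_cst.
exists (cst 0); split => //.
- by move=> x /=; rewrite adde0.
- by move=> x /=; rewrite adde0.
- exact: (hn_le HN m0 m0 _ _ e0 (hn_zero HN)).
Qed.

Lemma dist_leC f g e : dist_le f g e -> dist_le g f e.
Proof. by move=> [h [mh fg gf he]]; exists h. Qed.

Lemma dist_le_mono f g e e' : (0 <= e)%R -> (e <= e')%R -> dist_le f g e -> dist_le f g e'.
Proof.
move=> e0 ee' [h [mh fg gf he]]; exists h; split => //.
exact: (hn_le HN mh mh _ e0 ee').
Qed.

Lemma dist_le_trans f g k e e' : (0 <= e)%R -> (0 <= e')%R ->
  dist_le f g e -> dist_le g k e' -> dist_le f k (4 * (e + e')).
Proof.
move=> e0 e'0 [h [mh fg gf he]] [h' [mh' gk kg he']].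
exists (fun x => h x + h' x); split.
- exact: nnmeasD.
- move=> x; apply: le_trans (fg x) _; rewrite (addeC (h x)) addeA leeD2r//.
- move=> x; apply: le_trans (kg x) _; rewrite addeA leeD2r//.
- exact: hn_add.
Qed.

Lemma dist_leD f g f' g' e e' : (0 <= e)%R -> (0 <= e')%R ->
  dist_le f g e -> dist_le f' g' e' ->
  dist_le (fun x => f x + f' x) (fun x => g x + g' x) (4 * (e + e')).
Proof.
move=> e0 e'0 [h [mh fg gf he]] [h' [mh' fg' gf' he']].
exists (fun x => h x + h' x); split.
- exact: nnmeasD.
- by move=> x; rewrite addeACA leeD.
- by move=> x; rewrite addeACA leeD.
- exact: hn_add.
Qed.

Lemma dist_le_heate t f g e : nnmeas f -> nnmeas g ->
  dist_le f g e -> dist_le (heate t f) (heate t g) e.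
Proof.
move=> mf mg [h [mh fg gf he]]; exists (heate t h).
have [[mf' f0] [mg' g0] [mh' h0]] := And3 mf mg mh.
split; [exact: nnmeas_heate| | |exact: (hn_heat HN)].
- move=> x; rewrite -heateD//; apply: le_heate => //; exact: emeasurable_funD.
- move=> x; rewrite -heateD//; apply: le_heate => //; exact: emeasurable_funD.
Qed.

(* Strong continuity at time 0 of the semigroup on the datum [f]. *)
Definition SC f := forall e : R, (0 < e)%R -> exists2 d : R, (0 < d)%R &
  forall t, (0 < t)%R -> (t < d)%R -> dist_le (heate t f) f e.

Lemma SC_add f g : nnmeas f -> nnmeas g -> SC f -> SC g -> SC (fun x => f x + g x).
Proof.
move=> [mf f0] [mg g0] Sf Sg e e0; have e8 : (0 < e / 8)%R by rewrite divr_gt0.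
have [d d0 df] := Sf _ e8; have [d' d'0 dg] := Sg _ e8.
exists (Num.min d d'); first by rewrite lt_min d0.
move=> t t0; rewrite lt_min => /andP[td td'].
have -> : heate t (fun x => f x + g x) = (fun x => heate t f x + heate t g x).
  by apply/funext => x; rewrite heateD.
have -> : e = (4 * (e / 8 + e / 8))%R by field.
by apply: dist_leD; [exact: ltW|exact: ltW|exact: df|exact: dg].
Qed.

Lemma SC_scale f (k : R) : nnmeas f -> (0 <= k)%R -> SC f -> SC (fun x => k%:E * f x).
Proof.
move=> [mf f0] k0 Sf e e0.
have k10 : (0 < k + 1)%R by apply: ltr_wpDl.
have ek0 : (0 < e / (k + 1))%R by rewrite divr_gt0.
have [d d0 df] := Sf _ ek0; exists d => // t t0 td.
have [h [mh fg gf he]] := df t t0 td.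
exists (fun x => k%:E * h x); split.
- exact: nnmeasZ.
- move=> x; rewrite heateZ// -ge0_muleDr ?lee_wpmul2l ?lee_fin//; exact: mh.2.
- move=> x; rewrite heateZ// -ge0_muleDr ?lee_wpmul2l ?lee_fin//; [exact: heate_ge0|exact: mh.2].
- apply: (hn_le HN (nnmeasZ k0 mh) (nnmeasZ k0 mh) _ _ _ (hn_scale HN mh (ltW ek0) k0 he)) => //.
    by rewrite mulr_ge0// ltW.
  rewrite mulrA ler_pdivrMr// mulrC ler_wpM2l ?(ltW e0)// lerDl//.
Qed.

(** Subtraction is legitimate in inequalities of extended reals because f and its heat flow are
    finite. It provides the complement step of the Dynkin induction. *)
Lemma SC_sub f f' : nnmeas f -> nnmeas f' ->
  (forall x, f x \is a fin_num) -> (forall t x, (0 < t)%R -> heate t f x \is a fin_num) ->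
  SC (fun x => f' x + f x) -> SC f -> SC f'.
Proof.
move=> [mf f0] [mf' f'0] ffin Hfin Sg Sf e e0; have e8 : (0 < e / 8)%R by rewrite divr_gt0.
have [d d0 df] := Sf _ e8; have [d' d'0 dg] := Sg _ e8.
exists (Num.min d d'); first by rewrite lt_min d0.
move=> t t0; rewrite lt_min => /andP[td td'].
have [h [mh fg gf he]] := df t t0 td; have [h' [mh' fg' gf' he']] := dg t t0 td'.
exists (fun x => h x + h' x); split.
- exact: nnmeasD.
- move=> x; rewrite -(leeD2rE _ _ (Hfin t x t0)) -heateD//.
  apply: le_trans (fg' x) _; apply: (@le_trans _ _ (f' x + (heate t f x + h x) + h' x)).
    by rewrite leeD2r// leeD2l.
  by rewrite (addeC (heate t f x)) addeA -!addeA (addeC (heate t f x)).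
- move=> x; rewrite -(leeD2rE _ _ (ffin x)).
  apply: le_trans (gf' x) _; rewrite heateD//.
  apply: (@le_trans _ _ (heate t f' x + (f x + h x) + h' x)).
    by rewrite leeD2r// leeD2l.
  by rewrite (addeC (f x)) addeA -!addeA (addeC (f x)).
- have -> : e = (4 * (e / 8 + e / 8))%R by field.
  by apply: hn_add => //; exact: ltW.
Qed.

(** The density argument: the remainder k changes the distance by at most k plus its heat flow, both
    of norm at most e since the semigroup is nonexpansive. *)
Lemma SC_approx f : nnmeas f ->
  (forall e : R, (0 < e)%R -> exists g k, [/\ nnmeas g, nnmeas k,
    forall x, f x = g x + k x, SC g & NB k e]) -> SC f.
Proof.
move=> [mf f0] H e e0; have e64 : (0 < e / 64)%R by rewrite divr_gt0.
have [g [k [mg mk fE Sg ke]]] := H _ e64.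
have [d d0 dg] := Sg _ e64; exists d => // t t0 td.
have -> : heate t f = (fun x => heate t g x + heate t k x).
  apply/funext => x; have -> : f = (fun x => g x + k x) by apply/funext.
  by rewrite heateD//; [exact: mg.1|exact: mk.1|exact: mg.2|exact: mk.2].
have -> : f = (fun x => g x + k x) by apply/funext.
have e640 := ltW e64.
apply: (@dist_le_mono _ _ (4 * (e / 64 + (4 * (e / 64 + e / 64))))%R).
- by rewrite !mulr_ge0// !addr_ge0// mulr_ge0// addr_ge0.
- lra.
apply: dist_leD => //.
- by rewrite !mulr_ge0// addr_ge0.
- exact: dg.
have mHk := nnmeas_heate t mk.
exists (fun x => heate t k x + k x); split.
- exact: nnmeasD.
- by move=> x; rewrite addeCA leeDl// adde_ge0 ?mk.2.
- by move=> x; rewrite addeA leeDr// adde_ge0 ?mHk.2.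
- by apply: hn_add => //; exact: hn_heat.
Qed.

End strong_continuity.
End heat_norms.

(** * Strong continuity in L^1 on indicators of bounded sets *)

Section strong_continuity_Lq.
Context {R : realType} {N : nat}.
Notation RN := 'rV[R]_N.
Notation mu := (lebesgue_row N : {sigma_finite_measure set RN -> \bar R}).
Local Open Scope ereal_scope.

Definition ind (A : set RN) (x : RN) : \bar R := (\1_A x)%:E.

Lemma nnmeas_ind A : measurable A -> nnmeas (ind A).
Proof.
move=> mA; split; first by apply/measurable_EFinP; exact: measurable_indic.
by move=> x; rewrite lee_fin.
Qed.

Lemma ind_le1 A x : ind A x <= 1.
Proof. by rewrite lee_fin indicE; case: (_ \in _). Qed.

Lemma heate_ind_le1 t A x : measurable A -> heate t (ind A) x <= 1.
Proof.
move=> mA; rewrite -(@heate_cst R N t 1 x ler01); apply: le_heate => //.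
- exact: (nnmeas_ind mA).1.
- exact: (nnmeas_ind mA).2.
- exact: ind_le1.
Qed.

Lemma heate_ind_fin t A x : measurable A -> heate t (ind A) x \is a fin_num.
Proof.
move=> mA; rewrite ge0_fin_numE; first exact: le_lt_trans (heate_ind_le1 t x mA) (ltry _).
exact: heate_ge0 (nnmeas_ind mA).2.
Qed.

(** Openness expressed with the Euclidean norm, on which the heat kernel depends. *)
Definition enorm_open (A : set RN) := forall x, A x ->
  exists2 d : R, (0 < d)%R & forall y, (enorm (x - y) < d)%R -> A y.

(** The kernel mass beyond distance d from x is at most 2^(N/2) exp(-d^2/(8t)) by [heat_kernel_far],
    and exp(-s) <= 1/s makes this linear in t. *)
Lemma heate_ind_open (A : set RN) t x (d : R) : measurable A -> (0 < t)%R -> (0 < d)%R ->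
  (forall y, (enorm (x - y) < d)%R -> A y) ->
  1 <= heate t (ind A) x + (2 `^ (N%:R / 2) * (8 / d ^+ 2) * t)%:E.
Proof.
move=> mA t0 d0 dA; set e := expR (- (d ^+ 2 / (8 * t))).
have [mi i0] := nnmeas_ind mA.
have t20 : (0 < 2 * t)%R by rewrite mulr_gt0.
have d20 : (0 < d ^+ 2)%R by rewrite exprn_gt0.
have eb : (e <= 8 / d ^+ 2 * t)%R.
  rewrite /e expRN; have h1 : (0 < d ^+ 2 / (8 * t))%R by rewrite divr_gt0// mulr_gt0.
  have -> : (8 / d ^+ 2 * t = (d ^+ 2 / (8 * t))^-1)%R by field; rewrite !gt_eqF.
  rewrite lef_pV2 ?posrE ?expR_gt0//.
  by apply: le_trans (expR_ge1Dx _); rewrite lerDr.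
apply: (@le_trans _ _ (heate t (ind A) x + (2 `^ (N%:R / 2) * e)%:E)); last first.
  by rewrite leeD2l// lee_fin -mulrA ler_wpM2l ?powR_ge0.
rewrite /heate t0 -[leLHS](integral_heat_kernel x t0) -[X in _ + X]mule1.
rewrite -[X in _ + _ * X](integral_heat_kernel x t20).
rewrite -ge0_integralZl//; last 3 first.
- exact: measurable_Gr.
- by move=> y _; rewrite lee_fin heat_kernel_ge0.
- by rewrite lee_fin mulr_ge0 ?powR_ge0 ?expR_ge0.
rewrite -ge0_integralD//; last 4 first.
- by move=> y _; exact: GrM_ge0.
- exact: measurable_GrM.
- by move=> y _; rewrite mule_ge0 ?lee_fin ?heat_kernel_ge0// mulr_ge0 ?powR_ge0 ?expR_ge0.
- by apply: measurable_funeM; exact: measurable_Gr.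
apply: ge0_le_integral => //.
- by move=> y _; rewrite lee_fin heat_kernel_ge0.
- exact: measurable_Gr.
- apply: emeasurable_funD; first exact: measurable_GrM.
  by apply: measurable_funeM; exact: measurable_Gr.
move=> y _; rewrite -!EFinM -EFinD lee_fin indicE.
have [Ay|Ay] := boolP (y \in A).
  by rewrite mulr1 lerDl !mulr_ge0 ?powR_ge0 ?expR_ge0 ?heat_kernel_ge0.
rewrite mulr0 add0r; apply: heat_kernel_far => //; first exact: ltW.
rewrite leNgt; apply: contra Ay => /dA; exact: mem_set.
Qed.

Lemma cvg_heate_ind_open (A : set RN) x : measurable A -> enorm_open A -> A x ->
  forall u : nat -> R, (forall n, (0 < u n)%R) -> (u n @[n --> \oo] --> (0 : R)%R)%R ->
  heate (u n) (ind A) x @[n --> \oo] --> (1 : \bar R).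
Proof.
move=> mA oA Ax u u0 ucvg; have [d d0 dA] := oA x Ax.
pose C := (2 `^ (N%:R / 2) * (8 / d ^+ 2))%R.
apply: (@squeeze_cvge _ _ _ _ (fun n => (1 - C * u n)%:E) _ (cst 1)).
- apply: nearW => n; rewrite heate_ind_le1// andbT EFinB leeBlDr//.
  exact: heate_ind_open.
- rewrite -[X in _ --> X](_ : (1 - C * 0)%:E = 1); last by rewrite mulr0 subr0.
  apply/fine_cvgP; split; first exact: nearW.
  apply: cvgB; first exact: cvg_cst.
  by apply: cvgM; [exact: cvg_cst|].
- exact: cvg_cst.
Qed.

(** On A the heat flow of the indicator tends to 1 pointwise, so by dominated convergence the mass
    I(t) kept in A tends to mu A. By conservation of mass what leaves A is mu A - I(t) as well, and
    the L^1 distance is 2 (mu A - I(t)). *)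
Lemma SC_ind_open (A : set RN) : measurable A -> enorm_open A -> mu A < +oo ->
  SC (Lq_le 1) (ind A).
Proof.
move=> mA oA Aoo e e0; have [mi i0] := nnmeas_ind mA.
have muA : mu A \is a fin_num by rewrite ge0_fin_numE.
pose I t := \int[mu]_(x in A) heate t (ind A) x.
have IA t : I t <= mu A.
  rewrite -[leRHS]mul1e -(integral_cst mu mA (1 : \bar R)).
  apply: ge0_le_integral => //.
  - by move=> x _; exact: heate_ge0.
  - by apply: measurable_funTS; exact: measurable_heate.
  - by move=> x _; exact: heate_ind_le1.
have I0 t : 0 <= I t by apply: integral_ge0 => x _; exact: heate_ge0.
have Ifin t : I t \is a fin_num by rewrite ge0_fin_numE// (le_lt_trans (IA t)).
have cvgI : fine (I t) @[t --> (0 : R)^'+] --> fine (mu A).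
  apply/cvg_at_rightP => u [u0 ucvg].
  have : I (u n) @[n --> \oo] --> \int[mu]_(x in A) (1 : \bar R).
    apply: (@dominated_cvg _ _ _ mu A mA _ _ (cst 1)) => //.
    - by move=> n; apply: measurable_funTS; exact: measurable_heate.
    - by move=> x Ax; exact: cvg_heate_ind_open.
    - apply/integrableP; split => //.
      under eq_integral do rewrite /= normr1.
      by rewrite integral_cst// mul1e.
    - by move=> n x _; rewrite gee0_abs ?heate_ge0// heate_ind_le1.
  rewrite integral_cst// mul1e => H.
  have {}H : I (u n) @[n --> \oo] --> (fine (mu A))%:E by rewrite fineK.
  by have [_] := (fine_cvgP _ _).1 H.
move/cvgrPdist_lt : cvgI => /(_ (e / 2)%R); rewrite divr_gt0// => /(_ isT).
rewrite near_withinE => -[d /= d0 dI]; exists d => // t t0 td.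
have {dI} : (`|fine (mu A) - fine (I t)| < e / 2)%R.
  by apply: dI => //=; rewrite sub0r normrN gtr0_norm.
rewrite ger0_norm ?subr_ge0 ?fine_le// => It.
(* The absolute difference between the indicator and its heat flow, the latter lying between 0 and
   1. *)
pose h x := if x \in A then 1 - heate t (ind A) x else heate t (ind A) x.
have Hfin x := heate_ind_fin t x mA.
have h0 x : 0 <= h x.
  rewrite /h; case: ifP => _; first by rewrite sube_ge0 ?heate_ind_le1// Hfin.
  exact: heate_ge0.
have mH := measurable_heate t mi i0.
have mAb : measurable_fun [set: RN] (fun x => x \in A).
  apply/measurable_fun_bool.
  rewrite setTI (_ : _ @^-1` _ = A)//; apply/seteqP; split => x /=; [exact: set_mem|exact: mem_set].
have mh : measurable_fun [set: RN] h.
  by apply: measurable_fun_ifT => //; exact: emeasurable_funB.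
exists h; split => //.
- move=> x; rewrite /h [ind A x]/ind indicE; case: ifP => xA /=; last by rewrite add0e.
  by rewrite (le_trans (heate_ind_le1 t x mA))// leeDl// sube_ge0 ?heate_ind_le1// Hfin.
- move=> x; rewrite /h [ind A x]/ind indicE; case: ifP => xA /=.
    by rewrite [leRHS]addeC subeK// Hfin.
  by rewrite adde_ge0 ?heate_ge0.
rewrite /Lq_le; under eq_integral do rewrite poweRe1//.
rewrite powRr1 ?(ltW e0)//.
have mAc := measurableC mA.
rewrite -(setUv A) ge0_integral_setU//; last 2 first.
- exact: measurable_funTS.
- by apply/disj_set2P; rewrite setICr.
have hA : \int[mu]_(x in A) h x + I t = mu A.
  rewrite -ge0_integralD//; last 3 first.
  - exact: measurable_funTS.
  - by move=> x _; exact: heate_ge0.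
  - exact: measurable_funTS.
  rewrite -[RHS]mul1e -(integral_cst mu mA (1 : \bar R)); apply: eq_integral => x xA.
  by rewrite /h xA subeK.
have hAc : \int[mu]_(x in ~` A) h x + I t = mu A.
  transitivity (\int[mu]_x heate t (ind A) x).
    rewrite -[in RHS](setUv A) ge0_integral_setU//; last 3 first.
    - exact: measurable_funTS.
    - by move=> x _; exact: heate_ge0.
    - by apply/disj_set2P; rewrite setICr.
    rewrite addeC; congr (_ + _); apply: eq_integral => x; rewrite inE/= => xA.
    by rewrite /h memNset.
  by rewrite integral_heate// integral_indic// setIT.
have -> : \int[mu]_(x in A) h x = mu A - I t by rewrite -hA addeK.
have -> : \int[mu]_(x in ~` A) h x = mu A - I t by rewrite -{1}hAc addeK.
rewrite -(fineK muA) -(fineK (Ifin t)) -!EFinB -EFinD lee_fin; lra.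
Qed.

Definition cube (k : nat) : set RN := [set x | forall i, `](- k%:R)%R, k%:R[%classic (x ord0 i)].

Lemma measurable_cube k : measurable (cube k) /\ mu (cube k) < +oo.
Proof.
have mA (i : 'I_N) : measurable (`](- k%:R)%R, (k%:R : R)[%classic : set R) by exact: measurable_itv.
have [mB EB] := lebesgue_row_box mA; split => //.
rewrite [X in X < _]EB (eq_bigr (fun i : 'I_N => (k%:R + k%:R)%:E)); first by rewrite prodEFin ltry.
move=> i _; rewrite lebesgue_measure_itv/= lte_fin; case: ifP => [_|/negbT].
  by rewrite -EFinB opprK.
rewrite -leNgt => h; have k0 : (0 <= k%:R :> R)%R by [].
by have -> : (k%:R = 0 :> R)%R by [lra]; rewrite addr0.
Qed.

Lemma enorm_open_coord (i : 'I_N) (U : set R) : open U -> enorm_open [set x : RN | U (x ord0 i)].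
Proof.
move=> oU x /= Ux; have /nbhs_ballP[d /= d0 dU] := open_nbhs_nbhs (conj oU Ux).
exists d => // y xy; apply: dU; rewrite /ball/=.
have := ler_coord_enorm (x - y) i; rewrite !mxE => h; exact: le_lt_trans h xy.
Qed.

Lemma enorm_openI A B : enorm_open A -> enorm_open B -> enorm_open (A `&` B).
Proof.
move=> oA oB x [Ax Bx]; have [d d0 dA] := oA x Ax; have [d' d'0 dB] := oB x Bx.
exists (Num.min d d'); first by rewrite lt_min d0.
by move=> y; rewrite lt_min => /andP[? ?]; split; [exact: dA|exact: dB].
Qed.

Lemma enorm_open_cube k : enorm_open (cube k).
Proof.
move=> x /= kx.
have H i : exists2 d : R, (0 < d)%R & forall y : RN, (enorm (x - y) < d)%R ->
    `](- k%:R)%R, k%:R[%classic (y ord0 i).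
  have oI : open `](- k%:R)%R, (k%:R : R)[%classic by apply: interval_open.
  exact: (@enorm_open_coord i _ oI x (kx i)).
have {H}/choice[d dP] : forall i, exists d : R, (0 < d)%R /\
    forall y : RN, (enorm (x - y) < d)%R -> `](- k%:R)%R, k%:R[%classic (y ord0 i).
  by move=> i; have [d d0 dy] := H i; exists d.
pose m := (\big[Num.min/1]_(i < N) d i)%R.
exists m.
  by apply/bigmin_gtP; split => // i _; exact: (dP i).1.
move=> y xy i; apply: (dP i).2; apply: lt_le_trans xy _; exact: bigmin_le_cond.
Qed.

(** Puts the product sigma-algebra in the form required by Dynkin induction: the generators are
    stable under intersection, and they contain the preimages of open intervals by the
    coordinates. *)
Lemma row_measurable_open :
  @measurable _ RN = <<s [set A : set RN | measurable A /\ enorm_open A] >>.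
Proof.
apply/seteqP; split; last first.
  by apply: smallest_sub; [exact: sigma_algebra_measurable|move=> A []].
rewrite {1}/measurable/=; apply: smallest_sub.
  exact: smallest_sigma_algebra.
rewrite -bigcup_seq => A [i _ [B mB <-]]; rewrite setTI.
pose S : set (set R) := [set B | <<s [set A : set RN | measurable A /\ enorm_open A] >>
   ((fun x : RN => x ord0 i) @^-1` B)].
suff: @measurable _ R `<=` S by apply.
rewrite [X in X `<=` _](_ : _ = <<s @RGenOpens.G R >>); last exact: RGenOpens.measurableE.
apply: smallest_sub.
  split.
  - by rewrite /S/= preimage_set0; have [] := smallest_sigma_algebra setT [set A : set RN | measurable A /\ enorm_open A].
  - move=> C; rewrite /S/= => SC'; rewrite setTD preimage_setC -setTD.
    by have [_ + _] := smallest_sigma_algebra setT [set A : set RN | measurable A /\ enorm_open A]; apply.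
  - move=> F SF; rewrite /S/= preimage_bigcup.
    by have [_ _] := smallest_sigma_algebra setT [set A : set RN | measurable A /\ enorm_open A]; apply.
move=> _ [a [b ->]]; apply: sub_gen_smallest; split; last first.
  have oI : open `]a, b[%classic by apply: interval_open.
  exact: (@enorm_open_coord i _ oI).
have := @measurable_coord _ (R : measurableType _) N i measurableT _ (measurable_itv `]a, b[).
by rewrite setTI.
Qed.

(** Dynkin induction from the open sets to all measurable sets takes the place of the density of
    continuous functions in L^1. Complements follow from [SC_sub], disjoint unions from [SC_approx];
    the cube keeps all measures finite. *)
Lemma SC_ind_cube k (A : set RN) : measurable A -> SC (Lq_le 1) (ind (A `&` cube k)).
Proof.
move=> mA; have [mQ Qoo] := measurable_cube k; have oQ := @enorm_open_cube k.
have HN := @heat_norm_Lq R N 1%R (lexx _).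
move: mA; rewrite row_measurable_open; move: A.
apply: dynkin_induction.
- exact: row_measurable_open.
- by move=> A B [mA oA] [mB oB]; split; [exact: measurableI|exact: enorm_openI].
- by rewrite setTI; exact: SC_ind_open.
- move=> A [mA oA]; apply: SC_ind_open.
  + exact: measurableI.
  + exact: enorm_openI.
  + apply: le_lt_trans Qoo; apply: le_measure; rewrite ?inE//.
    exact: measurableI.
- move=> A mA SA.
  have mAQ : measurable (A `&` cube k) by exact: measurableI.
  have mAQ' : measurable (~` A `&` cube k) by apply: measurableI => //; exact: measurableC.
  apply: (SC_sub HN (f := ind (A `&` cube k))).
  + exact: nnmeas_ind.
  + exact: nnmeas_ind.
  + by [].
  + by move=> t x _; exact: heate_ind_fin.
  + rewrite (_ : (fun x => _) = ind (cube k)); first exact: SC_ind_open.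
    apply/funext => x; rewrite /ind -EFinD !indicE !in_setI in_setC.
    by case: (x \in A); case: (x \in cube k); rewrite /= ?addr0 ?add0r.
  + exact: SA.
- move=> F mF tF SF.
  have mFQ n : measurable (F n `&` cube k) by exact: measurableI.
  have mU n : measurable (\big[setU/set0]_(i < n) F i) by exact: bigsetU_measurable.
  have mUQ n : measurable (\big[setU/set0]_(i < n) F i `&` cube k) by exact: measurableI.
  have mF' : measurable (\bigcup_n F n) by exact: bigcup_measurable.
  apply: (SC_approx HN); first by apply: nnmeas_ind; exact: measurableI.
  move=> e e0.
  (* The part of the union missed by its first n terms decreases to the empty set, so its measure
     tends to 0. *)
  pose E n := (\bigcup_n F n `\` \big[setU/set0]_(i < n) F i) `&` cube k.
  have mE n : measurable (E n) by apply: measurableI => //; exact: measurableD.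
  have Elim : mu (E n) @[n --> \oo] --> (0 : \bar R).
    have -> : (0 : \bar R) = mu (\bigcap_n E n).
      rewrite (_ : \bigcap_n E n = set0) ?measure0//.
      rewrite -subset0 => x Ex; have [[[n _ Fnx] _] _] := Ex O I.
      have [[_ nFx] _] := Ex n.+1 I; apply: nFx.
      by rewrite -bigcup_mkord; exists n => /=.
    apply: nonincreasing_cvg_mu => //.
    + apply: le_lt_trans Qoo; apply: le_measure; rewrite ?inE//.
      exact: subIsetr.
    + exact: bigcap_measurable.
    + move=> m n mn; apply/subsetPset => x [[Fx nFx] Qx]; split => //; split => //.
      move=> Fm; apply: nFx; move: Fm; rewrite -!bigcup_mkord => -[i /= im Fi].
      by exists i => //=; exact: leq_trans mn.
  have [n En] : exists n, mu (E n) <= e%:E.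
    have : \forall n \near \oo, mu (E n) < e%:E.
      move/fine_cvgP: Elim => [Efin /cvgrPdist_lt/(_ e e0)].
      move: Efin; apply: filterS2 => n Efin; rewrite sub0r normrN ger0_norm ?fine_ge0// => h.
      by rewrite -(fineK Efin) lte_fin.
    by move=> [n _ /(_ n (leqnn n)) /ltW]; exists n.
  exists (ind (\big[setU/set0]_(i < n) F i `&` cube k)), (ind (E n)); split.
  + exact: nnmeas_ind.
  + exact: nnmeas_ind.
  + move=> x; rewrite /ind -EFinD /E !indicE 3!in_setI in_setD.
    have [xU|xU] := boolP (x \in \big[setU/set0]_(i < n) F i).
      rewrite /= (_ : x \in \bigcup_n F n) ?addr0//.
      move: xU; rewrite !inE -bigcup_mkord => -[i _ Fi]; by exists i.
    by rewrite /= add0r andbT.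
  + elim: n {En} => [|n IH].
      rewrite big_ord0 set0I => e' e'0; exists 1%R => // t t0 _.
      have i0 : ind set0 = cst 0 by apply/funext => x; rewrite /ind indic0.
      exists (cst 0); split => //.
      * by move=> x; rewrite i0 heate_cst//= adde0.
      * by move=> x; rewrite i0 heate_cst//= adde0.
      * rewrite /Lq_le; under eq_integral do rewrite poweRe1//.
        by rewrite integral0 lee_fin powR_ge0.
    rewrite big_ord_recr/= (_ : ind _ = fun x => ind (\big[setU/set0]_(i < n) F i `&` cube k) x +
        ind (F n `&` cube k) x).
      by apply: (SC_add HN) => //; exact: nnmeas_ind.
    apply/funext => x; rewrite /ind -EFinD !indicE !in_setI in_setU.
    have [xU|xU] := boolP (x \in \big[setU/set0]_(i < n) F i); last by rewrite /= add0r.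
    rewrite /= [x \in F n](_ : _ = false) ?addr0//.
    apply/negbTE; rewrite notin_setE => Fnx; move: xU; rewrite inE -bigcup_mkord => -[i /= ilt Fi].
    move/trivIsetP: tF => /(_ i n I I); rewrite neq_ltn ilt => /(_ isT).
    by move=> FF; suff : set0 x by []; rewrite -FF.
  + rewrite /Lq_le; under eq_integral do rewrite poweRe1 ?lee_fin//.
    by rewrite integral_indic// setIT powRr1// ltW.
Qed.

End strong_continuity_Lq.

(** * Strong continuity in L^q *)

Section strong_continuity_Lq_function.
Context {R : realType} {N : nat}.
Notation RN := 'rV[R]_N.
Notation mu := (lebesgue_row N : {sigma_finite_measure set RN -> \bar R}).
Local Open Scope ereal_scope.
Variable q : R.
Hypothesis q1 : (1 <= q)%R.
Let q0 : (0 < q)%R. Proof. exact: lt_le_trans q1. Qed.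

(** The indicator and its heat flow are at most 1, so the distance function h may be truncated at 1;
    then min(h, 1)^q <= h, and an L^1 distance e^q becomes an L^q distance e. *)
Lemma SC_ind_Lq k (A : set RN) : measurable A -> SC (Lq_le q) (ind (A `&` cube k)).
Proof.
move=> mA e e0; have eq0 : (0 < e `^ q)%R by rewrite powR_gt0.
have mB : measurable (A `&` cube k) by apply: measurableI => //; exact: (measurable_cube k).1.
have [d d0 dP] := SC_ind_cube k mA eq0.
exists d => // t t0 td; have [h [[mh h0] H1 H2 hL]] := dP t t0 td.
exists (fun x => mine (h x) 1); split.
- split; first exact: measurable_mine.
  by move=> x; rewrite le_min h0 lee01.
- move=> x; rewrite minEle; case: ifP => // _.
  apply: le_trans (heate_ind_le1 t x mB) _.
  by rewrite leeDr// (nnmeas_ind mB).2.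
- move=> x; rewrite minEle; case: ifP => // _.
  apply: le_trans (ind_le1 _ x) _.
  by rewrite leeDr// heate_ge0//; exact: (nnmeas_ind mB).2.
- move: hL; rewrite /Lq_le; under eq_integral do rewrite poweRe1//.
  rewrite powRr1 ?powR_ge0//; apply: le_trans; apply: ge0_le_integral => //.
  + by move=> x _; exact: poweR_ge0.
  + by apply: measurable_poweR_comp; exact: measurable_mine.
  move=> x _; rewrite minEle; case: ifPn => [hx1|]; last first.
    by rewrite -ltNge => /ltW h1; rewrite poweR1r.
  move: (h0 x) hx1; case: (h x) => [a||]//; rewrite poweR_EFin !lee_fin => a0 a1.
  have [->|an0] := eqVneq a 0%R; first by rewrite powR0// gt_eqF.
  by apply: ge1r_powR => //; rewrite lt_neqAle eq_sym an0 a0.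
Qed.

Lemma SC_sum_ind k (s : seq R) (A : R -> set RN) : (forall y, measurable (A y)) ->
  (forall y, y \in s -> (0 <= y)%R) ->
  nnmeas (fun x => (\sum_(y <- s) y * \1_(A y `&` cube k) x)%:E) /\
  SC (Lq_le q) (fun x => (\sum_(y <- s) y * \1_(A y `&` cube k) x)%:E).
Proof.
move=> mA; have HN := @heat_norm_Lq R N q q1.
have mB y : measurable (A y `&` cube k) by apply: measurableI => //; exact: (measurable_cube k).1.
elim: s => [|y s IH] s0.
  have -> : (fun x : RN => (\sum_(y <- [::]) y * \1_(A y `&` cube k) x)%:E) =
      (fun x => 0%:E * ind (A 0%R `&` cube k) x).
    by apply/funext => x; rewrite big_nil mul0e.
  split; first by apply: nnmeasZ => //; exact: nnmeas_ind.
  by apply: (SC_scale HN) => //; [exact: nnmeas_ind|exact: SC_ind_Lq].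
have [i sy|m1 S1] := IH; first by apply: s0; rewrite inE sy orbT.
have y0 : (0 <= y)%R by apply: s0; rewrite mem_head.
have -> : (fun x : RN => (\sum_(y <- y :: s) y * \1_(A y `&` cube k) x)%:E) =
    (fun x => y%:E * ind (A y `&` cube k) x + (\sum_(y <- s) y * \1_(A y `&` cube k) x)%:E).
  by apply/funext => x; rewrite big_cons EFinD.
have m2 : nnmeas (fun x => y%:E * ind (A y `&` cube k) x).
  by apply: nnmeasZ => //; exact: nnmeas_ind.
split; first exact: nnmeasD.
apply: (SC_add HN) => //; apply: (SC_scale HN) => //; first exact: nnmeas_ind.
exact: SC_ind_Lq.
Qed.

Import HBNNSimple.

Lemma SC_nnsfun k (g : {nnsfun RN >-> R}) :
  nnmeas (fun x => (g x * \1_(cube k) x)%:E) /\ SC (Lq_le q) (fun x => (g x * \1_(cube k) x)%:E).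
Proof.
pose s : seq R := finmap.enum_fset (fset_set (range g)).
have -> : (fun x : RN => (g x * \1_(cube k) x)%:E) =
   (fun x => (\sum_(y <- s) y * \1_(g @^-1` [set y] `&` cube k) x)%:E).
  apply/funext => x; congr _%:E; rewrite fimfunE fsbig_finite//= big_distrl/=.
  by apply: eq_bigr => y _; rewrite indicI/= mulrA.
apply: (@SC_sum_ind k s (fun y => g @^-1` [set y])) => // y.
move=> ys; have : y \in fset_set (range g) by [].
by rewrite in_fset_set// => /set_mem[x _ <-]; exact: fun_ge0.
Qed.

(** Approximation from below by simple functions cut to the cubes; the remainders are dominated by f
    and tend to 0, hence so do their L^q norms. *)
Lemma SC_Lq (f : RN -> R) : measurable_fun [set: RN] f -> (forall x, (0 <= f x)%R) ->
  \int[mu]_x (f x `^ q)%:E < +oo -> SC (Lq_le q) (EFin \o f).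
Proof.
move=> mf f0 foo; have HN := @heat_norm_Lq R N q q1.
have mfE : measurable_fun [set: RN] (EFin \o f) by apply/measurable_EFinP.
apply: (SC_approx HN); first by split => // x; rewrite lee_fin.
move=> e e0.
pose g := nnsfun_approx measurableT mfE.
have gc x : g n x @[n --> \oo] --> f x.
  have H : EFin \o g^~ x @ \oo --> (f x)%:E.
    by apply: (@cvg_nnsfun_approx _ _ _ _ measurableT (EFin \o f) mfE) => // y _; rewrite lee_fin.
  by have [_] := (fine_cvgP _ _).1 H.
have gf n x : (g n x <= f x)%R.
  rewrite -(cvg_lim _ (gc x))//; apply: (@nondecreasing_cvgn_le _ (g^~ x)).
    by move=> m p mp; exact/lefP/(@nd_nnsfun_approx _ _ _ _ measurableT _ mfE).
  by apply/cvg_ex; exists (f x).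
pose en n x := (f x - g n x * \1_(cube n) x)%R.
have en0 n x : (0 <= en n x)%R.
  rewrite subr_ge0 indicE; case: (_ \in _); rewrite ?mulr1// mulr0//.
have enf n x : (en n x <= f x)%R by rewrite lerBlDr lerDl mulr_ge0.
have men n : measurable_fun [set: RN] (en n).
  apply: measurable_funB => //; apply: measurable_funM => //.
  by apply: measurable_indic; exact: (measurable_cube n).1.
have encr x : en n x @[n --> \oo] --> (0 : R)%R.
  have -> : (0 = f x - f x :> R)%R by rewrite subrr.
  apply: cvgB; first exact: cvg_cst.
  apply: cvg_trans (gc x); apply: near_eq_cvg; near=> n.
  have xQ : x \in cube n.
    apply: mem_set => i; rewrite /= in_itv/= -ltr_norml.
    apply: le_lt_trans (ler_coord_enorm x i) _; near: n.
    exists (Num.bound (enorm x)) => // n /= hn.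
    by apply: lt_le_trans (archi_boundP (enorm_ge0 x)) _; rewrite ler_nat.
  by rewrite indicE xQ mulr1.
have enc x : (en n x `^ q)%:E @[n --> \oo] --> (0 : \bar R).
  apply/fine_cvgP; split; first exact: nearW.
  apply/cvgrPdist_lt => r r0; have rq0 : (0 < r `^ q^-1)%R by rewrite powR_gt0.
  move/cvgrPdist_lt : (encr x) => /(_ _ rq0); apply: filterS => n.
  rewrite !sub0r !normrN !ger0_norm ?powR_ge0// => h.
  have -> : r = ((r `^ q^-1) `^ q)%R by rewrite -powRrM mulVf ?gt_eqF// powRr1 ?ltW.
  by apply: gt0_ltr_powR; rewrite ?nnegrE ?powR_ge0.
have Ic : \int[mu]_x (en n x `^ q)%:E @[n --> \oo] --> \int[mu]_(x in [set: RN]) (cst 0 x : \bar R).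
  apply: (@dominated_cvg _ _ _ mu setT measurableT _ _ (fun x => (f x `^ q)%:E)) => //.
  - move=> n; apply/measurable_EFinP; exact: (measurableT_comp (measurable_powR _)).
  - apply/integrableP; split.
      by apply/measurable_EFinP; exact: (measurableT_comp (measurable_powR _)).
    under eq_integral do rewrite /= ger0_norm ?powR_ge0//.
    exact: foo.
  - move=> n x _; rewrite gee0_abs ?lee_fin ?powR_ge0//.
    by apply: ge0_ler_powR; rewrite ?nnegrE// ltW.
have [n En] : exists n, \int[mu]_x (en n x `^ q)%:E <= (e `^ q)%:E.
  rewrite integral0 in Ic; have eq0 : (0 < e `^ q)%R by rewrite powR_gt0.
  have : \forall n \near \oo, \int[mu]_x (en n x `^ q)%:E < (e `^ q)%:E.
    move/fine_cvgP: Ic => [Efin /cvgrPdist_lt/(_ _ eq0)].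
    move: Efin; apply: filterS2 => n Efin; rewrite sub0r normrN ger0_norm.
      by move=> h; rewrite -(fineK Efin) lte_fin.
    by apply: fine_ge0; apply: integral_ge0 => x _; rewrite lee_fin powR_ge0.
  by move=> [n _ /(_ n (leqnn n)) /ltW]; exists n.
have [mg Sg] := SC_nnsfun n (g n).
exists (fun x => (g n x * \1_(cube n) x)%:E), (fun x => (en n x)%:E); split => //.
- by split; [exact/measurable_EFinP|move=> x; rewrite lee_fin].
- by move=> x; rewrite -EFinD /en addrC subrK.
Unshelve. all: by end_near.
Qed.

End strong_continuity_Lq_function.

(** * Continuity in time of mild solutions *)

Section time_continuity.
Context {R : realType} {N : nat}.
Notation RN := 'rV[R]_N.
Local Open Scope ereal_scope.

Variables (NB : (RN -> \bar R) -> R -> Prop) (HN : heat_norm NB).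
Variables (a : RN -> \bar R) (k : R -> RN -> \bar R) (T K dl : R).
Hypotheses (ma : nnmeas a) (mk : jmeasurable k) (k0 : forall s x, 0 <= k s x).

Definition mild (t : R) : RN -> \bar R := fun x => heate t a x + duh 0 t k x.

Lemma nnmeas_duh s t : nnmeas (duh s t k).
Proof. by split; [exact: measurable_duhx|move=> x; exact: duh_ge0]. Qed.

Lemma nnmeas_mild t : nnmeas (mild t).
Proof. by apply: nnmeasD; [exact: nnmeas_heate|exact: nnmeas_duh]. Qed.

Lemma mild0 : mild 0 = a.
Proof. by apply/funext => x; rewrite /mild heate0 duh_geo// adde0. Qed.

Lemma mild_restart s t x : (0 <= s)%R -> (s <= t)%R ->
  mild t x = heate (t - s) (mild s) x + duh s t k x.
Proof.
move=> s0 st; have ts : (0 <= t - s)%R by rewrite subr_ge0.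
rewrite {1}/mild (duh_split mk k0 x s0 st) addeA; congr (_ + _).
rewrite /mild heateD//; last 4 first.
- exact: (nnmeas_heate s ma).1.
- exact: (nnmeas_duh 0 s).1.
- exact: (nnmeas_heate s ma).2.
- exact: (nnmeas_duh 0 s).2.
by rewrite heateM ?subrK//; [exact: ma.1|exact: ma.2].
Qed.

Hypotheses (K0 : (0 <= K)%R) (dl0 : (0 < dl)%R).
Hypothesis kE : forall s t, (0 <= s)%R -> (s < t)%R -> (t < T)%R ->
  NB (duh s t k) (K * (t - s) `^ dl).
Hypothesis kSC : forall s, (0 <= s)%R -> (s < T)%R -> SC NB (mild s).

Lemma dist_mild_restart s t : (0 <= s)%R -> (s <= t)%R -> (t < T)%R ->
  dist_le NB (mild t) (heate (t - s) (mild s)) (K * (t - s) `^ dl).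
Proof.
move=> s0; rewrite le_eqVlt => /predU1P[<-|st] tT.
  rewrite subrr heate0; apply: (dist_le_refl HN).
  by rewrite mulr_ge0 ?powR_ge0.
exists (duh s t k); split.
- exact: nnmeas_duh.
- by move=> x; rewrite (mild_restart x s0 (ltW st)).
- move=> x; rewrite (mild_restart x s0 (ltW st)) -addeA leeDl//.
  by rewrite adde_ge0// duh_ge0.
- exact: kE.
Qed.

Lemma dist_heate_small s (f : RN -> \bar R) (e d t1 t2 : R) : nnmeas f -> (0 < e)%R ->
  (forall t, (0 < t)%R -> (t < d)%R -> dist_le NB (heate t f) f e) ->
  (s <= t1)%R -> (t1 <= t2)%R -> (t2 - t1 < d)%R ->
  dist_le NB (heate (t2 - s) f) (heate (t1 - s) f) e.
Proof.
move=> mf e0 H st1; rewrite le_eqVlt => /predU1P[<-|t12] td.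
  by apply: (dist_le_refl HN); exact: ltW.
have -> : heate (t2 - s) f = heate (t1 - s) (heate (t2 - t1) f).
  have h1 : (0 <= t1 - s)%R by rewrite subr_ge0.
  have h2 : (0 <= t2 - t1)%R by rewrite subr_ge0 ltW.
  apply/funext => x; rewrite (heateM x h1 h2 mf.1 mf.2).
  by congr (heate _ f x); ring.
apply: (dist_le_heate HN) => //; first exact: nnmeas_heate.
by apply: H => //; rewrite subr_gt0.
Qed.

(** The heat flow cannot be run backwards, so the values at s and t are both compared with the heat
    flow from a common earlier time s0, slightly before t. The Duhamel terms from s0 are small, and
    the two heat flows differ by the strong continuity at the datum [mild s0]. *)
Lemma mild_time_continuous t e : (0 <= t)%R -> (t < T)%R -> (0 < e)%R ->
  exists2 d : R, (0 < d)%R &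
  forall s, (0 <= s)%R -> (s < T)%R -> (`|s - t| < d)%R -> dist_le NB (mild s) (mild t) e.
Proof.
move=> t0 tT e0.
have e64 : (0 < e / 64)%R by rewrite divr_gt0.
(* The length 2 d1 covers the interval from s0 >= t - d1 to any time at most t + d1. *)
have [d1 d10 d1P] : exists2 d1 : R, (0 < d1)%R & (K * (2 * d1) `^ dl <= e / 64)%R.
  have K1 : (0 < K + 1)%R by apply: ltr_wpDl.
  exists ((e / 64 / (K + 1)) `^ dl^-1 / 2)%R; first by rewrite divr_gt0// powR_gt0// divr_gt0.
  rewrite mulrCA divff ?pnatr_eq0// mulr1 -powRrM mulVf ?gt_eqF// powRr1; last by rewrite ltW// divr_gt0.
  by rewrite mulrA ler_pdivrMr// mulrC ler_wpM2l ?(ltW e64)// lerDl.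
pose s0 := Num.max 0%R (t - d1)%R.
have s00 : (0 <= s0)%R by rewrite le_max lexx.
have s0t : (s0 <= t)%R by rewrite ge_max t0 lerBlDr lerDl ltW.
have [d2 d20 d2P] := kSC s00 (le_lt_trans s0t tT) e64.
exists (Num.min d1 d2); first by rewrite lt_min d10.
move=> s sge0 sT; rewrite lt_min => /andP[sd1 sd2].
have s0s : (s0 <= s)%R by rewrite ge_max sge0/=; move: sd1; rewrite ltr_norml; lra.
have Ksmall r : (s0 <= r)%R -> (r < T)%R -> (r - t <= d1)%R ->
    dist_le NB (mild r) (heate (r - s0) (mild s0)) (e / 64).
  move=> s0r rT rd; apply: (dist_le_mono HN _ _ (dist_mild_restart s00 s0r rT)).
    by rewrite mulr_ge0 ?powR_ge0.
  apply: le_trans d1P; rewrite ler_wpM2l//; apply: ge0_ler_powR.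
  - exact: ltW.
  - by rewrite nnegrE subr_ge0.
  - by rewrite nnegrE mulr_ge0 ?ltW.
  - have : (t - d1 <= s0)%R by rewrite le_max lexx orbT.
    lra.
have Ks : dist_le NB (mild s) (heate (s - s0) (mild s0)) (e / 64).
  by apply: Ksmall => //; move: sd1; rewrite ltr_norml; lra.
have Kt : dist_le NB (mild t) (heate (t - s0) (mild s0)) (e / 64).
  by apply: Ksmall => //; rewrite subrr ltW.
have mid : dist_le NB (heate (s - s0) (mild s0)) (heate (t - s0) (mild s0)) (e / 64).
  have [st|ts] := leP s t.
    apply: dist_leC; apply: (dist_heate_small (nnmeas_mild s0) e64 d2P) => //.
    by move: sd2; rewrite ltr_norml; lra.
  apply: (dist_heate_small (nnmeas_mild s0) e64 d2P) => //; first exact: ltW.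
  by move: sd2; rewrite ltr_norml; lra.
have e640 := ltW e64.
have H1 := dist_le_trans HN e640 e640 Ks mid.
have e4 : (0 <= 4 * (e / 64 + e / 64))%R by rewrite mulr_ge0// addr_ge0.
have H2 := dist_le_trans HN e4 e640 H1 (dist_leC Kt).
apply: (dist_le_mono HN _ _ H2); first by rewrite mulr_ge0// addr_ge0.
lra.
Qed.

End time_continuity.
(** * Functions vanishing at infinity *)

Section vanishing_functions.
Context {R : realType} {N : nat}.
Notation RN := 'rV[R]_N.
Notation mu := (lebesgue_row N : {sigma_finite_measure set RN -> \bar R}).
Implicit Types (f : RN -> R) (x y : RN).

Lemma mx_norm_le_enorm x : `|x| <= enorm x.
Proof.
rewrite /Num.norm/= mx_normrE; apply/bigmax_leP; split; first exact: enorm_ge0.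
by move=> [i j] _ /=; rewrite (ord1 i); exact: ler_coord_enorm.
Qed.

Lemma ler_coord_mx_norm x i : `|x ord0 i| <= `|x|.
Proof.
rewrite /Num.norm/= mx_normrE; apply: (le_bigmax_cond _ (fun ij => `|x ij.1 ij.2|) (j := (ord0, i))) => //.
Qed.

Lemma enorm_le_mx_norm x : enorm x <= N%:R * `|x|.
Proof.
have h : 0 <= N%:R * `|x| by rewrite mulr_ge0.
rewrite -(ger0_norm h) -sqrtr_sqr ler_sqrt ?sqr_ge0// exprMn.
apply: (@le_trans _ _ (\sum_(i < N) `|x| ^+ 2)).
  apply: ler_sum => i _; rewrite -real_normK ?num_real//.
  by rewrite ler_sqr ?nnegrE// ler_coord_mx_norm.
rewrite sumr_const card_ord -[leLHS]mulr_natl ler_wpM2r ?sqr_ge0//.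
by rewrite -natrX ler_nat; case: (N) => // n; rewrite expnS expn1 leq_pmulr.
Qed.

(** Heine's theorem on a large box; outside it both values are below e / 2. *)
Lemma C0_unif f : C0 f -> forall e : R, 0 < e ->
  exists2 d : R, 0 < d & forall x y, enorm (x - y) < d -> `|f x - f y| < e.
Proof.
move=> [cf f0] e e0; have e2 : 0 < e / 2 by rewrite divr_gt0.
have [M MP] := f0 _ e2.
pose B := Num.max M 0 + 1.
(* The margin 1 ensures that a point at distance less than 1 from the complement of the box still
   has a coordinate larger than B in absolute value. *)
pose K := [set x : RN | forall i, `[- (B + 1), B + 1]%classic (x ord0 i)].
have cK : compact K by apply: (@rV_compact R N (fun=> `[- (B + 1), B + 1]%classic)) => i; exact: segment_compact.
(* A modulus valid near each point of the compact box, for all small radii, is valid on the whole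
   box. *)
have /compact_near_coveringP/(_ R (0^'+) (fun d x => forall y, `|x - y| < d -> `|f x - f y| < e) _) := cK.
case.
  move=> x Kx; have /cvgrPdist_lt/(_ _ e2)/nbhs_ballP[d /= d0 dP] := cf x.
  exists (ball x (d / 2), [set r | 0 < r < d / 2]).
    split; first by apply: nbhsx_ballx; rewrite divr_gt0.
    have d20 : 0 < d / 2 by rewrite divr_gt0.
    exists (d / 2) => //= r /=; rewrite sub0r normrN => rd r0.
    by rewrite r0/= -(gtr0_norm r0).
  move=> [x' r] /= [xx' /andP[r0 rd]] y xy.
  move: xx'; rewrite mx_norm_ball /ball_/= => xx'.
  have h1 : `|f x - f x'| < e / 2.
    by apply: dP; rewrite mx_norm_ball /ball_/=; apply: lt_trans xx' _; lra.
  have h2 : `|f x - f y| < e / 2.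
    apply: dP; rewrite mx_norm_ball /ball_/=.
    rewrite (_ : x - y = (x - x') + (x' - y)); last by rewrite addrA subrK.
    apply: le_lt_trans (ler_normD _ _) _; lra.
  rewrite (_ : f x' - f y = (f x - f y) - (f x - f x')); last by ring.
  apply: le_lt_trans (ler_normB _ _) _; lra.
move=> d /= d0 dP; pose d' := Num.min (d / 2) 1.
have d'0 : 0 < d' by rewrite lt_min divr_gt0//=.
have d'l : d' <= d / 2 by rewrite ge_min lexx.
have d'r : d' <= 1 by rewrite ge_min lexx orbT.
exists d' => // x y xy.
have xy' : `|x - y| < d' by apply: le_lt_trans (mx_norm_le_enorm _) xy.
have [Kx|nKx] := pselect (K x).
  apply: (dP d' _ d'0 x Kx) => //=.
  rewrite sub0r normrN gtr0_norm//; apply: le_lt_trans d'l _; lra.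
have [i xi] : exists i, B + 1 < `|x ord0 i|.
  apply: contrapT => /forallNP H; apply: nKx => i /=.
  by rewrite in_itv/= -ler_norml leNgt; apply/negP; exact: H.
have BM : M < B by rewrite (@le_lt_trans _ _ (Num.max M 0)) ?le_max ?lexx// ltrDl.
have xM : M < enorm x.
  by apply: lt_le_trans (ler_coord_enorm x i); apply: lt_trans xi; lra.
have yM : M < enorm y.
  apply: lt_le_trans (ler_coord_enorm y i).
  have := ler_coord_mx_norm (x - y) i; rewrite !mxE => h.
  have h' : `|x ord0 i - y ord0 i| < 1.
    by apply: le_lt_trans h (lt_le_trans xy' d'r).
  have := ler_normB (x ord0 i) (x ord0 i - y ord0 i).
  rewrite opprB addrC subrK => _.
  have : `|x ord0 i| <= `|x ord0 i - y ord0 i| + `|y ord0 i|.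
    by rewrite -{1}(subrK (y ord0 i) (x ord0 i)) ler_normD.
  lra.
apply: le_lt_trans (ler_normB _ _) _.
have := MP x xM; have := MP y yM; lra.
Qed.

Lemma C0_bounded f : C0 f -> exists2 B : R, 0 < B & forall x, `|f x| <= B.
Proof.
move=> [cf f0]; have [M MP] := f0 1 ltr01.
pose B := Num.max M 0 + 1.
pose K := [set x : RN | forall i, `[- B, B]%classic (x ord0 i)].
have cK : compact K by apply: (@rV_compact R N (fun=> `[- B, B]%classic)) => i; exact: segment_compact.
have /compact_near_coveringP/(_ R (+oo%R) (fun d x => `|f x| < d) _) := cK.
case.
  move=> x Kx; have /cvgrPdist_lt/(_ _ ltr01) H := cf x.
  exists ([set y | `|f x - f y| < 1], [set r | `|f x| + 1 < r]).
    split => //; exists (`|f x| + 1); split => //; exact: num_real.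
  move=> [y r] /= [xy xr].
  have : `|f y| <= `|f x| + `|f x - f y|.
    by rewrite -{1}(subKr (f x) (f y)) ler_normB.
  lra.
move=> d [_ dP]; pose b := Num.max (d + 1) 1.
exists b; first by rewrite lt_max ltr01 orbT.
move=> x; have [Kx|nKx] := pselect (K x).
  by apply: ltW; apply: (dP b _ x Kx); rewrite /b lt_max; apply/orP; left; lra.
have [i xi] : exists i, B < `|x ord0 i|.
  apply: contrapT => /forallNP H; apply: nKx => i /=.
  by rewrite in_itv/= -ler_norml leNgt; apply/negP; exact: H.
have BM : M < B by rewrite (@le_lt_trans _ _ (Num.max M 0)) ?le_max ?lexx// ltrDl.
have xM : M < enorm x.
  by apply: lt_le_trans (ler_coord_enorm x i); apply: lt_trans xi.
by apply: le_trans (ltW (MP x xM)) _; rewrite le_max lexx orbT.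
Qed.

(* [f] is the pointwise limit of its compositions with the rounding maps, which
   take countably many values. *)
Lemma continuous_measurable_row f : continuous f -> measurable_fun [set: RN] f.
Proof.
move=> cf; pose r n (x : RN) : RN := \row_i ((Num.floor (n.+1%:R * x ord0 i))%:~R / n.+1%:R).
have rE n x i : `|x ord0 i - r n x ord0 i| <= n.+1%:R^-1.
  rewrite mxE; have n0 : (0 < n.+1%:R :> R) by rewrite ltr0n.
  have h1 := Num.Theory.floor_le (n.+1%:R * x ord0 i).
  have h2 := Num.Theory.lt_succ_floor (n.+1%:R * x ord0 i).
  have -> : x ord0 i - (Num.floor (n.+1%:R * x ord0 i))%:~R / n.+1%:R =
    (n.+1%:R * x ord0 i - (Num.floor (n.+1%:R * x ord0 i))%:~R) / n.+1%:R.
    by field; rewrite gt_eqF.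
  rewrite normrM (ger0_norm (_ : 0 <= n.+1%:R^-1)) ?invr_ge0//.
  rewrite -[leRHS]mul1r ler_wpM2r ?invr_ge0// ger0_norm ?subr_ge0//.
  move: h2; rewrite intrD; lra.
have mr n : measurable_fun [set: RN] (f \o r n).
  move=> _ B mB; rewrite setTI.
  have n0 : (0 < n.+1%:R :> R) by rewrite ltr0n.
  pose I (k : 'rV[int]_N) (i : 'I_N) : set R :=
    `[(k ord0 i)%:~R / n.+1%:R, (k ord0 i + 1)%:~R / n.+1%:R[%classic.
  pose F (k : 'rV[int]_N) : set RN :=
    if `[< B (f (\row_i ((k ord0 i)%:~R / n.+1%:R))) >]
    then [set x : RN | forall i, I k i (x ord0 i)] else set0.
  have -> : (f \o r n) @^-1` B = \bigcup_k F k.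
    apply/seteqP; split => x /=.
      move=> Bx; exists (\row_i Num.floor (n.+1%:R * x ord0 i)) => //; rewrite /F.
      case: asboolP => [_|]; last first.
        move=> h; exfalso; apply: h; congr (B (f _)): Bx.
        by apply/rowP => i; rewrite !mxE.
      move=> i /=; rewrite /I /= in_itv/= !mxE.
      rewrite ler_pdivrMr// ltr_pdivlMr// mulrC.
      exact: Num.Theory.floor_itv.
    move=> [k _]; rewrite /F; case: asboolP => // Bk xk.
    congr (B (f _)): Bk; apply/rowP => i; rewrite !mxE; congr (_%:~R / _).
    have := xk i; rewrite /I /= in_itv/= ler_pdivrMr// ltr_pdivlMr// mulrC => h.
    by apply/esym; exact: Num.Theory.floor_def.
  apply: countable_bigcupT_measurable; first exact: countableP.
  move=> k; rewrite /F; case: asboolP => // _.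
  by have [] := @lebesgue_row_box R N (I k) (fun i => measurable_itv _).
apply: (@measurable_fun_cvg _ _ _ setT (fun n => f \o r n)) => // x _.
apply/cvgrPdist_lt => e e0; have /cvgrPdist_lt/(_ _ e0)/nbhs_ballP[d /= d0 dP] := cf x.
near=> n; apply: dP; rewrite mx_norm_ball /ball_/=.
apply: (@le_lt_trans _ _ n.+1%:R^-1).
  rewrite /Num.norm/= mx_normrE; apply/bigmax_leP; split; first by rewrite invr_ge0.
  by move=> [i j] _ /=; rewrite (ord1 i); have := rE n x j; rewrite !mxE.
near: n; exists (Num.bound d^-1) => // n /= hn.
rewrite -[ltRHS]invrK ltf_pV2 ?posrE ?invr_gt0//.
apply: lt_le_trans (archi_boundP _) _; first by rewrite invr_ge0 ltW.
by rewrite ler_nat; exact: leqW.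
Unshelve. all: by end_near.
Qed.

End vanishing_functions.

(** * The heat semigroup on bounded functions *)

Section bounded_heat.
Context {R : realType} {N : nat}.
Notation RN := 'rV[R]_N.
Notation mu := (lebesgue_row N : {sigma_finite_measure set RN -> \bar R}).
Notation leb := (@lebesgue_measure R : {sigma_finite_measure set (measurableTypeR R) -> \bar R}).
Notation G := (@heat_kernel R N).
Local Open Scope ereal_scope.

Lemma measurable_near x (d : R) : measurable [set y : RN | (enorm (x - y) < d)%R].
Proof.
rewrite -[X in measurable X]setTI.
have mf : measurable_fun [set: RN] (fun y : RN => enorm (x - y)).
  by apply: measurable_enorm; exact: measurable_rowB.
rewrite (_ : [set y | _] = (fun y : RN => enorm (x - y)) @^-1` `]-oo, d[%classic).
  by apply: mf => //; exact: measurable_itv.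
by apply/seteqP; split=> y /=; rewrite in_itv.
Qed.

Lemma heate_ind_far t x (d : R) : (0 < t)%R -> (0 < d)%R ->
  heate t (ind (~` [set y : RN | (enorm (x - y) < d)%R])) x <=
  (2 `^ (N%:R / 2) * (8 / d ^+ 2) * t)%:E.
Proof.
move=> t0 d0; set A := [set y : RN | _].
have mA : measurable A by exact: measurable_near.
have mAc := measurableC mA.
have [mi i0] := nnmeas_ind mA; have [mi' i0'] := nnmeas_ind mAc.
rewrite -(leeD2lE _ _ (heate_ind_fin t x mA)) -heateD//.
rewrite (_ : (fun y => _) = cst 1%:E).
  by rewrite heate_cst//; apply: heate_ind_open.
apply/funext => y; rewrite /ind -EFinD !indicE in_setC.
by case: (y \in A); rewrite /= ?addr0 ?add0r.
Qed.

(** Within distance d the oscillation of f is at most e / 2 uniformly; beyond it f is at most B, and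
    the kernel mass there is linear in t by [heate_ind_far]. *)
Lemma SC_sup (f : RN -> R) : C0 f -> (forall x, (0 <= f x)%R) -> SC Linf_le (EFin \o f).
Proof.
move=> Cf f0 e e0.
have e2 : (0 < e / 2)%R by rewrite divr_gt0.
have [d d0 dP] := C0_unif Cf e2; have [B B0 fB] := C0_bounded Cf.
have mf : measurable_fun [set: RN] (EFin \o f).
  by apply/measurable_EFinP; apply: continuous_measurable_row; exact: Cf.1.
have fE0 x : 0 <= (EFin \o f) x by rewrite lee_fin.
pose C := (2 `^ (N%:R / 2) * (8 / d ^+ 2))%R.
have C0' : (0 <= C)%R by rewrite mulr_ge0 ?powR_ge0// divr_ge0// sqr_ge0.
have BC0 : (0 < B * C + 1)%R by rewrite ltr_wpDl// mulr_ge0// ltW.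
exists (e / 2 / (B * C + 1))%R; first by rewrite divr_gt0.
move=> t t0 td; exists (cst e%:E).
have near1 x y : (f y <= (f x + e / 2) + B * \1_(~` [set y : RN | (enorm (x - y) < d)%R]) y)%R.
  rewrite indicE in_setC; have [xy|xy] := ltP (enorm (x - y)) d.
    rewrite mem_set//= mulr0 addr0; have := dP x y xy; rewrite ltr_norml; lra.
  rewrite memNset/=; last by rewrite ltNge xy.
  rewrite mulr1; have := fB y; have := f0 x; rewrite ger0_norm//; lra.
have far x : (B%:E * heate t (ind (~` [set y : RN | (enorm (x - y) < d)%R])) x <= (e / 2)%:E).
  apply: (@le_trans _ _ (B%:E * (C * t)%:E)).
    by rewrite lee_wpmul2l ?lee_fin ?(ltW B0)//; exact: heate_ind_far.
  rewrite -EFinM lee_fin; apply: (@le_trans _ _ ((B * C + 1) * t)%R).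
    by rewrite mulrA ler_wpM2r ?(ltW t0)// lerDl.
  by rewrite mulrC -ler_pdivlMr// ltW.
have mN x := nnmeas_ind (measurableC (measurable_near x d)).
split.
- by split=> // x; rewrite lee_fin ltW.
- move=> x.
  apply: (@le_trans _ _ (heate t (fun y => (f x + e / 2)%:E + B%:E * ind (~` [set y : RN | (enorm (x - y) < d)%R]) y) x)).
    apply: le_heate => //.
      by apply: emeasurable_funD => //; apply: measurable_funeM; exact: (mN x).1.
    by move=> y; rewrite /ind -EFinM -EFinD lee_fin; exact: near1.
  rewrite heateD//; last 3 first.
  + by apply: measurable_funeM; exact: (mN x).1.
  + by move=> y; rewrite lee_fin addr_ge0// ltW.
  + by move=> y; rewrite mule_ge0 ?lee_fin ?(ltW B0)//; exact: (mN x).2.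
  rewrite heateZ ?(ltW B0)//; [|exact: (mN x).1|exact: (mN x).2].
  rewrite (_ : heate t (fun=> (f x + e / 2)%:E) x = (f x + e / 2)%:E); last first.
    by apply: heate_cst; rewrite addr_ge0// ltW.
  apply: (@le_trans _ _ ((f x + e / 2)%:E + (e / 2)%:E)); first by rewrite leeD2l.
  by rewrite -!EFinD lee_fin /=; lra.
- move=> x; apply: (@le_trans _ _ (heate t (fun y => (EFin \o f) y +
     ((e / 2)%:E + B%:E * ind (~` [set y : RN | (enorm (x - y) < d)%R]) y)) x)).
    rewrite -[leLHS]/((f x)%:E) -(heate_cst t x (f0 x)); apply: le_heate => //.
    + apply: emeasurable_funD => //; apply: emeasurable_funD => //.
      by apply: measurable_funeM; exact: (mN x).1.
    + by move=> y; rewrite lee_fin.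
    move=> y; rewrite /ind /= -EFinM -!EFinD lee_fin.
    rewrite indicE in_setC; have [xy|xy] := ltP (enorm (x - y)) d.
      rewrite mem_set//= mulr0 addr0; have := dP x y xy; rewrite ltr_norml; lra.
    rewrite memNset/=; last by rewrite ltNge xy.
    rewrite mulr1; have := fB x; have := f0 y; rewrite ger0_norm//; lra.
  rewrite heateD//; last 2 first.
  + apply: emeasurable_funD => //; apply: measurable_funeM; exact: (mN x).1.
  + move=> y; apply: adde_ge0; first by rewrite lee_fin ltW.
    by apply: mule_ge0; [rewrite lee_fin ltW|exact: (mN x).2].
  rewrite leeD2l// heateD//; last 3 first.
  + by apply: measurable_funeM; exact: (mN x).1.
  + by move=> y; rewrite lee_fin ltW.
  + by move=> y; rewrite mule_ge0 ?lee_fin ?(ltW B0)//; exact: (mN x).2.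
  rewrite heateZ ?(ltW B0)//; [|exact: (mN x).1|exact: (mN x).2].
  rewrite (_ : heate t (fun=> (e / 2)%:E) x = (e / 2)%:E); last by apply: heate_cst; exact: ltW.
  apply: (@le_trans _ _ ((e / 2)%:E + (e / 2)%:E)); first by rewrite leeD2l.
  by rewrite -!EFinD lee_fin /=; lra.
- by move=> x.
Qed.

(* The Hellinger affinity of two translates of the Gaussian is explicit, and
   bounds their L^1 distance. *)
Definition hroot (t : R) (z : RN) : R :=
  ((4 * pi * t) `^ (- (N%:R / 4)) * expR (- (enorm z ^+ 2 / (8 * t))))%R.

Lemma hroot_sqr t z : (0 < t)%R -> (hroot t z ^+ 2 = G t z)%R.
Proof.
move=> t0; rewrite /hroot exprMn /heat_kernel; congr (_ * _)%R.
  rewrite -powR_mulrn ?powR_ge0// -powRrM//; congr (_ `^ _)%R; field.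
  by [].
rewrite expr2 -expRD; congr expR; field; rewrite gt_eqF//.
Qed.

Lemma measurable_hroot t x : measurable_fun [set: RN] (fun y => hroot t (x - y)).
Proof.
apply: measurable_funM => //; apply: measurableT_comp => //; apply: measurable_funN.
apply: measurable_funM => //; apply: measurable_funX; apply: measurable_enorm.
exact: measurable_rowB.
Qed.

Lemma hroot_ge0 t z : (0 <= hroot t z)%R.
Proof. by rewrite mulr_ge0 ?powR_ge0 ?expR_ge0. Qed.

(** [hroot] at time t is a constant multiple of the kernel at time 2t, so the integral is the
    semigroup law at times 2t and 2t; the normalizations cancel. *)
Lemma integral_hroot t x z : (0 < t)%R ->
  \int[mu]_y (hroot t (x - y) * hroot t (z - y))%:E = (expR (- (enorm (x - z) ^+ 2 / (16 * t))))%:E.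
Proof.
move=> t0; have t20 : (0 < 2 * t)%R by rewrite mulr_gt0.
have pi0 := pi_gt0 R.
have X0 : (0 < 4 * pi * t)%R by rewrite !mulr_gt0.
pose k := ((4 * pi * t) `^ (- (N%:R / 4)) * (8 * pi * t) `^ (N%:R / 2))%R.
have kE y : (hroot t y = k * G (2 * t) y)%R.
  rewrite /hroot /k /heat_kernel.
  have -> : (4 * pi * (2 * t) = 8 * pi * t)%R by ring.
  have -> : (4 * (2 * t) = 8 * t)%R by ring.
  have h : ((8 * pi * t) `^ (N%:R / 2) * (8 * pi * t) `^ (- (N%:R / 2)) = 1)%R.
    by rewrite powRN divff// gt_eqF// powR_gt0// !mulr_gt0.
  rewrite [RHS](_ : _ = ((4 * pi * t) `^ (- (N%:R / 4)) * expR (- (enorm y ^+ 2 / (8 * t)))) *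
    ((8 * pi * t) `^ (N%:R / 2) * (8 * pi * t) `^ (- (N%:R / 2))))%R; last first.
    move: ((4 * pi * t) `^ _)%R (expR _) ((8 * pi * t) `^ (N%:R / 2))%R ((8 * pi * t) `^ _)%R => A B C D.
    by ring.
  by rewrite h mulr1.
transitivity (\int[mu]_y ((k ^+ 2)%:E * (G (2 * t) (x - y) * G (2 * t) (y - z))%:E)).
  apply: eq_integral => y _; rewrite !kE (heat_kernelC _ z y) -EFinM; congr _%:E; ring.
rewrite ge0_integralZl//; last 3 first.
- apply/measurable_EFinP; apply: measurable_funM; apply/measurable_EFinP.
    exact: measurable_Gr.
  exact: measurable_Gl.
- by move=> y _; rewrite lee_fin mulr_ge0 ?heat_kernel_ge0.
- by rewrite lee_fin sqr_ge0.
rewrite integral_heat_kernelM// -EFinM; congr _%:E.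
rewrite /heat_kernel /k mulrA.
have -> : (4 * (2 * t + 2 * t) = 16 * t)%R by ring.
rewrite -[RHS]mul1r; congr (_ * _)%R.
have -> : (8 * pi * t = 2 * (4 * pi * t))%R by ring.
have -> : (4 * pi * (2 * t + 2 * t) = (2 * 2) * (4 * pi * t))%R by ring.
pose p : R := (2 `^ (N%:R / 2))%R; pose r := ((4 * pi * t) `^ (N%:R / 4))%R.
have r2 : ((4 * pi * t) `^ (N%:R / 2) = r ^+ 2)%R.
  rewrite /r -powR_mulrn ?powR_ge0// -powRrM; congr (_ `^ _)%R; field.
  by [].
have p0 : p != 0%R by rewrite gt_eqF// powR_gt0.
have r0 : r != 0%R by rewrite gt_eqF// powR_gt0.
rewrite (powRM _ _ (ltW X0))// (powRM _ _ (ltW X0))// !powRN (@powRM _ 2%R 2%R)// r2 -/p -/r.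
by field; rewrite p0 r0.
Qed.

(** With P and Q the square roots of the two translated kernels, P^2 - Q^2 <= (P - Q)^2 / eta +
    eta/2 (P^2 + Q^2), and the integral of (P - Q)^2 is twice 1 minus the affinity, hence at most |x
    - z|^2/(8t). The parameter eta is left to be balanced against the distance. *)
Lemma heate_bounded_continuous t (f : RN -> \bar R) (B eta : R) x z : (0 < t)%R ->
  nnmeas f -> (0 <= B)%R -> Linf_le f B -> (0 < eta)%R ->
  heate t f x <= heate t f z + (B * (eta + enorm (x - z) ^+ 2 / (8 * t * eta)))%:E.
Proof.
move=> t0 [mf f0] B0 fB eta0; rewrite /heate t0.
pose P y := hroot t (x - y); pose Q y := hroot t (z - y).
have mP := measurable_hroot t x; have mQ := measurable_hroot t z.
have mPQ2 : measurable_fun [set: RN] (fun y => (P y - Q y) ^+ 2)%R.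
  by apply: measurable_funX; exact: measurable_funB.
have PQ0 y : (0 <= (P y - Q y) ^+ 2)%R by rewrite sqr_ge0.
have GG0 y : (0 <= eta / 2 * (G t (x - y) + G t (z - y)))%R.
  by rewrite mulr_ge0 ?addr_ge0 ?heat_kernel_ge0// divr_ge0// ltW.
have eP0 y : (0 <= eta^-1 * (P y - Q y) ^+ 2)%R by rewrite mulr_ge0// invr_ge0 ltW.
have pq y : (G t (x - y) <= G t (z - y) + (eta^-1 * (P y - Q y) ^+ 2 +
    eta / 2 * (G t (x - y) + G t (z - y))))%R.
  rewrite -!hroot_sqr// -/(P y) -/(Q y).
  have : (0 <= ((P y - Q y) / eta - (P y + Q y) / 2) ^+ 2 * eta)%R by rewrite mulr_ge0 ?sqr_ge0 ?ltW.
  have -> : (((P y - Q y) / eta - (P y + Q y) / 2) ^+ 2 * eta = eta^-1 * (P y - Q y) ^+ 2 -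
     (P y ^+ 2 - Q y ^+ 2) + eta / 4 * (P y + Q y) ^+ 2)%R by field; rewrite gt_eqF.
  have : (0 <= eta * (P y - Q y) ^+ 2)%R by rewrite mulr_ge0 ?sqr_ge0 ?ltW.
  have -> : (eta / 4 * (P y + Q y) ^+ 2 = eta / 2 * (P y ^+ 2 + Q y ^+ 2) - eta * (P y - Q y) ^+ 2 / 4)%R by field.
  lra.
have I2 : \int[mu]_y ((P y - Q y) ^+ 2)%:E <= (enorm (x - z) ^+ 2 / (8 * t))%:E.
  set c := expR (- (enorm (x - z) ^+ 2 / (16 * t))).
  have IPQ : \int[mu]_y (2%:E * (P y * Q y)%:E) = (2 * c)%:E.
    rewrite ge0_integralZl//; first by rewrite integral_hroot// EFinM.
    - by apply/measurable_EFinP; exact: measurable_funM.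
    - by move=> y _; rewrite lee_fin mulr_ge0 ?hroot_ge0.
  have : \int[mu]_y ((P y - Q y) ^+ 2)%:E + (2 * c)%:E = 2%:E.
    rewrite -IPQ -ge0_integralD//; last 4 first.
    - by move=> y _; rewrite lee_fin.
    - by apply/measurable_EFinP.
    - by move=> y _; apply: mule_ge0; rewrite lee_fin// mulr_ge0 ?hroot_ge0.
    - by apply: measurable_funeM; apply/measurable_EFinP; exact: measurable_funM.
    transitivity (\int[mu]_y ((G t (x - y))%:E + (G t (z - y))%:E)).
      apply: eq_integral => y _; rewrite -EFinM -!EFinD -!hroot_sqr//; congr _%:E.
      by rewrite -/(P y) -/(Q y); ring.
    rewrite ge0_integralD//; try exact: measurable_Gr; try by move=> y _; rewrite lee_fin heat_kernel_ge0.
    by rewrite !integral_heat_kernel// -EFinD.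
  move=> E; rewrite -(@leeD2rE _ (2 * c)%:E)//; rewrite [leLHS]E -EFinD lee_fin.
  have := expR_ge1Dx (- (enorm (x - z) ^+ 2 / (16 * t))).
  rewrite -/c => h.
  have -> : (enorm (x - z) ^+ 2 / (8 * t) = 2 * (enorm (x - z) ^+ 2 / (16 * t)))%R by field; rewrite gt_eqF.
  lra.
pose E1 y := (eta^-1 * (P y - Q y) ^+ 2)%:E.
pose E2 y := (eta / 2)%:E * ((G t (x - y))%:E + (G t (z - y))%:E).
have mE1 : measurable_fun [set: RN] E1.
  by apply/measurable_EFinP; exact: measurable_funM.
have mE2 : measurable_fun [set: RN] E2.
  by apply: measurable_funeM; apply: emeasurable_funD; exact: measurable_Gr.
have mE : measurable_fun [set: RN] (fun y => E1 y + E2 y) by exact: emeasurable_funD.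
have mBE : measurable_fun [set: RN] (fun y => B%:E * (E1 y + E2 y)) by exact: measurable_funeM.
have E10 y : 0 <= E1 y by rewrite lee_fin.
have E20 y : 0 <= E2 y by rewrite lee_fin.
have BE0 y : 0 <= B%:E * (E1 y + E2 y) by rewrite mule_ge0 ?adde_ge0.
apply: (@le_trans _ _ (\int[mu]_y ((G t (z - y))%:E * f y + B%:E * (E1 y + E2 y)))).
  apply: ge0_le_integral => //.
  - by move=> y _; exact: GrM_ge0.
  - exact: measurable_GrM.
  - by apply: emeasurable_funD => //; exact: measurable_GrM.
  move=> y _; move: (fB y) (f0 y); case: (f y) => [a||]//; rewrite !lee_fin => aB a0.
  apply: (@le_trans _ _ ((G t (z - y) + (eta^-1 * (P y - Q y) ^+ 2 + eta / 2 * (G t (x - y) + G t (z - y)))) * a)%R).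
    by rewrite ler_wpM2r.
  by rewrite mulrDl lerD2l mulrC ler_wpM2r// addr_ge0//.
rewrite ge0_integralD//; [|by move=> y _; exact: GrM_ge0|exact: measurable_GrM].
rewrite leeD2l// ge0_integralZl//; last by move=> y _; exact: adde_ge0.
rewrite EFinM lee_wpmul2l ?lee_fin// ge0_integralD//.
rewrite ge0_integralZl//; last 3 first.
- by apply: emeasurable_funD; exact: measurable_Gr.
- by move=> y _; rewrite lee_fin addr_ge0 ?heat_kernel_ge0.
- by rewrite lee_fin divr_ge0 ?ltW.
rewrite ge0_integralD//; try exact: measurable_Gr; try by move=> y _; rewrite lee_fin heat_kernel_ge0.
rewrite !integral_heat_kernel// addeC EFinD; apply: leeD.
  by rewrite -EFinD -EFinM lee_fin le_eqVlt; apply/orP; left; apply/eqP; field.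
apply: (@le_trans _ _ ((eta^-1)%:E * (enorm (x - z) ^+ 2 / (8 * t))%:E)).
  under eq_integral do rewrite /E1 EFinM.
  rewrite ge0_integralZl ?lee_fin ?invr_ge0 ?(ltW eta0)//; last 2 first.
  - by apply/measurable_EFinP.
  - by move=> y _; rewrite lee_fin.
  by rewrite lee_wpmul2l// lee_fin invr_ge0 ltW.
rewrite -EFinM lee_fin le_eqVlt; apply/orP; left; apply/eqP; field.
by rewrite !gt_eqF.
Qed.

End bounded_heat.
(** * Monotone iteration *)

Section odd_power.
Context {R : realType}.
Variable al : R.
Hypothesis al0 : 0 < al.

Definition oddpow (v : R) : R := `|v| `^ al * v.

Lemma oddpow_ge0 v : 0 <= v -> 0 <= oddpow v.
Proof. by move=> v0; rewrite mulr_ge0 ?powR_ge0. Qed.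

Lemma oddpow0 : oddpow 0 = 0.
Proof. by rewrite /oddpow mulr0. Qed.

Lemma oddpowN v : oddpow (- v) = - oddpow v.
Proof. by rewrite /oddpow normrN mulrN. Qed.

Lemma oddpow_pos v : 0 <= v -> oddpow v = v `^ (al + 1).
Proof.
move=> v0; rewrite /oddpow ger0_norm// [RHS](_ : _ = v `^ al * v)//.
have al1 : al + 1 != 0 by rewrite gt_eqF// ltr_wpDl ?(ltW al0).
by rewrite powRD ?powRr1// (negPf al1).
Qed.

Lemma le_oddpow : {homo oddpow : u v / u <= v}.
Proof.
have mono u v : 0 <= u -> u <= v -> oddpow u <= oddpow v.
  move=> u0 uv; have v0 := le_trans u0 uv.
  by rewrite !oddpow_pos//; apply: ge0_ler_powR; rewrite ?nnegrE// addr_ge0// ltW.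
move=> u v uv; have [u0|u0] := leP 0 u; first exact: mono.
have [v0|v0] := leP 0 v.
  apply: (@le_trans _ _ 0); last exact: oddpow_ge0.
  by rewrite -oppr_ge0 -oddpowN oddpow_ge0// oppr_ge0 ltW.
by rewrite -lerN2 -!oddpowN; apply: mono; rewrite ?oppr_ge0 ?lerN2// ltW.
Qed.

Lemma continuous_oddpow : continuous oddpow.
Proof.
move=> v; have [->|v0] := eqVneq v 0.
  rewrite /continuous_at oddpow0; apply/cvgr0Pnorm_le => e e0; near=> u.
  have u1 : `|u| <= 1 by near: u; exact: (@nbhs0_le R R^o).
  rewrite /oddpow normrM ger0_norm ?powR_ge0//; apply: (@le_trans _ _ `|u|).
    rewrite ler_piMl// [leRHS](_ : _ = 1 `^ al); [|by rewrite powR1]; apply: ge0_ler_powR => //; first exact: ltW.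
    by rewrite nnegrE.
  by near: u; exact: (@nbhs0_le R R^o).
have E : \forall u \near v, expR (al * ln `|u|) * u = oddpow u.
  near=> u; have u0 : u != 0 by near: u; exact: (cvgr_neq0 v (@cvg_id _ _) v0).
  by rewrite /oddpow /powR normr_eq0 (negPf u0).
have Ev := nbhs_singleton E.
rewrite /continuous_at -Ev; apply: cvg_trans (near_eq_cvg E) _; apply: cvgM; last exact: cvg_id.
apply: continuous_cvg; first exact: continuous_expR.
apply: cvgM; first exact: cvg_cst.
apply: (@cvg_comp _ _ _ (fun u : R => `|u|) (@ln R) _ (nbhs `|v|)).
  exact: (@norm_continuous _ R^o v).
by apply: continuous_ln; rewrite normr_gt0.
Unshelve. all: by end_near.
Qed.

Lemma measurable_oddpow : measurable_fun [set: R] oddpow.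
Proof.
apply: measurable_funM => //; apply: (measurableT_comp (measurable_powR _)).
exact: normr_measurable.
Qed.

End odd_power.

Section monotone_iteration.
Context {R : realType} {N : nat}.
Notation RN := 'rV[R]_N.
Local Open Scope ereal_scope.

Definition rjmeasurable (v : R -> RN -> R) := jmeasurable (fun s x => (v s x)%:E).

Variables (a : RN -> \bar R) (phi : R -> RN -> R -> R) (T : R).
Variables (P : (R -> RN -> R) -> Prop) (om : R -> RN -> R).
Hypotheses (ma : nnmeas a).
Hypotheses (mphi : forall v, rjmeasurable v -> rjmeasurable (fun s x => phi s x (v s x)))
  (phi0 : forall s x, phi s x 0 = 0%R)
  (ndphi : forall s x, {homo phi s x : u v / (u <= v)%R})
  (cphi : forall s x, continuous (phi s x)).
Let Phi (v : R -> RN -> R) s x := (phi s x (v s x))%:E.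
Hypotheses (P0 : P (fun _ _ => 0%R))
  (Pom : forall v t x, P v -> (0 < t)%R -> (t < T)%R -> (v t x <= om t x)%R)
  (Pfin : forall v t x, rjmeasurable v -> (forall s x, (0 <= v s x)%R) -> P v ->
     (0 < t)%R -> (t < T)%R -> mild a (Phi v) t x \is a fin_num)
  (Pstep : forall v, rjmeasurable v -> (forall s x, (0 <= v s x)%R) -> P v ->
     P (fun t x => if (0 < t < T)%R then fine (mild a (Phi v) t x) else 0%R))
  (Plim : forall (v : nat -> R -> RN -> R) w, (forall n, rjmeasurable (v n)) ->
     (forall n s x, (0 <= v n s x)%R) -> (forall n, P (v n)) ->
     (forall s x, nondecreasing_seq (fun n => v n s x)) ->
     (forall s x, v n s x @[n --> \oo] --> w s x) -> P w).

(** Outside ]0, T[, where no bound is available, the iterate is 0; the Duhamel integral up to t < T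
    only sees the times in ]0, t[. *)
Let next v t x := if (0 < t < T)%R then fine (mild a (Phi v) t x) else 0%R.

Let Phi_ge0 v : (forall s x, (0 <= v s x)%R) -> forall s x, 0 <= Phi v s x.
Proof. by move=> v0 s x; rewrite lee_fin -(phi0 s x) ndphi. Qed.

Let jmeasurable_mild k : jmeasurable k -> (forall s x, 0 <= k s x) -> jmeasurable (mild a k).
Proof.
move=> mk k0; apply: emeasurable_funD; last exact: measurable_duh.
apply: (@measurable_heate_param _ _ _ _ (fun p => a p.2) fst snd) => //.
  by apply: (measurableT_comp ma.1); exact: measurable_snd.
by move=> p; exact: ma.2.
Qed.

Let next_meas v : rjmeasurable v -> (forall s x, (0 <= v s x)%R) -> rjmeasurable (next v).
Proof.
move=> mv v0; apply/measurable_EFinP; apply: measurable_fun_if => //.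
- apply: measurable_and; apply: measurable_fun_ltr => //; exact: measurable_fst.
- apply: measurable_funTS; apply: measurableT_comp => //.
  exact: (jmeasurable_mild (mphi mv) (Phi_ge0 v0)).
Qed.

Let mild_ge0 v t x : (forall s x, (0 <= v s x)%R) -> 0 <= mild a (Phi v) t x.
Proof. by move=> v0; rewrite adde_ge0 ?heate_ge0 ?duh_ge0//; [exact: ma.2|exact: Phi_ge0]. Qed.

Let next_ge0 v : (forall s x, (0 <= v s x)%R) -> forall t x, (0 <= next v t x)%R.
Proof. by move=> v0 t x; rewrite /next; case: ifPn => // _; exact/fine_ge0/mild_ge0. Qed.

Let it n := iter n next (fun _ _ => 0%R).

Let itP n : [/\ rjmeasurable (it n), forall s x, (0 <= it n s x)%R & P (it n)].
Proof.
elim: n => [|n [mi i0 Pi]]; first by split; [rewrite /rjmeasurable/jmeasurable/=; exact: measurable_cst|move=> s x; rewrite /it/=|exact: P0].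
by split; [exact: next_meas|exact: next_ge0|exact: Pstep].
Qed.

Let it_nd n s x : (it n s x <= it n.+1 s x)%R.
Proof.
elim: n s x => [|n IH] s x; first by have [_ i0 _] := itP 1; exact: i0.
rewrite /it !iterS -/(it n) -/(it n.+1) {1 2}/next; case: ifPn => // /andP[s0 sT].
have [m1 v1 P1] := itP n; have [m2 v2 P2] := itP n.+1.
apply: fine_le; [exact: Pfin|exact: Pfin|]; rewrite leeD2l//.
apply: le_duh; [exact: mphi|exact: mphi|exact: Phi_ge0|exact: Phi_ge0|].
by move=> r y _; rewrite lee_fin ndphi.
Qed.

(** Applied once to w and once to z, whence the abstract class P: it contains 0, is stable under one
    step and under increasing limits, and is bounded pointwise by [om], which makes the increasing
    iterates converge to a finite limit. *)
Lemma monotone_mild : exists v : R -> RN -> R,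
  [/\ rjmeasurable v, forall s x, (0 <= v s x)%R, P v &
   forall t x, (0 < t)%R -> (t < T)%R -> (v t x)%:E = mild a (Phi v) t x].
Proof.
have nd s x : nondecreasing_seq (fun n => it n s x).
  by apply/nondecreasing_seqP => n; exact: it_nd.
pose v s x := limn (fun n => it n s x).
have cv s x : it n s x @[n --> \oo] --> v s x.
  case: (boolP (0 < s < T)%R) => [/andP[s0 sT]|sT].
    apply: nondecreasing_is_cvgn => //; exists (om s x) => _ [n _ <-].
    by apply: Pom => //; have [] := itP n.
  rewrite /v (_ : (fun n => it n s x) = cst 0%R); first exact: is_cvg_cst.
  by apply/funext => -[|n]//; rewrite /it iterS /next (negPf sT).
have v0 s x : (0 <= v s x)%R.
  by apply: limr_ge; [exact: cv|apply: nearW => n; have [_ i0 _] := itP n; exact: i0].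
have mv : rjmeasurable v.
  apply/measurable_EFinP; apply: (@measurable_fun_cvg _ _ _ _ (fun n p => it n p.1 p.2)) => //.
  by move=> n; have [mi _ _] := itP n; apply/measurable_EFinP.
exists v; split => //.
  by apply: (@Plim it) => //; move=> n; have [] := itP n.
move=> t x t0 tT.
have c1 : (it n.+1 t x)%:E @[n --> \oo] --> (v t x)%:E.
  by rewrite (cvg_shiftS (fun n => (it n t x)%:E)); apply: cvg_EFin; [exact: nearW|exact: cv].
have c2 : (it n.+1 t x)%:E @[n --> \oo] --> mild a (Phi v) t x.
  rewrite (_ : (fun n => _) = fun n => mild a (Phi (it n)) t x); last first.
    apply/funext => n; rewrite /it iterS -/(it n) /next t0 tT fineK//.
    by have [? ? ?] := itP n; exact: Pfin.
  apply: cvgeD; [|exact: cvg_cst|].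
    by rewrite ge0_adde_def ?inE ?heate_ge0 ?duh_ge0//; [exact: ma.2|exact: Phi_ge0].
  apply: cvg_duh => //.
  - by move=> n; apply: mphi; have [] := itP n.
  - exact: mphi.
  - by move=> n r y; apply: Phi_ge0; have [] := itP n.
  - by move=> r y _ m n mn; rewrite lee_fin ndphi// nd.
  - move=> r y _; apply: cvg_EFin; first exact: nearW.
    apply: (@cvg_comp _ _ _ (fun n => it n r y) (phi r y) _ (nbhs (v r y))); first exact: cv.
    exact: cphi.
by apply: cvg_unique c1 c2.
Qed.

End monotone_iteration.

(** * Comparison and linearity of integrals *)

Section integral_tools.
Context {R : realType} {N : nat}.
Notation RN := 'rV[R]_N.
Notation mu := (lebesgue_row N : {sigma_finite_measure set RN -> \bar R}).
Local Open Scope ereal_scope.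

(** The integral of a nonnegative function is a supremum over simple functions below it, hence
    monotone without measurability. It is used for the norm of the Duhamel integrand as a function
    of time. *)
Lemma le_integral_nonmeasurable d (X : measurableType d) (m : {measure set X -> \bar R})
    (D : set X) (f h : X -> \bar R) :
  (forall x, D x -> 0 <= f x) -> (forall x, D x -> f x <= h x) ->
  \int[m]_(x in D) f x <= \int[m]_(x in D) h x.
Proof.
move=> f0 fh; have h0 x : D x -> 0 <= h x by move=> Dx; apply: le_trans (fh x Dx); exact: f0.
rewrite !ge0_integralE//; apply: ereal_sup_le => _ [k kf <-]; exists k => // x.
apply: le_trans (kf x) _; rewrite /patch; case: ifPn => //; rewrite inE => Dx; exact: fh.
Qed.

Lemma integrable_heate t x (f : RN -> R) : (0 < t)%R -> nnmeas (EFin \o f) ->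
  heate t (EFin \o f) x < +oo -> mu.-integrable [set: RN] (fun y => (heat_kernel t (x - y) * f y)%:E).
Proof.
move=> t0 [mf f0] fin; apply/integrableP; split.
  by under eq_fun do rewrite EFinM; exact: measurable_GrM.
move: fin; rewrite /heate t0; apply: le_lt_trans.
rewrite le_eqVlt; apply/orP; left; apply/eqP; apply: eq_integral => y _ /=.
rewrite ger0_norm ?EFinM// mulr_ge0 ?heat_kernel_ge0//; exact: f0.
Qed.

Lemma heat_diff t x (f1 f2 : RN -> R) : (0 < t)%R ->
  nnmeas (EFin \o f1) -> nnmeas (EFin \o f2) ->
  heate t (EFin \o f1) x < +oo -> heate t (EFin \o f2) x < +oo ->
  heat t (fun y => f1 y - f2 y)%R x =
    (fine (heate t (EFin \o f1) x) - fine (heate t (EFin \o f2) x))%R.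
Proof.
move=> t0 nf1 nf2 h1 h2; rewrite /heat t0.
under eq_Rintegral do rewrite mulrBr.
by rewrite RintegralB//; [rewrite /heate t0|exact: integrable_heate..].
Qed.

Lemma heat_abs_le t x (f : RN -> R) (k : RN -> \bar R) : measurable_fun [set: RN] f ->
  nnmeas k -> (0 < t)%R -> (forall y, `|f y|%:E <= k y) -> `|heat t f x|%:E <= heate t k x.
Proof.
move=> mf [mk k0] t0 fk; rewrite /heat /heate t0 /Rintegral.
have mg : measurable_fun [set: RN] (fun y => (heat_kernel t (x - y) * f y)%:E).
  by under eq_fun do rewrite EFinM; apply: measurable_GrM; exact/measurable_EFinP.
have fineI (I : \bar R) : `|fine I|%:E <= `|I| by case: I => [r||] /=; rewrite ?leey ?lexx.
apply: le_trans (fineI _) _.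
apply: le_trans (le_abse_integral _ measurableT mg) _; apply: ge0_le_integral => //.
- by apply: measurableT_comp.
- exact: measurable_GrM.
- move=> y _; rewrite EFinM abseM /= ger0_norm ?heat_kernel_ge0//.
  by rewrite lee_wpmul2l ?lee_fin ?heat_kernel_ge0//; exact: fk.
Qed.

End integral_tools.

(** * Construction of the mild solution *)

Section mild_solution.
Context {R : realType} {N : nat}.
Notation RN := 'rV[R]_N.
Local Open Scope ereal_scope.

Variables (NB : (RN -> \bar R) -> R -> Prop) (HN : heat_norm NB).
Variables (g al a dl K : R).
Hypotheses (N0 : (0 < N)%N) (g0 : (0 < g)%R) (gN : (g < N%:R)%R).
Hypotheses (al0 : (0 < al)%R) (a0 : (0 <= a)%R) (dl0 : (0 < dl)%R) (K0 : (0 <= K)%R).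

(** The decay is counted from the left end s. A bound counted from time 0 implies it, since r^(-a)
    <= (r - s)^(-a), so the Duhamel estimates apply on every subinterval. *)
Definition kap_class (M s t : R) (w : R -> RN -> \bar R) :=
  [/\ jmeasurable w, forall r x, 0 <= w r x,
   forall r x, (s < r < t)%R -> w r x <= (M * (r - s) `^ (- a))%:E &
   forall r, (s < r < t)%R -> NB (w r) M].

(* [w] solves the equation with data [|u0|], [u = w - z], and [k1], [k2] are the
   integrands of the equations of [w] and [z]. *)
Record mild_data (M T : R) (u0 : RN -> R) (w u : R -> RN -> R)
    (k1 k2 : R -> RN -> \bar R) : Prop := MildData {
  md_class : forall s t, (0 <= s)%R -> (t <= T)%R ->
    kap_class M s t (fun r => EFin \o w r) ;
  md_kernel : forall s, k1 s = kap g (al + 1) (EFin \o w s) ;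
  md_jk1 : jmeasurable k1 ;
  md_jk2 : jmeasurable k2 ;
  md_k2_ge0 : forall s x, 0 <= k2 s x ;
  md_k2_le : forall s x, (0 < s)%R -> (s < T)%R -> k2 s x <= 2%:E * k1 s x ;
  md_w_fin : forall t x, (0 <= t)%R -> (t < T)%R ->
    mild (fun x => `|u0 x|%:E) k1 t x \is a fin_num ;
  md_z_fin : forall t x, (0 <= t)%R -> (t < T)%R ->
    mild (fun x => (`|u0 x| - u0 x)%:E) k2 t x \is a fin_num ;
  md_z_le : forall t x, (0 <= t)%R -> (t < T)%R ->
    mild (fun x => (`|u0 x| - u0 x)%:E) k2 t x <= 2%:E * mild (fun x => `|u0 x|%:E) k1 t x ;
  md_w_norm : forall t, (0 <= t)%R -> (t < T)%R -> NB (mild (fun x => `|u0 x|%:E) k1 t) M ;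
  md_u : forall t x, u t x = (fine (mild (fun x => `|u0 x|%:E) k1 t x) -
    fine (mild (fun x => (`|u0 x| - u0 x)%:E) k2 t x))%R ;
  md_u0 : u 0%R = u0 ;
  md_meas : forall t, measurable_fun [set: RN] (u t) ;
  md_sup : forall t x, (0 < t)%R -> (t < T)%R -> (`|u t x| <= M * t `^ (- a))%R ;
  md_norm : forall t, (0 <= t)%R -> (t < T)%R -> exists h, [/\ nnmeas h,
    forall x, `|u t x|%:E <= h x & NB h M] ;
  md_continuous : forall t e, (0 <= t)%R -> (t < T)%R -> (0 < e)%R ->
    (forall s, (0 <= s)%R -> (s < T)%R -> SC NB (mild (fun x => `|u0 x|%:E) k1 s)) ->
    (forall s, (0 <= s)%R -> (s < T)%R ->
       SC NB (mild (fun x => (`|u0 x| - u0 x)%:E) k2 s)) ->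
    exists2 d : R, (0 < d)%R & forall s, (0 <= s)%R -> (s < T)%R -> (`|s - t| < d)%R ->
    exists h, [/\ nnmeas h, forall x, `|u s x - u t x|%:E <= h x & NB h e] ;
  md_integrand : forall t s x, (0 < s)%R -> (s < t)%R -> (t < T)%R ->
    `|duhamel_integrand (- g) al u t s x|%:E <=
      heate (t - s) (kap g (al + 1) (EFin \o w s)) x ;
  md_eq : forall t x, (0 <= t)%R -> (t < T)%R ->
    lebesgue_measure.-integrable `]0%R, t[ (fun s => (duhamel_integrand (- g) al u t s x)%:E) /\
    u t x = (heat t u0 x +
      \int[lebesgue_measure]_(s in `]0, t[) duhamel_integrand (- g) al u t s x)%R }.

(** The interface with the function space: these four properties are proved for the L^q norm with a
    = N/(2q) and for the sup norm with a = 0. *)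
Hypothesis heat_smoothing : forall f A t x, nnmeas f -> (0 <= A)%R -> NB f A ->
  (0 < t)%R -> heate t f x <= (A * t `^ (- a))%:E.
Hypothesis duh_sup : forall M s t w x, (0 < M)%R -> (s < t)%R -> kap_class M s t w ->
  duh s t (fun r => kap g (al + 1) (w r)) x <=
    (K * (M `^ (al + 1) * (t - s) `^ dl) * (t - s) `^ (- a))%:E.
Hypothesis duh_norm : forall M s t w, (0 < M)%R -> (s < t)%R -> kap_class M s t w ->
  NB (duh s t (fun r => kap g (al + 1) (w r))) (K * (M `^ (al + 1) * (t - s) `^ dl)).
Hypothesis NB_lim : forall (f : nat -> RN -> R) (h : RN -> R) B, (0 <= B)%R ->
  (forall n, nnmeas (EFin \o f n)) -> (forall x, nondecreasing_seq (fun n => f n x)) ->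
  (forall x, f n x @[n --> \oo] --> h x) -> (forall n, NB (EFin \o f n) B) ->
  NB (EFin \o h) B.

Variables (A T : R) (u0 : RN -> R).
(** The datum contributes A, the Duhamel term at most M/8 = A by [AT] (see [small]), and the
    triangle inequality multiplies their sum by 4. *)
Let M := (8 * A)%R.
Hypotheses (A0 : (0 < A)%R) (T0 : (0 < T)%R) (AT : (8 * K * M `^ al * T `^ dl <= 1)%R)
  (mu0 : measurable_fun [set: RN] u0) (u0A : NB (fun x => `|u0 x|%:E) A).
Let M0 : (0 < M)%R. Proof. by rewrite mulr_gt0. Qed.

Let a1 : RN -> \bar R := fun x => `|u0 x|%:E.
Let a2 : RN -> \bar R := fun x => (`|u0 x| - u0 x)%:E.

Let ma1 : nnmeas a1.
Proof.
split; last by move=> x; rewrite lee_fin.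
by apply/measurable_EFinP; apply: measurableT_comp => //; exact: normr_measurable.
Qed.

Let ma2 : nnmeas a2.
Proof.
split; last by move=> x; rewrite lee_fin subr_ge0 ler_norm.
apply/measurable_EFinP; apply: measurable_funB => //.
by apply: measurableT_comp => //; exact: normr_measurable.
Qed.

Let c (y : RN) : R := (enorm y `^ (- g))%R.
Let c0 y : (0 <= c y)%R. Proof. exact: powR_ge0. Qed.
Let phi1 (s : R) (y : RN) (v : R) : R := (c y * oddpow al v)%R.

Let small t : (0 < t)%R -> (t < T)%R -> (K * (M `^ (al + 1) * t `^ dl) <= A)%R.
Proof.
move=> t0 tT; have : (t `^ dl <= T `^ dl)%R.
  by apply: ge0_ler_powR; rewrite ?nnegrE ?ltW.
have Mal0 : (0 <= K * M `^ al)%R by rewrite mulr_ge0 ?powR_ge0.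
move=> /(ler_wpM2l Mal0) h.
have -> : (M `^ (al + 1) = M `^ al * M)%R by rewrite powRD ?powRr1 ?(ltW M0)// gt_eqF// ltr_wpDl// ltW.
have -> : (K * (M `^ al * M * t `^ dl) = K * M `^ al * t `^ dl * M)%R by ring.
have h2 : (K * M `^ al * t `^ dl <= 8^-1)%R.
  by apply: (le_trans h); move: AT; rewrite -!mulrA mulrC -ler_pdivlMr// mul1r.
by apply: (le_trans (ler_wpM2r (ltW M0) h2)); rewrite /M mulrA mulVf ?mul1r.
Qed.

Let kapE (v : R -> RN -> R) r : (forall s x, (0 <= v s x)%R) ->
  (fun y => (phi1 r y (v r y))%:E) = kap g (al + 1) (EFin \o v r).
Proof.
move=> v0; apply/funext => y; rewrite /kap /phi1 /= oddpow_pos// EFinM.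
Qed.

Let class1 (v : R -> RN -> R) := forall t, (0 < t)%R -> (t < T)%R ->
  (forall x, (v t x <= M * t `^ (- a))%R) /\ NB (EFin \o v t) M.

Let class1_kap v s t : rjmeasurable v -> (forall s x, (0 <= v s x)%R) -> class1 v ->
  (0 <= s)%R -> (t <= T)%R -> kap_class M s t (fun r => EFin \o v r).
Proof.
move=> mv v0 Pv s0 tT; split => //.
- move=> r x /andP[sr rt]; rewrite lee_fin.
  have r0 : (0 < r)%R by exact: le_lt_trans sr.
  apply: le_trans ((Pv r r0 (lt_le_trans rt tT)).1 x) _; rewrite ler_wpM2l ?(ltW M0)//.
  by rewrite powR_antitone ?subr_gt0// gerBl.
- move=> r /andP[sr rt]; exact: (Pv r (le_lt_trans s0 sr) (lt_le_trans rt tT)).2.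
Qed.

Let mild1_bound v t x : rjmeasurable v -> (forall s x, (0 <= v s x)%R) -> class1 v ->
  (0 < t)%R -> (t < T)%R ->
  mild a1 (fun s y => (phi1 s y (v s y))%:E) t x <= (M * t `^ (- a))%:E.
Proof.
move=> mv v0 Pv t0 tT; have kc := class1_kap mv v0 Pv (lexx 0%R) (ltW tT).
have h1 := heat_smoothing x ma1 (ltW A0) u0A t0.
have h2 := duh_sup x M0 t0 kc; rewrite subr0 in h2.
rewrite /mild; under [X in _ + duh _ _ X _]eq_fun do rewrite kapE//.
apply: le_trans (leeD h1 h2) _; rewrite -EFinD lee_fin -mulrDl ler_wpM2r ?powR_ge0//.
by have := small t0 tT; have := A0; rewrite /M; lra.
Qed.

Let mild1_norm v t : rjmeasurable v -> (forall s x, (0 <= v s x)%R) -> class1 v ->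
  (0 < t)%R -> (t < T)%R ->
  NB (mild a1 (fun s y => (phi1 s y (v s y))%:E) t) M.
Proof.
move=> mv v0 Pv t0 tT; have kc := class1_kap mv v0 Pv (lexx 0%R) (ltW tT).
have h2 := duh_norm M0 t0 kc; rewrite subr0 in h2.
have mk := jmeasurable_kap g (al + 1) (mv : jmeasurable (fun s y => (v s y)%:E)).
have k0 s y := @kap_ge0 R N g (al + 1) (EFin \o v s) y.
have h1 := hn_heat HN t ma1 u0A.
have nd := nnmeas_duh mk k0 0 t.
rewrite (_ : mild _ _ _ = fun x => heate t a1 x + duh 0 t (fun r => kap g (al + 1) (EFin \o v r)) x).
  2: by apply/funext => x; rewrite /mild; under [X in _ + duh _ _ X _]eq_fun do rewrite kapE//.
have B0 : (0 <= K * (M `^ (al + 1) * t `^ dl))%R by rewrite !mulr_ge0 ?powR_ge0.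
have nn := nnmeasD (nnmeas_heate t ma1) nd.
apply: (hn_le HN nn nn _ _ _ (hn_add HN (nnmeas_heate t ma1) nd (ltW A0) B0 h1 h2)) => //.
  by rewrite mulr_ge0// addr_ge0// ltW.
by have := small t0 tT; rewrite /M; lra.
Qed.

Let mphi1 v : rjmeasurable v -> rjmeasurable (fun s x => phi1 s x (v s x)).
Proof.
move=> /measurable_EFinP mv; apply/measurable_EFinP; apply: measurable_funM.
  apply/measurable_EFinP; apply: (measurableT_comp (measurable_singular g)); exact: measurable_snd.
by apply: measurableT_comp => //; exact: measurable_oddpow.
Qed.

Let mild_fin (b : RN -> \bar R) k t x B : nnmeas b -> (forall s y, 0 <= k s y) -> mild b k t x <= B%:E ->
  mild b k t x \is a fin_num.
Proof.
move=> mb k0 h; rewrite ge0_fin_numE; first exact: (le_lt_trans h (ltry _)).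
by rewrite adde_ge0 ?heate_ge0 ?duh_ge0//; exact: mb.2.
Qed.

Let phi1_ge0 (v : R -> RN -> R) : (forall s x, (0 <= v s x)%R) ->
  forall s y, 0 <= (phi1 s y (v s y))%:E.
Proof. by move=> v0 s y; rewrite lee_fin mulr_ge0// oddpow_ge0. Qed.

Let dominating_solution : exists w : R -> RN -> R,
  [/\ rjmeasurable w, forall s x, (0 <= w s x)%R, class1 w &
   forall t x, (0 < t)%R -> (t < T)%R ->
     (w t x)%:E = mild a1 (fun s y => (phi1 s y (w s y))%:E) t x].
Proof.
apply: (@monotone_mild R N a1 phi1 T class1 (fun t _ => M * t `^ (- a))%R) => //.
- by move=> s x; rewrite /phi1 oddpow0 mulr0.
- by move=> s x u v uv; rewrite ler_wpM2l// le_oddpow.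
- move=> s x v; apply: cvgM; first exact: cvg_cst.
  exact: continuous_oddpow.
- move=> t t0 tT; split; first by move=> x; rewrite mulr_ge0 ?powR_ge0// ltW.
  have n0 : nnmeas (cst 0 : RN -> \bar R) by split => //; exact: measurable_cst.
  by apply: (hn_le HN n0 n0 _ _ (ltW M0) (hn_zero HN)).
- by move=> v t x Pv t0 tT; exact: (Pv t t0 tT).1.
- by move=> v t x mv v0 Pv t0 tT; apply: (mild_fin ma1 (phi1_ge0 v0) (mild1_bound x mv v0 Pv t0 tT)).
- move=> v mv v0 Pv t t0 tT; rewrite t0 tT /=.
  have fin x := mild_fin ma1 (phi1_ge0 v0) (mild1_bound x mv v0 Pv t0 tT).
  split; first by move=> x; rewrite -lee_fin fineK// mild1_bound.
  rewrite (_ : _ \o _ = mild a1 (fun s y => (phi1 s y (v s y))%:E) t); first exact: mild1_norm.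
  by apply/funext => x /=; rewrite fineK.
- move=> v w mv v0 Pv nd cw t t0 tT; split.
    move=> x; rewrite -(cvg_lim _ (cw t x))//; apply: limr_le; first by apply/cvg_ex; exists (w t x).
    by apply: nearW => n; exact: (Pv n t t0 tT).1.
  apply: (NB_lim (ltW M0) _ (nd t) (cw t)) => n; last exact: (Pv n t t0 tT).2.
  by split; [exact: (jmeasurable_section t (mv n))|move=> x; rewrite lee_fin].
Qed.

Definition odd_kernel (u : R -> RN -> R) (s : R) (y : RN) : \bar R := (c y * oddpow al (u s y))%:E.

(** The bound z <= 2 w is preserved by the iteration because the datum satisfies |u0| - u0 <= 2 |u0|
    and, the power being odd, f(w) - f(w - 2w) = 2 f(w): twice w is a supersolution of the equation
    of z. *)
Lemma mild_pair : exists w z : R -> RN -> R,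
  [/\ rjmeasurable w, rjmeasurable z, forall s x, (0 <= w s x)%R & forall s x, (0 <= z s x)%R] /\
  [/\ forall t, (0 < t)%R -> (t < T)%R ->
       (forall x, (w t x <= M * t `^ (- a))%R) /\ NB (EFin \o w t) M,
    forall t x, (0 < t)%R -> (t < T)%R -> (z t x <= 2 * w t x)%R,
    forall t x, (0 < t)%R -> (t < T)%R -> (w t x)%:E = mild a1 (odd_kernel w) t x &
    forall t x, (0 < t)%R -> (t < T)%R -> (z t x)%:E =
      mild a2 (fun s y => (c y * (oddpow al (w s y) - oddpow al (w s y - z s y)))%:E) t x].
Proof.
have [w [mw w0 Pw wE]] := dominating_solution.
pose phi2 s y v := (c y * (oddpow al (w s y) - oddpow al (w s y - v)))%R.
pose class2 (z : R -> RN -> R) := forall t x, (0 < t)%R -> (t < T)%R -> (z t x <= 2 * w t x)%R.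
have mphi2 v : rjmeasurable v -> rjmeasurable (fun s x => phi2 s x (v s x)).
  move=> /measurable_EFinP mv; apply/measurable_EFinP.
  have mw' : measurable_fun [set: measurableTypeR R * RN] (fun p => w p.1 p.2).
    exact/measurable_EFinP.
  apply: measurable_funM.
    apply/measurable_EFinP; apply: (measurableT_comp (measurable_singular g)); exact: measurable_snd.
  apply: measurable_funB.
    by apply: measurableT_comp => //; exact: measurable_oddpow.
  apply: measurableT_comp; first exact: measurable_oddpow.
  exact: measurable_funB.
have phi20 s y : phi2 s y 0%R = 0%R by rewrite /phi2 subr0 subrr mulr0.
have ndphi2 s y : {homo phi2 s y : u v / (u <= v)%R}.
  by move=> u v uv; rewrite ler_wpM2l// lerD2l lerN2 le_oddpow// lerD2l lerN2.
have phi2_ge0 (v : R -> RN -> R) : (forall s x, (0 <= v s x)%R) ->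
    forall s y, 0 <= (phi2 s y (v s y))%:E.
  by move=> v0 s y; rewrite lee_fin -(phi20 s y) ndphi2.
have phi2_le s y v : (v <= 2 * w s y)%R -> (phi2 s y v <= 2 * phi1 s y (w s y))%R.
  move=> vw; apply: (le_trans (ndphi2 s y _ _ vw)); rewrite /phi2 /phi1.
  have -> : (w s y - 2 * w s y = - w s y)%R by ring.
  by rewrite oddpowN le_eqVlt; apply/orP; left; apply/eqP; ring.
have bound2 v t x : rjmeasurable v -> (forall s x, (0 <= v s x)%R) -> class2 v ->
    (0 < t)%R -> (t < T)%R -> mild a2 (fun s y => (phi2 s y (v s y))%:E) t x <= (2 * w t x)%:E.
  move=> mv v0 Pv t0 tT; rewrite EFinM wE// /mild ge0_muleDr ?heate_ge0 ?duh_ge0//; last 2 first.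
  - exact: ma1.2.
  - exact: phi1_ge0.
  apply: leeD.
    rewrite -(heateZ _ _ ma1.1 ma1.2)//; apply: le_heate.
    - exact: ma2.1.
    - by apply: measurable_funeM; exact: ma1.1.
    - exact: ma2.2.
    - by move=> y; rewrite -EFinM lee_fin; have := ler_norm (- u0 y)%R; rewrite normrN; lra.
  apply: (@le_trans _ _ (duh 0 t (fun s y => (phi1 s y (w s y))%:E + (phi1 s y (w s y))%:E) x)).
    apply: le_duh.
    - exact: mphi2.
    - by apply: emeasurable_funD; exact: mphi1.
    - exact: phi2_ge0.
    - by move=> s y; rewrite adde_ge0// phi1_ge0.
    - move=> s y /andP[s0 st]; rewrite -EFinD lee_fin -mulr2n -mulr_natl.
      by apply: phi2_le; apply: Pv => //; exact: lt_trans st tT.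
  by rewrite duhD ?mule_natl ?mule2n//; solve [exact: mphi1|exact: phi1_ge0].
have [z [mz z0 Pz zE]] : exists z : R -> RN -> R,
    [/\ rjmeasurable z, forall s x, (0 <= z s x)%R, class2 z &
     forall t x, (0 < t)%R -> (t < T)%R ->
       (z t x)%:E = mild a2 (fun s y => (phi2 s y (z s y))%:E) t x].
  apply: (@monotone_mild R N a2 phi2 T class2 (fun t x => 2 * w t x)%R) => //.
  - move=> s x v; apply: cvgM; first exact: cvg_cst.
    apply: cvgB; first exact: cvg_cst.
    apply: (@cvg_comp _ _ _ (fun v => w s x - v)%R (oddpow al) _ (nbhs (w s x - v)%R)).
      by apply: cvgB; [exact: cvg_cst|exact: cvg_id].
    exact: continuous_oddpow.
  - by move=> t x t0 tT; rewrite mulr_ge0.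
  - by move=> v t x Pv t0 tT; exact: Pv.
  - by move=> v t x mv v0 Pv t0 tT; apply: (mild_fin ma2 (phi2_ge0 _ v0) (bound2 _ _ x mv v0 Pv t0 tT)).
  - move=> v mv v0 Pv t x t0 tT; rewrite t0 tT /=.
    have fin := mild_fin ma2 (phi2_ge0 _ v0) (bound2 _ _ x mv v0 Pv t0 tT).
    by rewrite -lee_fin fineK// bound2.
  - move=> v z mv v0 Pv nd cz t x t0 tT.
    rewrite -(cvg_lim _ (cz t x))//; apply: limr_le; first by apply/cvg_ex; exists (z t x).
    by apply: nearW => n; exact: (Pv n).
by exists w, z.
Qed.

Section difference.
Variables (w z : R -> RN -> R).
Hypotheses (mw : rjmeasurable w) (mz : rjmeasurable z)
  (w0 : forall s x, (0 <= w s x)%R) (z0 : forall s x, (0 <= z s x)%R)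
  (Pw : forall t, (0 < t)%R -> (t < T)%R ->
       (forall x, (w t x <= M * t `^ (- a))%R) /\ NB (EFin \o w t) M)
  (zw : forall t x, (0 < t)%R -> (t < T)%R -> (z t x <= 2 * w t x)%R).
Let k1 := odd_kernel w.
Let k2r s y := (c y * (oddpow al (w s y) - oddpow al (w s y - z s y)))%R.
Let k2 s y := (k2r s y)%:E.
Hypotheses (wE : forall t x, (0 < t)%R -> (t < T)%R -> (w t x)%:E = mild a1 k1 t x)
  (zE : forall t x, (0 < t)%R -> (t < T)%R -> (z t x)%:E = mild a2 k2 t x).

Let jk1 : jmeasurable k1. Proof. exact: (mphi1 mw). Qed.
Let k10 s y : 0 <= k1 s y. Proof. exact: phi1_ge0. Qed.

Let jk2 : jmeasurable k2.
Proof.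
apply/measurable_EFinP.
have mw' : measurable_fun [set: measurableTypeR R * RN] (fun p => w p.1 p.2).
  exact/measurable_EFinP.
have mz' : measurable_fun [set: measurableTypeR R * RN] (fun p => z p.1 p.2).
  exact/measurable_EFinP.
apply: measurable_funM.
  apply/measurable_EFinP; apply: (measurableT_comp (measurable_singular g)); exact: measurable_snd.
apply: measurable_funB.
  by apply: measurableT_comp => //; exact: measurable_oddpow.
apply: measurableT_comp; first exact: measurable_oddpow.
exact: measurable_funB.
Qed.

Let k20 s y : 0 <= k2 s y.
Proof. by rewrite lee_fin mulr_ge0// subr_ge0 le_oddpow// gerBl. Qed.

Let k2_le s y : (0 < s)%R -> (s < T)%R -> k2 s y <= 2%:E * k1 s y.
Proof.
move=> s0 sT; rewrite /k1 /odd_kernel -EFinM lee_fin mulrCA ler_wpM2l//.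
rewrite mulr_natl mulr2n lerD2l lerNl -oddpowN; apply: le_oddpow => //.
by have := zw y s0 sT; lra.
Qed.

Let W := mild a1 k1.
Let Z := mild a2 k2.

Let W_fin t x : (0 <= t)%R -> (t < T)%R -> W t x \is a fin_num.
Proof.
rewrite le_eqVlt => /predU1P[<- _|t0 tT]; first by rewrite /W mild0.
by rewrite /W -wE.
Qed.

Let Z_fin t x : (0 <= t)%R -> (t < T)%R -> Z t x \is a fin_num.
Proof.
rewrite le_eqVlt => /predU1P[<- _|t0 tT]; first by rewrite /Z mild0.
by rewrite /Z -zE.
Qed.

Let Z_le t x : (0 <= t)%R -> (t < T)%R -> Z t x <= 2%:E * W t x.
Proof.
rewrite le_eqVlt => /predU1P[<- _|t0 tT].
  rewrite /Z /W !mild0 -EFinM lee_fin.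
  by have := ler_norm (- u0 x)%R; rewrite normrN; lra.
by rewrite /Z /W -zE// -wE// -EFinM lee_fin zw.
Qed.

Let W_NB t : (0 <= t)%R -> (t < T)%R -> NB (W t) M.
Proof.
rewrite le_eqVlt => /predU1P[<- _|t0 tT].
  rewrite /W mild0; apply: (hn_le HN ma1 ma1 _ (ltW A0) _ u0A) => //.
  by rewrite /M ler_peMl ?(ltW A0)// ler1n.
rewrite (_ : W t = EFin \o w t); first exact: (Pw t0 tT).2.
by apply/funext => x; rewrite /W -wE.
Qed.

(** Taken from the right-hand sides W and Z: they equal w and z on ]0, T[, and at time 0 they give
    the data |u0| and |u0| - u0, hence u(0) = u0. *)
Definition mild_difference t x := (fine (W t x) - fine (Z t x))%R.
Let u := mild_difference.

Lemma mild_difference0 : u 0%R = u0.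
Proof. by apply/funext => x; rewrite /u /mild_difference /W /Z !mild0 /=; ring. Qed.

Lemma measurable_mild_difference t : measurable_fun [set: RN] (u t).
Proof.
apply: measurable_funB; apply: measurableT_comp => //.
  exact: (nnmeas_mild ma1 jk1 k10 t).1.
exact: (nnmeas_mild ma2 jk2 k20 t).1.
Qed.

(** The inequalities 0 <= Z <= 2 W say that |W - Z| <= W; through this all bounds on w pass to u. *)
Lemma mild_difference_le t x : (0 <= t)%R -> (t < T)%R -> `|u t x|%:E <= W t x.
Proof.
move=> t0 tT; have := Z_le x t0 tT.
have : 0 <= Z t x by exact: (nnmeas_mild ma2 jk2 k20 t).2.
rewrite /u /mild_difference; move: (W_fin x t0 tT) (Z_fin x t0 tT).
case: (W t x) => [b||]//; case: (Z t x) => [d||]//= _ _.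
rewrite -EFinM !lee_fin => d0 db; rewrite ler_norml; apply/andP; split; lra.
Qed.

Lemma mild_difference_sup t x : (0 < t)%R -> (t < T)%R -> (`|u t x| <= M * t `^ (- a))%R.
Proof.
move=> t0 tT; rewrite -lee_fin; apply: le_trans (mild_difference_le x (ltW t0) tT) _.
by rewrite /W -wE// lee_fin (Pw t0 tT).1.
Qed.

Lemma mild_difference_norm t : (0 <= t)%R -> (t < T)%R -> exists h, [/\ nnmeas h,
  forall x, `|u t x|%:E <= h x & NB h M].
Proof.
move=> t0 tT; exists (W t); split; [exact: nnmeas_mild| |exact: W_NB].
by move=> x; exact: mild_difference_le.
Qed.

Let k1_class s t : (0 <= s)%R -> (t <= T)%R -> kap_class M s t (fun r => EFin \o w r).
Proof. exact: (class1_kap mw w0 Pw). Qed.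

Let duh_k1E s t : duh s t k1 = duh s t (fun r => kap g (al + 1) (EFin \o w r)).
Proof. by apply/funext => x; congr duh; apply/funext => r; rewrite -kapE. Qed.

(** One constant for both kernels, the factor 2 coming from k2 <= 2 k1. *)
Let C1 := (2 * (K * M `^ (al + 1)))%R.
Let C10 : (0 <= C1)%R. Proof. by rewrite !mulr_ge0 ?powR_ge0. Qed.

Lemma duh_odd_kernel_norm s t : (0 <= s)%R -> (s < t)%R -> (t < T)%R ->
  NB (duh s t k1) (C1 * (t - s) `^ dl).
Proof.
move=> s0 st tT; have := duh_norm M0 st (k1_class s0 (ltW tT)); rewrite -duh_k1E.
have nk := nnmeas_duh jk1 k10 s t.
apply: (hn_le HN nk nk) => //; first by rewrite !mulr_ge0 ?powR_ge0.
have : (0 <= K * (M `^ (al + 1) * (t - s) `^ dl))%R by rewrite !mulr_ge0 ?powR_ge0.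
by rewrite /C1 -!mulrA; lra.
Qed.

Lemma duh_odd_kernel2_norm s t : (0 <= s)%R -> (s < t)%R -> (t < T)%R ->
  NB (duh s t k2) (C1 * (t - s) `^ dl).
Proof.
move=> s0 st tT; have := duh_norm M0 st (k1_class s0 (ltW tT)); rewrite -duh_k1E.
have nk := nnmeas_duh jk1 k10 s t; have nk2 := nnmeas_duh jk2 k20 s t => h.
have B0 : (0 <= K * (M `^ (al + 1) * (t - s) `^ dl))%R by rewrite !mulr_ge0 ?powR_ge0.
apply: (hn_le HN nk2 (nnmeasZ (ler0n _ 2) nk) _ _ _ (hn_scale HN nk B0 (ler0n _ 2) h)).
- move=> x; apply: (@le_trans _ _ (duh s t (fun s y => k1 s y + k1 s y) x)).
    apply: le_duh => //; first by exact: emeasurable_funD.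
      by move=> r y; rewrite adde_ge0.
    move=> r y /andP[sr rt]; rewrite -mule2n -mule_natl.
    by apply: k2_le; [exact: le_lt_trans sr|exact: lt_trans tT].
  by rewrite duhD// -mule2n -mule_natl.
- by rewrite mulr_ge0.
- by rewrite /C1 le_eqVlt; apply/orP; left; apply/eqP; ring.
Qed.

Let fine_diff_le (b d h1 : \bar R) : b \is a fin_num -> d \is a fin_num -> 0 <= h1 ->
  b <= d + h1 -> d <= b + h1 -> `|fine b - fine d|%:E <= h1.
Proof.
case: b => [b||]// _; case: d => [d||]// _; case: h1 => [h||]//; last by move=> *; exact: leey.
rewrite -!EFinD !lee_fin => h0 bd db; rewrite ler_norml; apply/andP; split => /=; lra.
Qed.

Let sub4 (b d b' d' : R) : (`|(b - d) - (b' - d')| <= `|b - b'| + `|d - d'|)%R.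
Proof. by have -> : ((b - d) - (b' - d') = (b - b') - (d - d'))%R; [ring|exact: ler_normB]. Qed.

Lemma mild_difference_continuous t e : (0 <= t)%R -> (t < T)%R -> (0 < e)%R ->
  (forall s, (0 <= s)%R -> (s < T)%R -> SC NB (W s)) ->
  (forall s, (0 <= s)%R -> (s < T)%R -> SC NB (Z s)) ->
  exists2 d : R, (0 < d)%R & forall s, (0 <= s)%R -> (s < T)%R -> (`|s - t| < d)%R ->
   exists h, [/\ nnmeas h, forall x, `|u s x - u t x|%:E <= h x & NB h e].
Proof.
move=> t0 tT e0 SW SZ; have e8 : (0 < e / 8)%R by rewrite divr_gt0.
have [d1 d10 H1] := mild_time_continuous HN ma1 jk1 k10 C10 dl0 duh_odd_kernel_norm SW t0 tT e8.
have [d2 d20 H2] := mild_time_continuous HN ma2 jk2 k20 C10 dl0 duh_odd_kernel2_norm SZ t0 tT e8.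
exists (Num.min d1 d2); first by rewrite lt_min d10.
move=> s s0 sT; rewrite lt_min => /andP[sd1 sd2].
have [h1 [mh1 a1' b1 n1]] := H1 s s0 sT sd1; have [h2 [mh2 a2' b2 n2]] := H2 s s0 sT sd2.
exists (fun x => h1 x + h2 x); split.
- exact: nnmeasD.
- move=> x; have h1x : `|fine (W s x) - fine (W t x)|%:E <= h1 x.
    by apply: fine_diff_le; [exact: W_fin|exact: W_fin|exact: mh1.2|exact: a1'|exact: b1].
  have h2x : `|fine (Z s x) - fine (Z t x)|%:E <= h2 x.
    by apply: fine_diff_le; [exact: Z_fin|exact: Z_fin|exact: mh2.2|exact: a2'|exact: b2].
  apply: le_trans (leeD h1x h2x); rewrite -EFinD lee_fin; exact: sub4.
- have -> : e = (4 * (e / 8 + e / 8))%R by field.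
  by apply: (hn_add HN) => //; exact: ltW.
Qed.

Let k1_fin t s x : (0 < s)%R -> (s < t)%R -> (t < T)%R -> heate (t - s) (k1 s) x < +oo.
Proof.
move=> s0 st tT; have sT := lt_trans st tT.
have -> : k1 s = kap g (al + 1) (EFin \o w s) by rewrite -kapE.
have m0 : (0 <= M * s `^ (- a))%R by rewrite mulr_ge0 ?powR_ge0// ltW.
apply: le_lt_trans (heate_kap_sup N0 g0 gN al0 _ _ m0 _ _ x) (ltry _).
- exact: (jmeasurable_section s mw).
- by move=> y; rewrite lee_fin.
- by move=> y; rewrite lee_fin (Pw s0 sT).1.
- by rewrite subr_gt0.
Qed.

Let k2_fin t s x : (0 < s)%R -> (s < t)%R -> (t < T)%R -> heate (t - s) (k2 s) x < +oo.
Proof.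
move=> s0 st tT; have sT := lt_trans st tT.
have m1 := jmeasurable_section s jk1; have m2 := jmeasurable_section s jk2.
apply: (@le_lt_trans _ _ (2%:E * heate (t - s) (k1 s) x)).
  rewrite -heateZ//; apply: le_heate => //; first exact: measurable_funeM.
  by move=> y; exact: k2_le.
have := k1_fin x s0 st tT; have : 0 <= heate (t - s) (k1 s) x by apply: heate_ge0.
by case: (heate _ _ _) => [b||]//= _ _; rewrite -EFinM ltry.
Qed.

Let hardyE s y : (0 < s)%R -> (s < T)%R ->
  hardy_nonlinearity (- g) al (u s) y = (c y * oddpow al (w s y) - k2r s y)%R.
Proof.
move=> s0 sT; rewrite /hardy_nonlinearity /k2r -mulrA -/(oddpow al (u s y)) -/(c y).
rewrite /u /mild_difference /W /Z -wE// -zE//=; ring.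
Qed.

Let integrandE t s x : (0 < s)%R -> (s < t)%R -> (t < T)%R ->
  duhamel_integrand (- g) al u t s x =
  (fine (heate (t - s) (k1 s) x) - fine (heate (t - s) (k2 s) x))%R.
Proof.
move=> s0 st tT; have sT := lt_trans st tT; rewrite /duhamel_integrand.
rewrite (_ : hardy_nonlinearity _ _ _ = fun y => (c y * oddpow al (w s y) - k2r s y)%R); last first.
  by apply/funext => y; exact: hardyE.
rewrite heat_diff//.
- by rewrite subr_gt0.
- by split; [exact: (jmeasurable_section s jk1)|move=> y; exact: k10].
- by split; [exact: (jmeasurable_section s jk2)|move=> y; exact: k20].
- exact: k1_fin.
- exact: k2_fin.
Qed.

Lemma integrand_le t s x : (0 < s)%R -> (s < t)%R -> (t < T)%R ->
  `|duhamel_integrand (- g) al u t s x|%:E <= heate (t - s) (kap g (al + 1) (EFin \o w s)) x.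
Proof.
move=> s0 st tT; have sT := lt_trans st tT; rewrite -kapE//.
apply: heat_abs_le.
- rewrite /hardy_nonlinearity; under eq_fun do rewrite -mulrA.
  apply: measurable_funM; first by apply/measurable_EFinP; exact: measurable_singular.
  by apply: (measurableT_comp (measurable_oddpow al)); exact: measurable_mild_difference.
- by split; [exact: (jmeasurable_section s jk1)|move=> y; exact: k10].
- by rewrite subr_gt0.
- move=> y; rewrite lee_fin /hardy_nonlinearity -mulrA -/(oddpow al (u s y)) -/(c y) normrM ger0_norm//.
  rewrite ler_wpM2l// ler_norml -oddpowN !le_oddpow//.
    apply: le_trans (ler_norm _) _; rewrite -lee_fin wE//.
    exact: mild_difference_le (ltW s0) sT.
  rewrite lerNl; apply: le_trans (ler_norm _) _; rewrite normrN -lee_fin wE//.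
  exact: mild_difference_le (ltW s0) sT.
Qed.

(** The equations of W and Z are subtracted, all terms being finite at every x. Since u = w - z, the
    nonlinearity at u is the difference of the two integrands, and u0 is the difference of the two
    data. *)
Lemma mild_difference_eq t x : (0 <= t)%R -> (t < T)%R ->
  lebesgue_measure.-integrable `]0%R, t[ (fun s => (duhamel_integrand (- g) al u t s x)%:E) /\
  u t x = (heat t u0 x + \int[lebesgue_measure]_(s in `]0, t[) duhamel_integrand (- g) al u t s x)%R.
Proof.
rewrite le_eqVlt => /predU1P[<- _|t0 tT].
  rewrite mild_difference0 /heat ltxx set_itv_ge ?bnd_simp ?ltxx//; split.
    exact: integrable_set0.
  by rewrite /Rintegral integral_set0 addr0.
have mH k : jmeasurable k -> (forall s y, 0 <= k s y) ->
    measurable_fun `]0%R, t[ (fun s => heate (t - s) (k s) x).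
  by move=> mk k0; exact: measurable_heate_sigma.
have fin b k : nnmeas b -> jmeasurable k -> (forall s y, 0 <= k s y) -> mild b k t x \is a fin_num ->
    heate t b x \is a fin_num /\ duh 0 t k x \is a fin_num.
  by move=> nb mk k0; rewrite fin_numD => /andP.
have [H1 D1] := fin _ _ ma1 jk1 k10 (W_fin x (ltW t0) tT).
have [H2 D2] := fin _ _ ma2 jk2 k20 (Z_fin x (ltW t0) tT).
have int k : jmeasurable k -> (forall s y, 0 <= k s y) -> duh 0 t k x \is a fin_num ->
    (forall s, (0 < s)%R -> (s < t)%R -> heate (t - s) (k s) x < +oo) ->
    lebesgue_measure.-integrable `]0%R, t[ (fun s => (fine (heate (t - s) (k s) x))%:E) /\
    (\int[lebesgue_measure]_(s in `]0, t[) fine (heate (t - s) (k s) x))%R = fine (duh 0 t k x).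
  move=> mk k0 Df kf.
  have E s : `]0%R, t[%classic s -> (fine (heate (t - s) (k s) x))%:E = heate (t - s) (k s) x.
    by rewrite /= in_itv/= => /andP[s0 st]; rewrite fineK// ge0_fin_numE ?kf//; exact: heate_ge0.
  split.
    have mI : measurable (`]0%R, t[%classic : set (measurableTypeR R)) by exact: measurable_itv.
    apply: (@eq_integrable _ _ _ _ _ mI (fun s => heate (t - s) (k s) x)) => //.
      by move=> s; rewrite inE => sI; rewrite E.
    apply/integrableP; split; first exact: mH.
    rewrite -ge0_fin_numE; last by apply: integral_ge0.
    rewrite (_ : \int[_]_(_ in _) _ = duh 0 t k x)//; apply: eq_integral => s _.
    by rewrite gee0_abs//; exact: heate_ge0.
  by rewrite /Rintegral; congr fine; apply: eq_integral => s; rewrite inE => sI; rewrite E.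
have [I1 E1] := int _ jk1 k10 D1 (fun s s0 st => k1_fin x s0 st tT).
have [I2 E2] := int _ jk2 k20 D2 (fun s s0 st => k2_fin x s0 st tT).
have IE s : s \in `]0%R, t[%classic -> duhamel_integrand (- g) al u t s x =
    (fine (heate (t - s) (k1 s) x) - fine (heate (t - s) (k2 s) x))%R.
  by rewrite inE/= in_itv/= => /andP[s0 st]; exact: integrandE.
split.
  have mI : measurable (`]0%R, t[%classic : set (measurableTypeR R)) by exact: measurable_itv.
  apply: (@eq_integrable _ _ _ _ _ mI (fun s => (fine (heate (t - s) (k1 s) x))%:E - (fine (heate (t - s) (k2 s) x))%:E)) => //.
    by move=> s sI; rewrite IE.
  exact: integrableB.
have -> : (\int[lebesgue_measure]_(s in `]0, t[) duhamel_integrand (- g) al u t s x =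
    \int[lebesgue_measure]_(s in `]0, t[)
      (fine (heate (t - s) (k1 s) x) - fine (heate (t - s) (k2 s) x)))%R.
  by rewrite /Rintegral; congr fine; apply: eq_integral => s sI; rewrite IE.
rewrite RintegralB// E1 E2.
rewrite [heat t u0 x](_ : _ = heat t (fun y => `|u0 y| - (`|u0 y| - u0 y))%R x); last first.
  by congr heat; apply/funext => y; ring.
rewrite heat_diff//; last 2 first.
- by rewrite -ge0_fin_numE ?heate_ge0//; exact: ma1.2.
- by rewrite -ge0_fin_numE ?heate_ge0//; exact: ma2.2.
rewrite /u /mild_difference /W /Z /mild (fineD H1 D1) (fineD H2 D2).
transitivity ((fine (heate t a1 x) - fine (heate t a2 x)) + (fine (duh 0 t k1 x) - fine (duh 0 t k2 x)))%R; last by [].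
move: (fine (heate t a1 x)) (fine (heate t a2 x)) (fine (duh 0 t k1 x)) (fine (duh 0 t k2 x)) => p1 p2 p3 p4.
by ring.
Qed.

Lemma mild_difference_data : mild_data M T u0 w mild_difference k1 k2.
Proof.
split.
- exact: k1_class.
- by move=> s; rewrite -kapE.
- exact: jk1.
- exact: jk2.
- exact: k20.
- exact: k2_le.
- exact: W_fin.
- exact: Z_fin.
- exact: Z_le.
- exact: W_NB.
- by [].
- exact: mild_difference0.
- exact: measurable_mild_difference.
- exact: mild_difference_sup.
- exact: mild_difference_norm.
- exact: mild_difference_continuous.
- exact: integrand_le.
- exact: mild_difference_eq.
Qed.

End difference.

Lemma mild_data_exists : exists w u k1 k2, mild_data M T u0 w u k1 k2.
Proof.
have [w [z [[mw mz w0 z0] [Pw zw wE zE]]]] := mild_pair.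
have D := mild_difference_data mw mz w0 z0 Pw zw wE zE.
by do 4!eexists; exact: D.
Qed.

End mild_solution.

(** * Mild solutions with data in C_0 *)

Section vanishing.
Context {R : realType} {N : nat}.
Notation RN := 'rV[R]_N.
Notation mu := (lebesgue_row N : {sigma_finite_measure set RN -> \bar R}).
Notation leb := (@lebesgue_measure R : {sigma_finite_measure set (measurableTypeR R) -> \bar R}).
Local Open Scope ereal_scope.

(** The heat flow at time 2t is kept on the right so that f may be singular: the estimates of the
    weight apply to it, and t/d^2 is the gain due to the distance. *)
Lemma heate_far t x (f : RN -> \bar R) (d : R) : (0 < t)%R -> (0 < d)%R -> nnmeas f ->
  (forall y, (enorm (x - y) < d)%R -> f y = 0) ->
  heate t f x <= (2 `^ (N%:R / 2) * (8 * t / d ^+ 2))%:E * heate (2 * t) f x.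
Proof.
move=> t0 d0 [mf f0] far; have t20 : (0 < 2 * t)%R by rewrite mulr_gt0.
have C0 : (0 <= 2 `^ (N%:R / 2) * (8 * t / d ^+ 2) :> R)%R.
  by rewrite mulr_ge0 ?powR_ge0// divr_ge0 ?sqr_ge0// mulr_ge0// ltW.
rewrite /heate t0 t20 -ge0_integralZl ?lee_fin//; last 2 first.
- exact: measurable_GrM.
- by move=> y _; exact: GrM_ge0.
apply: ge0_le_integral => //.
- by move=> y _; exact: GrM_ge0.
- exact: measurable_GrM.
- by apply: measurable_funeM; exact: measurable_GrM.
move=> y _; have [xy|xy] := ltP (enorm (x - y)) d; first by rewrite far// !mule0.
rewrite muleA -EFinM lee_wpmul2r// lee_fin.
apply: le_trans (heat_kernel_far t0 (ltW d0) xy) _.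
rewrite ler_wpM2r ?heat_kernel_ge0// ler_wpM2l ?powR_ge0//.
have X0 : (0 < d ^+ 2 / (8 * t))%R by rewrite divr_gt0 ?exprn_gt0// mulr_gt0.
rewrite expRN -[leRHS]invrK lef_pV2 ?posrE ?expR_gt0 ?invr_gt0 ?divr_gt0 ?mulr_gt0 ?exprn_gt0//.
rewrite invf_div; apply: le_trans (expR_ge1Dx _); by rewrite lerDr.
Qed.

(** The triangle inequality is that of the sup norm; the factor N is the price of the comparison
    with the Euclidean norm. *)
Lemma enorm_far (x y : RN) (d r : R) : (0 < N)%N -> (N%:R * (r + d) <= enorm x)%R ->
  (enorm y < r)%R -> (d <= enorm (x - y))%R.
Proof.
move=> N0 xd yr; apply: le_trans (mx_norm_le_enorm (x - y)).
have h1 : (r + d <= `|x|)%R.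
  have Np : (0 < N%:R :> R)%R by rewrite ltr0n.
  by rewrite -(ler_pM2l Np) (le_trans xd)// enorm_le_mx_norm.
have := mx_norm_le_enorm y; have := lerB_normD x (- y)%R; rewrite normrN; lra.
Qed.

Variables (g al m T B : R) (f : RN -> R) (k : R -> RN -> \bar R).
Hypotheses (N0 : (0 < N)%N) (g0 : (0 < g)%R) (gN : (g < N%:R)%R) (g2 : (g < 2)%R)
  (al0 : (0 < al)%R) (m0 : (0 < m)%R) (T0 : (0 < T)%R).
Hypotheses (Cf : C0 f) (f0 : forall x, (0 <= f x)%R) (mk : jmeasurable k)
  (k0 : forall s x, 0 <= k s x)
  (km : forall s x, (0 < s)%R -> (s < T)%R -> k s x <= kap g (al + 1) (cst m%:E) x).
Let KB := (1 + Kball (N := N) g)%R.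
Let KB0 : (0 <= KB)%R. Proof. by rewrite addr_ge0// (Kball_ge0 N0)// ltW. Qed.
Let M := (m `^ (al + 1))%R.
Let M0 : (0 < M)%R. Proof. exact: powR_gt0. Qed.
Let de := (1 - g / 2)%R.
Let de0 : (0 < de)%R. Proof. by rewrite subr_gt0 ltr_pdivrMr// mul1r. Qed.
Let Kc := (KB / de * M)%R.
Let Kc0 : (0 <= Kc)%R.
Proof. by rewrite mulr_ge0 ?divr_ge0// ltW. Qed.
Let mc : measurable_fun [set: RN] (cst m%:E : RN -> \bar R). Proof. exact: measurable_cst. Qed.
Let c0 : forall y : RN, 0 <= (cst m%:E : RN -> \bar R) y. Proof. by move=> y; rewrite lee_fin ltW. Qed.
Let jc : jmeasurable (fun _ : R => cst m%:E : RN -> \bar R).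
Proof. exact: measurable_cst. Qed.
Let jkc := jmeasurable_kap g (al + 1) jc.
Let kc0 := fun (s : R) y => @kap_ge0 R N g (al + 1) (cst m%:E) y.
Let mf : nnmeas (EFin \o f).
Proof.
split; last by move=> x; rewrite lee_fin.
by apply/measurable_EFinP; apply: continuous_measurable_row; exact: Cf.1.
Qed.

Let duh_small s t x : (0 <= s)%R -> (s <= t)%R -> (t < T)%R ->
  duh s t k x <= (Kc * (t - s) `^ de)%:E.
Proof.
move=> s0 st tT; apply: (@le_trans _ _ (duh s t (fun=> kap g (al + 1) (cst m%:E)) x)).
  apply: le_duh => // r y /andP[sr rt]; apply: km; [exact: le_lt_trans sr|exact: lt_trans tT].
apply: le_trans (duh_kap_bounded N0 g0 gN g2 al0 m0 jc _ x st _) _ => //.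
by rewrite lee_fin /Kc /KB /de /M; rewrite le_eqVlt; apply/orP; left; apply/eqP; ring.
Qed.

Let mild_bounded : exists2 B' : R, (0 < B')%R & forall t x, (0 <= t)%R -> (t < T)%R ->
  mild (EFin \o f) k t x <= B'%:E.
Proof.
have [B' B'0 fB] := C0_bounded Cf.
exists (B' + Kc * T `^ de)%R; first by rewrite ltr_pwDl// mulr_ge0 ?powR_ge0.
move=> t x t0 tT; rewrite EFinD; apply: leeD.
  apply: (hn_heat (@heat_norm_sup R N) t mf _ x) => y; rewrite lee_fin.
  by apply: le_trans (ler_norm _) (fB y).
apply: le_trans (duh_small x (lexx 0%R) t0 tT) _; rewrite lee_fin ler_wpM2l//.
by rewrite subr0; apply: ge0_ler_powR; rewrite ?nnegrE ?(ltW de0) ?(ltW tT) ?(ltW T0).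
Qed.

Let mild_fin t x : (0 <= t)%R -> (t < T)%R -> mild (EFin \o f) k t x \is a fin_num.
Proof.
move=> t0 tT; have [B' _ h] := mild_bounded; rewrite ge0_fin_numE.
  exact: le_lt_trans (h t x t0 tT) (ltry _).
exact: (nnmeas_mild mf mk k0 t).2.
Qed.

Let h t x := fine (mild (EFin \o f) k t x).

(** The equation is restarted at t - ep: the last Duhamel piece is at most e / 2, and the rest is
    the heat flow during the time ep of a bounded function, which [heate_bounded_continuous]
    controls. *)
Let h_unif t (e : R) : (0 < t)%R -> (t < T)%R -> (0 < e)%R -> exists2 d : R, (0 < d)%R &
  forall x z, (enorm (x - z) < d)%R -> (h t x <= h t z + e)%R.
Proof.
move=> t0 tT e0; have [B' B'0 hB] := mild_bounded.
have e2 : (0 < e / 2)%R by rewrite divr_gt0.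
have Kc1 : (0 < Kc + 1)%R by rewrite ltr_wpDl.
pose ep := Num.min (t / 2)%R ((e / 2 / (Kc + 1)) `^ de^-1)%R.
have ep0 : (0 < ep)%R by rewrite lt_min divr_gt0// powR_gt0// !divr_gt0.
have ept : (ep < t)%R by rewrite gt_min; apply/orP; left; lra.
have Kep : (Kc * ep `^ de <= e / 2)%R.
  apply: (@le_trans _ _ (Kc * (e / 2 / (Kc + 1)))%R).
    rewrite ler_wpM2l//; apply: (@le_trans _ _ (((e / 2 / (Kc + 1)) `^ de^-1) `^ de)%R).
      by apply: ge0_ler_powR; rewrite ?nnegrE ?powR_ge0 ?(ltW ep0) ?(ltW de0)// ge_min lexx orbT.
    by rewrite -powRrM mulVf ?gt_eqF// powRr1//; apply: ltW; rewrite divr_gt0.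
  by rewrite mulrA ler_pdivrMr// mulrC ler_wpM2l ?(ltW e2)// lerDl.
(* With d^2 = 8 ep eta^2 the two terms of [heate_bounded_continuous] are both at most eta, and B'
   (eta + eta) = e / 2. *)
pose eta := (e / 4 / B')%R.
have eta0 : (0 < eta)%R by rewrite !divr_gt0.
exists (Num.sqrt (8 * ep * eta * eta))%R; first by rewrite sqrtr_gt0 mulr_gt0// mulr_gt0// mulr_gt0.
move=> x z xz; rewrite -lee_fin EFinD !fineK ?mild_fin ?(ltW t0)//.
have tep : (0 <= t - ep)%R by rewrite subr_ge0 ltW.
have tle : (t - ep <= t)%R by rewrite gerBl ltW.
have E y := mild_restart mf mk k0 y tep tle.
rewrite !E (_ : t - (t - ep) = ep)%R; last by ring.
have nm := nnmeas_mild mf mk k0 (t - ep).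
have L : Linf_le (mild (EFin \o f) k (t - ep)) B'.
  by move=> y; apply: hB => //; apply: le_lt_trans tT.
have H := heate_bounded_continuous x z ep0 nm (ltW B'0) L eta0.
have D := duh_small x tep tle tT; rewrite (_ : t - (t - ep) = ep)%R in D; last by ring.
apply: le_trans (leeD H D) _; rewrite -addeA -EFinD.
apply: (@le_trans _ _ (heate ep (mild (EFin \o f) k (t - ep)) z + e%:E)); last first.
  by rewrite leeD2r// leeDl// duh_ge0.
rewrite leeD2l// lee_fin.
have q : (enorm (x - z) ^+ 2 / (8 * ep * eta) <= eta)%R.
  rewrite ler_pdivrMr; last by rewrite mulr_gt0// mulr_gt0.
  rewrite mulrC.
  have s0 : (0 <= 8 * ep * eta * eta)%R by apply: ltW; rewrite mulr_gt0// mulr_gt0// mulr_gt0.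
  rewrite -(sqr_sqrtr s0); rewrite ler_pXn2r ?nnegrE ?enorm_ge0 ?sqrtr_ge0//; exact: ltW.
have : (B' * (eta + enorm (x - z) ^+ 2 / (8 * ep * eta)) <= B' * (eta + eta))%R.
  by rewrite ler_wpM2l ?(ltW B'0)// lerD2l.
have -> : (B' * (eta + eta) = e / 2)%R by rewrite /eta; field; rewrite gt_eqF.
by move=> ?; lra.
Qed.

Let h_continuous t : (0 < t)%R -> (t < T)%R -> continuous (h t).
Proof.
move=> t0 tT x; apply/(@cvgrPdist_le _ R^o _ _ (@nbhs_filter RN x)) => e e0.
have [d d0 dP] := h_unif t0 tT e0.
have dN : (0 < d / N%:R)%R by rewrite divr_gt0// ltr0n.
have Np : (0 < N%:R :> R)%R by rewrite ltr0n.
apply/nbhs_ballP; exists (d / N%:R)%R => //= z; rewrite mx_norm_ball /ball_/= => xz.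
have xzd : (enorm (x - z) < d)%R.
  apply: le_lt_trans (enorm_le_mx_norm _) _; by rewrite mulrC -ltr_pdivlMr.
have h1 := dP _ _ xzd; rewrite enormC in xzd; have h2 := dP _ _ xzd.
rewrite ler_norml; apply/andP; split; lra.
Qed.

(** Datum and integrand are cut at |y| = d. Beyond d the datum is small and the weight is at most
    d^(-g); the part inside is at distance at least d from x once |x| >= 2 N d, and gains 1/d^2 by
    [heate_far]. *)
Let h_vanish t (e : R) : (0 < t)%R -> (t < T)%R -> (0 < e)%R ->
  exists r, forall x, (r < enorm x)%R -> (h t x < e)%R.
Proof.
move=> t0 tT e0; have e8 : (0 < e / 8)%R by rewrite divr_gt0.
have [B' B'0 fB] := C0_bounded Cf; have [r1 r1P] := Cf.2 _ e8.
have Np : (0 < N%:R :> R)%R by rewrite ltr0n.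
pose C2 := (2 `^ (N%:R / 2) * (8 * t))%R.
have C20 : (0 <= C2)%R by rewrite !mulr_ge0 ?powR_ge0// ltW.
pose Q := (C2 * (B' + Kc * t `^ de))%R.
have Kt0 : (0 <= Kc * t `^ de)%R by rewrite mulr_ge0 ?powR_ge0.
have Q0 : (0 <= Q)%R by rewrite mulr_ge0// addr_ge0// ltW.
have tM0 : (0 < t * M)%R by rewrite mulr_gt0.
pose d1 := ((e / 8 / (t * M)) `^ (- g^-1))%R.
have d10 : (0 < d1)%R by rewrite powR_gt0// divr_gt0.
(* Each summand meets one requirement: d1 makes t M d^(-g) at most e / 8, the maximum exceeds the
   threshold r1 of the datum, and the root makes the total Q / d^2 of the inner parts at most e /
   8. *)
pose d := (d1 + (Num.max 0 r1) + Num.sqrt (8 * Q / e) + 1)%R.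
have mr : (0 <= Num.max 0 r1)%R by rewrite le_max lexx.
have sq0 : (0 <= Num.sqrt (8 * Q / e))%R by exact: sqrtr_ge0.
have d0 : (0 < d)%R by rewrite /d; lra.
have r1m : (r1 <= Num.max 0 r1)%R by rewrite le_max lexx orbT.
have dr1 : (r1 < d)%R by rewrite /d; lra.
have dQ : (Q / d ^+ 2 <= e / 8)%R.
  rewrite ler_pdivrMr ?exprn_gt0// -ler_pdivrMl// invf_div mulrAC.
  have s0 : (0 <= 8 * Q / e)%R by rewrite divr_ge0 ?(ltW e0)// mulr_ge0.
  rewrite -(sqr_sqrtr s0) ler_pXn2r ?nnegrE ?(ltW d0) ?sq0//; rewrite /d; lra.
have dg : (t * M * d `^ (- g) <= e / 8)%R.
  rewrite mulrC -ler_pdivlMr//; apply: (@le_trans _ _ (d1 `^ (- g))%R).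
    by apply: powR_antitone; rewrite ?(ltW g0)// /d; lra.
  by rewrite -powRrM mulrNN mulVf ?gt_eqF// powRr1//; apply: ltW; rewrite divr_gt0.
exists (N%:R * (d + d))%R => x xd.
have far (F : RN -> \bar R) y : (enorm (x - y) < d)%R -> cutin d F y = 0.
  rewrite /cutin => xy; case: ifPn => // yd; have := enorm_far N0 (ltW xd) yd.
  by rewrite leNgt xy.
have heat1 : heate t (EFin \o f) x <= (e / 8 + C2 * B' / d ^+ 2)%:E.
  rewrite -(cutin_cutout d (EFin \o f)) heateD; last 4 first.
  - exact: (measurable_cutin d mf.1).
  - exact: (measurable_cutout d mf.1).
  - exact: (cutin_ge0 d mf.2).
  - exact: (cutout_ge0 d mf.2).
  rewrite addeC EFinD; apply: leeD.
    rewrite -(heate_cst t x (ltW e8)); apply: le_heate => //.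
    - exact: (measurable_cutout d mf.1).
    - exact: (cutout_ge0 d mf.2).
    - move=> y; rewrite /cutout; case: ifPn; first by rewrite lee_fin ltW.
      by rewrite -leNgt lee_fin => dy; apply/ltW/(le_lt_trans (ler_norm _))/r1P/(lt_le_trans dr1).
  have nc : nnmeas (cutin d (EFin \o f)) by split; [exact: (measurable_cutin d mf.1)|exact: (cutin_ge0 d mf.2)].
  apply: le_trans (heate_far t0 d0 nc (far _)) _.
  have -> : (C2 * B' / d ^+ 2 = 2 `^ (N%:R / 2) * (8 * t / d ^+ 2) * B')%R.
    by rewrite /C2; field; rewrite gt_eqF.
  rewrite [leRHS]EFinM; apply: lee_wpmul2l.
    by rewrite lee_fin mulr_ge0 ?powR_ge0// divr_ge0 ?sqr_ge0// mulr_ge0// ltW.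
  apply: (hn_heat (@heat_norm_sup R N) (2 * t) nc _ x) => y; rewrite /cutin; case: ifPn => _.
    by rewrite lee_fin; apply: le_trans (ler_norm _) (fB y).
  by rewrite lee_fin ltW.
have duh1 : duh 0 t k x <= (M * d `^ (- g) * t + C2 * Kc * t `^ de / d ^+ 2)%:E.
  pose kc : RN -> \bar R := kap g (al + 1) (cst m%:E).
  have mkc : measurable_fun [set: RN] kc by exact: measurable_kap.
  have kc00 := @kap_ge0 R N g (al + 1) (cst m%:E).
  have nc : nnmeas (cutin d kc) by split; [exact: (measurable_cutin d mkc)|exact: (cutin_ge0 d kc00)].
  (* The outer part of the weight contributes a constant; the inner part is smoothed at time 2 (t -
     s), which leaves an integrable singularity at s = t. *)
  pose G s := (M * d `^ (- g))%:E + (C2 / d ^+ 2 * KB * M)%:E * ((t - s) `^ (- (g / 2)))%:E.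
  have ml : measurable_fun `]0%R, t[ (fun r : R => ((t - r) `^ (- (g / 2)))%:E).
    apply/measurable_EFinP; apply: measurable_funTS.
    by apply: (measurableT_comp (measurable_powR _)); exact: measurable_funB.
  have cc0 : (0 <= C2 / d ^+ 2 * KB * M)%R by rewrite !mulr_ge0 ?invr_ge0 ?sqr_ge0// ltW.
  have Md0 : (0 <= M * d `^ (- g))%R by rewrite mulr_ge0 ?powR_ge0// ltW.
  apply: (@le_trans _ _ (\int[leb]_(s in `]0%R, t[) G s)).
    apply: ge0_le_integral => //.
    - by move=> s _; exact: heate_ge0.
    - exact: measurable_heate_sigma.
    - by apply: emeasurable_funD => //; exact: measurable_funeM.
    move=> s; rewrite /= in_itv/= => /andP[s0 st]; have ts : (0 < t - s)%R by rewrite subr_gt0.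
    apply: (@le_trans _ _ (heate (t - s) kc x)).
      apply: le_heate => //; first exact: jmeasurable_section.
      by move=> y; apply: km => //; exact: lt_trans tT.
    rewrite -(cutin_cutout d kc) heateD; last 4 first.
    - exact: (measurable_cutin d mkc).
    - exact: (measurable_cutout d mkc).
    - exact: (cutin_ge0 d kc00).
    - exact: (cutout_ge0 d kc00).
    rewrite addeC; apply: leeD.
      rewrite -(heate_cst (t - s) x Md0); apply: le_heate => //.
      - exact: (measurable_cutout d mkc).
      - exact: (cutout_ge0 d kc00).
      - move=> y; rewrite [X in _ <= X](_ : _ = (d `^ (- g) * m `^ (al + 1))%:E); last by rewrite /cst mulrC.
        by apply: (cutout_kap_sup _ _ c0 (ltW m0)).
    apply: le_trans (heate_far ts d0 nc (far _)) _.
    apply: (@le_trans _ _ ((C2 / d ^+ 2)%:E * (KB * ((2 * (t - s)) `^ (- (g / 2)) * M))%:E)).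
      apply: lee_pmul.
      - by rewrite lee_fin mulr_ge0 ?powR_ge0// divr_ge0 ?sqr_ge0// mulr_ge0// ltW.
      - by apply: heate_ge0; exact: nc.2.
      - rewrite lee_fin /C2 -[leRHS]mulrA ler_wpM2l ?powR_ge0// ler_wpM2r ?invr_ge0 ?sqr_ge0//.
        by rewrite ler_wpM2l// gerBl ltW.
      - apply: (@le_trans _ _ (heate (2 * (t - s)) kc x)).
          apply: le_heate => //; [exact: nc.1|exact: nc.2|].
          by move=> y; rewrite /cutin; case: ifP.
        by apply: (heate_kap_sup N0 g0 gN al0 mc c0 (ltW m0)) => //; rewrite mulr_gt0.
    rewrite -!EFinM lee_fin -[leLHS]mulrA.
    have -> : (C2 / d ^+ 2 * KB * M * (t - s) `^ (- (g / 2)) =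
       C2 * ((d ^+ 2)^-1 * (KB * ((t - s) `^ (- (g / 2)) * M))))%R by ring.
    rewrite !ler_wpM2l ?invr_ge0 ?sqr_ge0// ler_wpM2r ?(ltW M0)//.
    by apply: powR_antitone => //; [lra|rewrite divr_ge0// ltW].
  rewrite ge0_integralD//; last 2 first.
  - by move=> s _; rewrite mule_ge0 ?lee_fin ?powR_ge0.
  - exact: measurable_funeM.
  rewrite EFinD; apply: leeD.
    by rewrite integral_cst//= lebesgue_measure_itv/= lte_fin t0 -EFinB subr0 -EFinM.
  rewrite ge0_integralZl//; last by move=> s _; rewrite lee_fin powR_ge0.
  apply: (@le_trans _ _ ((C2 / d ^+ 2 * KB * M)%:E * (t `^ de / de)%:E)).
    rewrite lee_wpmul2l ?lee_fin// -[in leRHS](subr0 t); apply: integral_powRl_le; first exact: ltW.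
    by rewrite ltr_pdivrMr// mul1r.
  rewrite -EFinM lee_fin le_eqVlt; apply/orP; left; apply/eqP; rewrite /Kc; field.
  by rewrite !gt_eqF.
rewrite -lte_fin fineK ?mild_fin ?(ltW t0)//.
apply: le_lt_trans (leeD heat1 duh1) _; rewrite -EFinD lte_fin.
have -> : (e / 8 + C2 * B' / d ^+ 2 + (M * d `^ (- g) * t + C2 * Kc * t `^ de / d ^+ 2) =
  e / 8 + t * M * d `^ (- g) + Q / d ^+ 2)%R by rewrite /Q; field; rewrite gt_eqF.
by lra.
Qed.

Lemma mild_C0 t : (0 <= t)%R -> (t < T)%R ->
  C0 (fun x => fine (mild (EFin \o f) k t x)) /\
  forall x, mild (EFin \o f) k t x \is a fin_num.
Proof.
rewrite le_eqVlt => /predU1P[<- tT|t0 tT].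
  by rewrite mild0; split.
split; last by move=> x; exact: mild_fin (ltW t0) tT.
split; first exact: h_continuous.
move=> e e0; have [r rP] := h_vanish t0 tT e0; exists r => x xr.
by rewrite ger0_norm ?rP//; apply: fine_ge0; exact: (nnmeas_mild mf mk k0 t).2.
Qed.

End vanishing.
(** * Lebesgue norms *)

Section norms.
Context {R : realType} {N : nat}.
Notation RN := 'rV[R]_N.
Notation mu := (lebesgue_row N : {sigma_finite_measure set RN -> \bar R}).
Local Open Scope ereal_scope.
Implicit Types (f : RN -> R) (h : RN -> \bar R).

Lemma C0_sub (f h : RN -> R) : C0 f -> C0 h -> C0 (fun x => f x - h x)%R.
Proof.
move=> [cf f0] [ch h0]; split; first by move=> x; exact: (@cvgB R R^o RN (nbhs x) _ f h (f x) (h x) (cf x) (ch x)).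
move=> e e0; have e2 : (0 < e / 2)%R by rewrite divr_gt0.
have [r1 r1P] := f0 _ e2; have [r2 r2P] := h0 _ e2.
exists (Num.max r1 r2) => x; rewrite gt_max => /andP[/r1P f1 /r2P h1].
apply: le_lt_trans (ler_normB _ _) _; lra.
Qed.

Lemma C0_abs (f : RN -> R) : C0 f -> C0 (fun x => `|f x|%R).
Proof.
move=> [cf f0]; split; last by move=> e /f0[r rP]; exists r => y /rP; rewrite normr_id.
by move=> y; apply: (@continuous_comp _ _ _ f Num.norm); [exact: cf|exact: norm_continuous].
Qed.

Lemma C0_scale (f : RN -> R) (k : R) : C0 f -> C0 (fun x => k * f x)%R.
Proof.
move=> [cf f0]; split; first by move=> x; exact: (@cvgM R RN (nbhs x) _ (cst k) f k (f x) (cvg_cst _) (cf x)).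
move=> e e0; have k0 : (0 < `|k| + 1)%R by rewrite ltr_wpDl.
have ek0 : (0 < e / (`|k| + 1))%R by rewrite divr_gt0.
have [r rP] := f0 _ ek0; exists r => x /rP h.
rewrite normrM; apply: (@le_lt_trans _ _ ((`|k| + 1) * `|f x|)%R).
  by rewrite ler_wpM2r// lerDl.
by rewrite mulrC -ltr_pdivlMr.
Qed.

Lemma Lnorm_le_Lq q f h B : (0 < q)%R -> (0 <= B)%R -> (forall x, `|f x|%:E <= h x) ->
  Lq_le q h B -> 'N[mu]_q%:E[EFin \o f] <= B%:E.
Proof.
move=> q0 B0 fh hB; apply: (poweR_le_EFin q0) => //; first exact: Lnorm_ge0.
rewrite poweR_Lnorm ?gt_eqF//; apply: le_trans hB.
apply: le_integral_nonmeasurable => x _; first exact: poweR_ge0.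
have h0 : 0 <= h x by apply: le_trans (fh x); rewrite lee_fin.
by apply: gt0_ler_poweR; rewrite ?in_itv/= ?leey ?andbT ?lee_fin ?(ltW q0)//; exact: fh.
Qed.

Lemma Lq_le_Lnorm q f B : (0 < q)%R -> 'N[mu]_q%:E[EFin \o f] <= B%:E ->
  Lq_le q (fun x => `|f x|%:E) B.
Proof.
move=> q0 fB; rewrite /Lq_le [leLHS](_ : _ = 'N[mu]_q%:E[EFin \o f] `^ q); last by rewrite poweR_Lnorm ?gt_eqF.
rewrite -poweR_EFin.
have N0 := Lnorm_ge0 mu q%:E (EFin \o f).
have B0 := le_trans N0 fB.
by apply: gt0_ler_poweR; rewrite ?in_itv/= ?leey ?andbT ?(ltW q0).
Qed.

(** Since |f|^r <= S^(r-q) |f|^q, a pointwise bound and an L^q bound control every L^r norm; the L^r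
    part of the solution concept rests on this, so that r does not influence the time T. *)
Lemma Lnorm_le_interp q r f h B S : (0 < q)%R -> (q < r)%R -> (0 <= B)%R -> (0 <= S)%R ->
  nnmeas h -> (forall x, `|f x|%:E <= h x) -> (forall x, (`|f x| <= S)%R) -> Lq_le q h B ->
  'N[mu]_r%:E[EFin \o f] <= ((S `^ (r - q) * B `^ q) `^ r^-1)%:E.
Proof.
move=> q0 qr B0 S0 [mh h0] fh fS hB; have r0 := lt_trans q0 qr.
have SB0 : (0 <= S `^ (r - q) * B `^ q)%R by rewrite mulr_ge0 ?powR_ge0.
apply: (poweR_le_EFin r0); rewrite ?powR_ge0//; first exact: Lnorm_ge0.
rewrite poweR_Lnorm ?gt_eqF// -powRrM mulVf ?gt_eqF// powRr1//.
apply: (@le_trans _ _ (\int[mu]_x ((S `^ (r - q))%:E * h x `^ q))).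
  apply: le_integral_nonmeasurable => x _; first exact: poweR_ge0.
  rewrite /=; apply: (@le_trans _ _ ((S `^ (r - q))%:E * (`|f x| `^ q)%:E)).
    rewrite -EFinM lee_fin -[in leLHS](subrK q r) powRD; last first.
      by rewrite subrK (gt_eqF r0).
    rewrite ler_wpM2r ?powR_ge0//; apply: ge0_ler_powR; rewrite ?nnegrE ?subr_ge0 ?(ltW qr)//.
  rewrite lee_wpmul2l ?lee_fin ?powR_ge0// -poweR_EFin.
  by apply: gt0_ler_poweR; rewrite ?in_itv/= ?leey ?andbT ?lee_fin ?(ltW q0)//; exact: fh.
rewrite ge0_integralZl ?lee_fin ?powR_ge0//; last 2 first.
- exact: measurable_poweR_comp.
- by move=> x _; exact: poweR_ge0.
by rewrite [leRHS]EFinM lee_wpmul2l ?lee_fin ?powR_ge0.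
Qed.

Lemma Lnorm_le_sup f B : (0 <= B)%R -> (forall x, (`|f x| <= B)%R) ->
  'N[mu]_+oo[EFin \o f] <= B%:E.
Proof.
move=> B0 fB; rewrite unlock /=; case: ifPn => _; last by rewrite lee_fin.
by apply/ess_supP/nearW => x /=; rewrite lee_fin.
Qed.

(** The heat flow of |f| does not see null sets, so it is at most B everywhere; it tends to |f|
    uniformly by [SC_sup]. *)
Lemma Lnorm_sup_lt f x B : C0 f -> 'N[mu]_+oo[EFin \o f] <= B%:E -> (`|f x| <= B)%R.
Proof.
move=> Cf fB; have B0 : (0 <= B)%R by rewrite -lee_fin; apply: le_trans fB; exact: Lnorm_ge0.
(* The norm with exponent +oo is an essential supremum only when the whole space has positive
   measure, and 0 by default; the kernel, of integral 1, shows that the measure is not zero. *)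
have mu0 : 0 < mu [set: RN].
  rewrite lt_neqAle measure_ge0 andbT; apply/eqP => mu0.
  have := @integral_heat_kernel R N 1%R 0%R ltr01.
  rewrite (ae_eq_integral (cst 0)) ?integral0//.
  - by move=> /eqP; rewrite eq_sym onee_eq0.
  - exact: measurable_Gr.
  - exact: ae_eq0.
move: fB; rewrite unlock /= mu0 => /ess_supP fB.
have Caf := C0_abs Cf.
have ma : measurable_fun [set: RN] (fun x => `|f x|%:E).
  by apply/measurable_EFinP; exact: (continuous_measurable_row Caf.1).
apply/ler_addgt0Pr => e e0.
have [d d0 dP] := SC_sup Caf (fun y => normr_ge0 _) e0.
have d2 : (0 < d / 2)%R by rewrite divr_gt0.
have dd : (d / 2 < d)%R by lra.
have [h [mh _ fh he]] := dP _ d2 dd.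
rewrite -lee_fin; rewrite EFinD; apply: (le_trans (fh x)); apply: leeD; last exact: he.
rewrite -(heate_cst (d / 2) x B0); by apply: ae_le_heate => // y; rewrite lee_fin.
Qed.

End norms.
(** * Existence times *)

Section lifespan.
Context {R : realType}.
Local Open Scope ereal_scope.

(** C solves the smallness condition with equality at A = 1; the power al / dl is the one for which
    A cancels. *)
Lemma lifespan_constant (al dl K : R) : (0 < al)%R -> (0 < dl)%R -> (0 < K)%R ->
  exists2 C : R, (0 < C)%R & forall A : R, (0 < A)%R ->
    (8 * K * (8 * A) `^ al * (C * (A `^ (al / dl))^-1) `^ dl <= 1)%R.
Proof.
move=> al0 dl0 K0; pose C := ((8 * K * 8 `^ al) `^ (- dl^-1))%R.
have K80 : (0 < 8 * K * 8 `^ al)%R by rewrite !mulr_gt0// powR_gt0.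
exists C => [|A A0]; first exact: powR_gt0.
have Ad : (0 < A `^ (al / dl))%R by exact: powR_gt0.
have h1 : (C `^ dl = (8 * K * 8 `^ al)^-1)%R.
  by rewrite /C -powRrM mulNr mulVf ?gt_eqF// powRN powRr1// ltW.
have h2 : (((A `^ (al / dl))^-1) `^ dl = (A `^ al)^-1)%R.
  by rewrite -powRN -powRrM mulNr divfK ?gt_eqF// powRN.
have C0 : (0 <= C)%R by exact: powR_ge0.
have -> : ((C * (A `^ (al / dl))^-1) `^ dl = C `^ dl * ((A `^ (al / dl))^-1) `^ dl)%R.
  by apply: powRM => //; rewrite invr_ge0 powR_ge0.
rewrite h1 h2 powRM ?(ltW A0)//.
rewrite le_eqVlt; apply/orP; left; apply/eqP; field.
by rewrite !gt_eqF ?powR_gt0.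
Qed.

(** Covers the degenerate norms: for X = +oo the bound is 0, for X = 0 the bound is +oo and
    arbitrarily small A force Tmax = +oo; otherwise A = X. *)
Lemma lifespan_lower_bound (X Tmax : \bar R) (C rho : R) : 0 <= X -> 0 < Tmax ->
  (0 < C)%R -> (0 < rho)%R ->
  (forall A : R, (0 < A)%R -> X <= A%:E -> (C * (A `^ rho)^-1)%:E <= Tmax) ->
  C%:E * (X `^ rho)^-1 <= Tmax.
Proof.
move=> X0 T0 C0 rho0 H; case: X X0 H => [x||]// x0 H; last first.
  by rewrite poweRyr ?gt_eqF// invey mule0 ltW.
rewrite lee_fin le_eqVlt in x0; case/predU1P: x0 => [x0|x0].
  have Ty : Tmax = +oo.
    case: Tmax T0 H => [b||]// b0 H; exfalso; rewrite lte_fin in b0.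
    (* For this A the bound C A^(-rho) equals 2 b, which exceeds the supposed finite value b of
       [Tmax]. *)
    have A0 : (0 < (C / (2 * b)) `^ rho^-1)%R by rewrite powR_gt0// divr_gt0// mulr_gt0.
    have := H _ A0; rewrite -x0 lee_fin (ltW A0) => /(_ isT).
    rewrite -powRrM mulVf ?gt_eqF// powRr1 ?invf_div; last by rewrite ltW// divr_gt0// mulr_gt0.
    by rewrite lee_fin mulrCA divff ?gt_eqF// mulr1; lra.
  by rewrite Ty leey.
have := H x x0 (lexx _); rewrite poweR_EFin inver (gt_eqF (powR_gt0 _ x0)).
by rewrite -EFinM.
Qed.

Lemma cvg_within_to0 (I : set R) (F : R -> \bar R) (t : R) : (forall s, 0 <= F s) ->
  (forall e : R, (0 < e)%R -> exists2 d : R, (0 < d)%R &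
    forall s, I s -> (`|s - t| < d)%R -> F s <= e%:E) ->
  F s @[s --> within I (nbhs t)] --> 0.
Proof.
move=> F0 H.
have nearF (e : R) : (0 < e)%R -> \forall s \near within I (nbhs t), F s <= e%:E.
  move=> e0; have [d d0 dP] := H e e0; apply/nbhs_ballP; exists d => //= s.
  by rewrite /ball/= => ts Is; apply: dP => //; rewrite distrC.
apply/fine_cvgP; split.
  near=> s; rewrite ge0_fin_numE//; apply: (@le_lt_trans _ _ 1%:E); last exact: ltry.
  by near: s; apply: nearF.
apply/cvgr0Pnorm_le => e e0; near=> s => /=.
have Fe : F s <= e%:E by near: s; apply: nearF.
by rewrite ger0_norm ?fine_ge0// -lee_fin fineK// ge0_fin_numE// (le_lt_trans Fe) ?ltry.
Unshelve. all: by end_near.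
Qed.

End lifespan.

(** * Existence in C_0 *)

Section C0_instance.
Context {R : realType} {N : nat}.
Notation RN := 'rV[R]_N.
Notation mu := (lebesgue_row N : {sigma_finite_measure set RN -> \bar R}).
Notation leb := (@lebesgue_measure R : {sigma_finite_measure set (measurableTypeR R) -> \bar R}).
Local Open Scope ereal_scope.

Variables (g al : R).
Hypotheses (N0 : (0 < N)%N) (g0 : (0 < g)%R) (gN : (g < N%:R)%R) (g2 : (g < 2)%R)
  (al0 : (0 < al)%R).
Let dl := (1 - g / 2)%R.
Let dl0 : (0 < dl)%R. Proof. by rewrite subr_gt0 ltr_pdivrMr// mul1r. Qed.
Let KB0 : (0 < 1 + Kball (N := N) g)%R.
Proof. by rewrite ltr_pwDl// (Kball_ge0 N0)// ltW. Qed.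
Let K := ((1 + Kball (N := N) g) / dl)%R.
Let K0 : (0 < K)%R. Proof. by rewrite divr_gt0. Qed.

Let smoothing (f : RN -> \bar R) (A t : R) x : nnmeas f -> (0 <= A)%R -> Linf_le f A ->
  (0 < t)%R -> heate t f x <= (A * t `^ (- 0))%:E.
Proof.
move=> nf A0 fA t0; rewrite oppr0 powRr0 mulr1.
exact: (hn_heat (@heat_norm_sup R N) t nf fA x).
Qed.

Let duh_norm (M s t : R) (w : R -> RN -> \bar R) : (0 < M)%R -> (s < t)%R ->
  kap_class Linf_le 0 M s t w ->
  Linf_le (duh s t (fun r => kap g (al + 1) (w r))) (K * (M `^ (al + 1) * (t - s) `^ dl)).
Proof.
move=> M0 st [mw w0 wM _] x.
apply: (duh_kap_bounded N0 g0 gN g2 al0 M0 mw w0 x (ltW st)) => r y rst.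
by have := wM r y rst; rewrite oppr0 powRr0 mulr1.
Qed.

Let duh_sup (M s t : R) (w : R -> RN -> \bar R) x : (0 < M)%R -> (s < t)%R ->
  kap_class Linf_le 0 M s t w ->
  duh s t (fun r => kap g (al + 1) (w r)) x <=
  (K * (M `^ (al + 1) * (t - s) `^ dl) * (t - s) `^ (- 0))%:E.
Proof. by move=> M0 st wk; rewrite oppr0 powRr0 mulr1; exact: duh_norm. Qed.

Let norm_lim (f : nat -> RN -> R) (h : RN -> R) B : (0 <= B)%R ->
  (forall n, nnmeas (EFin \o f n)) -> (forall x, nondecreasing_seq (fun n => f n x)) ->
  (forall x, f n x @[n --> \oo] --> h x) -> (forall n, Linf_le (EFin \o f n) B) ->
  Linf_le (EFin \o h) B.
Proof.
move=> B0 _ _ fh fB x; rewrite lee_fin -(cvg_lim _ (fh x))//.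
apply: limr_le; first by apply/cvg_ex; exists (h x).
by apply: nearW => n; have := fB n x; rewrite lee_fin.
Qed.

(** [mild_C0] places W and Z in C_0 at every time. This yields u(t) in C_0 and, through [SC_sup],
    the strong continuity at all intermediate data that the continuity in time requires. *)
Lemma C0_solution_exists (A T : R) (u0 : RN -> R) : C0 u0 -> (0 < A)%R -> (0 < T)%R ->
  (forall x, (`|u0 x| <= A)%R) -> (8 * K * (8 * A) `^ al * T `^ dl <= 1)%R ->
  exists u, C0_solution (- g) al u0 T%:E u.
Proof.
move=> Cu A0 T0 uA AT; pose M := (8 * A)%R; have M0 : (0 < M)%R by rewrite mulr_gt0.
have mu0 := continuous_measurable_row Cu.1.
have u0A : Linf_le (fun x : RN => `|u0 x|%:E) A by move=> x; rewrite lee_fin.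
have [w [u [k1 [k2 D]]]] := mild_data_exists (@heat_norm_sup R N) N0 g0 gN al0 (lexx 0%R)
  dl0 (ltW K0) smoothing duh_sup duh_norm norm_lim A0 T0 AT mu0 u0A.
have C1 := C0_abs Cu; have C2 := C0_sub C1 Cu.
have wM s x : (0 < s)%R -> (s < T)%R -> (w s x <= M)%R.
  move=> s0 sT; have [_ _ + _] := md_class D (lexx 0%R) (lexx T).
  by move=> /(_ s x); rewrite s0 sT /= oppr0 powRr0 mulr1 lee_fin; apply.
have [jw w0 _ _] := md_class D (lexx 0%R) (lexx T).
have k1E s : k1 s = kap g (al + 1) (EFin \o w s) by exact: md_kernel D s.
have k10 s x : 0 <= k1 s x by rewrite k1E; exact: kap_ge0.
have k1M s x : (0 < s)%R -> (s < T)%R -> k1 s x <= kap g (al + 1) (cst M%:E) x.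
  move=> s0 sT; rewrite k1E; apply: le_kap => //; first by rewrite addr_ge0// ltW.
  by move=> y; rewrite lee_fin wM.
(* The factor 2 is absorbed into the constant function, 2 M^(al+1) <= (2 M)^(al+1), so that
   [mild_C0] applies to Z as well. *)
have k2M s x : (0 < s)%R -> (s < T)%R -> k2 s x <= kap g (al + 1) (cst (2 * M)%:E) x.
  move=> s0 sT; apply: le_trans (md_k2_le D x s0 sT) _.
  apply: (@le_trans _ _ (2%:E * kap g (al + 1) (cst M%:E) x)).
    by rewrite lee_wpmul2l// k1M.
  rewrite /kap /cst !poweR_EFin -!EFinM lee_fin mulrCA ler_wpM2l ?powR_ge0//.
  rewrite powRM ?(ltW M0)// ler_wpM2r ?powR_ge0// -[leLHS](powRr1 (ler0n _ 2)).
  by rewrite ler_powR ?ler1n// lerDr ltW.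
have M20 : (0 < 2 * M)%R by rewrite mulr_gt0.
have W t : (0 <= t)%R -> (t < T)%R -> _ := mild_C0 N0 g0 gN g2 al0 M0 T0 C1
  (fun x => normr_ge0 _) (md_jk1 D) k10 k1M (t := t).
have a20 x : (0 <= `|u0 x| - u0 x)%R by rewrite subr_ge0 ler_norm.
have Z t : (0 <= t)%R -> (t < T)%R -> _ := mild_C0 N0 g0 gN g2 al0 M20 T0 C2
  a20 (md_jk2 D) (md_k2_ge0 D) k2M (t := t).
have SCm (f : RN -> R) k t : nnmeas (EFin \o f) -> jmeasurable k -> (forall s x, 0 <= k s x) ->
    C0 (fun x => fine (mild (EFin \o f) k t x)) /\
      (forall x, mild (EFin \o f) k t x \is a fin_num) -> SC Linf_le (mild (EFin \o f) k t).
  move=> nf jk kk0 [Cm fm].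
  rewrite (_ : mild _ _ _ = EFin \o (fun x => fine (mild (EFin \o f) k t x))); last first.
    by apply/funext => x /=; rewrite fineK.
  apply: SC_sup => // x; apply: fine_ge0; exact: (nnmeas_mild nf jk kk0 t).2.
have n1 : nnmeas (EFin \o (fun x => `|u0 x|%R)).
  split; last by move=> x; rewrite lee_fin.
  by apply/measurable_EFinP; exact: (continuous_measurable_row C1.1).
have n2 : nnmeas (EFin \o (fun x => `|u0 x| - u0 x)%R).
  split; last by move=> x; rewrite lee_fin.
  by apply/measurable_EFinP; exact: (continuous_measurable_row C2.1).
have SW s : (0 <= s)%R -> (s < T)%R -> SC Linf_le (mild (fun x => `|u0 x|%:E) k1 s).
  by move=> s0 sT; apply: (SCm _ _ _ n1 (md_jk1 D) k10); exact: W.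
have SZ s : (0 <= s)%R -> (s < T)%R -> SC Linf_le (mild (fun x => (`|u0 x| - u0 x)%:E) k2 s).
  by move=> s0 sT; apply: (SCm _ _ _ n2 (md_jk2 D) (md_k2_ge0 D)); exact: Z.
exists u; split; first by rewrite lte_fin.
- split.
    move=> t [t0]; rewrite lte_fin => tT.
    rewrite (_ : u t = fun x => (fine (mild (EFin \o (fun x => `|u0 x|%R)) k1 t x) -
       fine (mild (EFin \o (fun x => `|u0 x| - u0 x)%R) k2 t x))%R).
      by apply: C0_sub; [exact: (W t t0 tT).1|exact: (Z t t0 tT).1].
    by apply/funext => x; rewrite (md_u D).
  move=> t [t0]; rewrite lte_fin => tT.
  apply: cvg_within_to0 => [s|e e0]; first exact: Lnorm_ge0.
  have [d d0 dP] := md_continuous D t0 tT e0 SW SZ.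
  exists d => // s [s0]; rewrite lte_fin => sT st.
  have [h [_ uh hB]] := dP s s0 sT st.
  apply: (@Lnorm_le_sup R N (fun x => u s x - u t x)%R e (ltW e0)) => x.
  by rewrite -lee_fin; apply: le_trans (uh x) (hB x).
- move=> t [t0]; rewrite lte_fin => tT; split; last first.
    by apply: aeW => x; exact: (md_eq D).
  pose c := ((1 + Kball (N := N) g) * M `^ (al + 1))%R.
  have c0 : (0 <= c)%R by rewrite mulr_ge0 ?powR_ge0 ?(ltW KB0).
  apply: (@le_lt_trans _ _ (\int[leb]_(s in `]0%R, t[) (c%:E * ((t - s) `^ (- (g / 2)))%:E))).
    apply: le_integral_nonmeasurable => s; first by move=> _; exact: Lnorm_ge0.
    rewrite /= in_itv/= => /andP[s0 st]; have sT := lt_trans st tT.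
    have tsg : (0 <= c * (t - s) `^ (- (g / 2)))%R by rewrite mulr_ge0 ?powR_ge0.
    rewrite -EFinM; apply: (@Lnorm_le_sup R N (duhamel_integrand (- g)%R al u t s) _ tsg) => x.
    rewrite -lee_fin; apply: le_trans (md_integrand D x s0 st tT) _.
    have ts0 : (0 < t - s)%R by rewrite subr_gt0.
    have wMs y : (EFin \o w s) y <= M%:E by rewrite lee_fin wM.
    apply: le_trans (heate_kap_sup N0 g0 gN al0 (jmeasurable_section s jw) (w0 s) (ltW M0) wMs ts0 x) _.
    by rewrite lee_fin le_eqVlt; apply/orP; left; apply/eqP; rewrite /c; ring.
  rewrite ge0_integralZl//; last 2 first.
  - apply/measurable_EFinP; apply: measurable_funTS.
    by apply: (measurableT_comp (measurable_powR _)); exact: measurable_funB.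
  - by move=> s _; rewrite lee_fin powR_ge0.
  apply: (@le_lt_trans _ _ (c%:E * ((t - 0) `^ (1 - g / 2) / (1 - g / 2))%:E)); last by rewrite -EFinM ltry.
  by rewrite lee_wpmul2l ?lee_fin//; apply: integral_powRl_le => //; rewrite ltr_pdivrMr// mul1r.
Qed.

End C0_instance.

(** * Existence in L^q *)

Section Lq_instance.
Context {R : realType} {N : nat}.
Notation RN := 'rV[R]_N.
Notation mu := (lebesgue_row N : {sigma_finite_measure set RN -> \bar R}).
Notation leb := (@lebesgue_measure R : {sigma_finite_measure set (measurableTypeR R) -> \bar R}).
Local Open Scope ereal_scope.

(* [th] splits [w^(al+1) = w^(al+1-th) w^th], the first factor being bounded
   pointwise and the second in L^(q/th); the conditions are the integrability at
   the origin of the singular weight and of the two powers of time at both ends. *)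
Lemma duhamel_exponent_exists (g al q : R) : (0 < N)%N -> (0 < g)%R -> (g < N%:R)%R ->
  (g < 2)%R -> (0 < al)%R -> (1 < q)%R -> (N%:R * al / (2 - g) < q)%R ->
  exists th : R, [/\ (0 < th)%R, (th <= al + 1)%R & (th < q * (1 - g / N%:R))%R] /\
    [/\ (al + 1 - 2 * q / N%:R < th)%R, (1 - q * g / N%:R < th)%R &
        (th < 1 + q * (2 - g) / N%:R)%R].
Proof.
move=> N0 g0 gN g2 al0 q1 qc; have Np : (0 < N%:R :> R)%R by rewrite ltr0n.
have q0 : (0 < q)%R by exact: lt_trans q1.
pose X := (q / N%:R)%R; have X0 : (0 < X)%R by rewrite divr_gt0.
have g20 : (0 < 2 - g)%R by rewrite subr_gt0.
have alX : (al < X * (2 - g))%R.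
  by move: qc; rewrite ltr_pdivrMr// mulrC -ltr_pdivlMr// mulrAC.
have XN : (q = X * N%:R)%R by rewrite /X divfK// gt_eqF.
have -> : (q * (1 - g / N%:R) = q - g * X)%R by rewrite /X; field; rewrite gt_eqF.
have -> : (2 * q / N%:R = 2 * X)%R by rewrite /X mulrA.
have -> : (q * g / N%:R = g * X)%R by rewrite /X mulrAC mulrC.
have -> : (q * (2 - g) / N%:R = X * (2 - g))%R by rewrite /X mulrAC.
have gX : (0 < q - g * X)%R by rewrite {1}XN mulrC -mulrBl mulr_gt0// subr_gt0.
have gX0 : (0 < g * X)%R by rewrite mulr_gt0.
have Xg : (X * (2 - g) = 2 * X - g * X)%R by ring.
have Xg0 : (0 < X * (2 - g))%R by rewrite mulr_gt0.
pose L := (Num.max 0 (Num.max (al + 1 - 2 * X) (1 - g * X)))%R.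
pose U := (Num.min (q - g * X) (Num.min (1 + X * (2 - g)) (al + 1)))%R.
(* Nine comparisons of a lower with an upper bound. Subcriticality, in the form al < X (2 - g),
   gives al + 1 - 2X < 1 - g X, which is less than q - g X because q > 1. *)
have LU : (L < U)%R.
  by rewrite /L /U !gt_max !lt_min; do !(apply/andP; split); lra.
have [L1 L2 L3] : [/\ 0 <= L, al + 1 - 2 * X <= L & 1 - g * X <= L]%R.
  by rewrite /L !le_max !lexx !orbT.
have [U1 U2 U3] : [/\ U <= q - g * X, U <= 1 + X * (2 - g) & U <= al + 1]%R.
  by rewrite /U !ge_min !lexx !orbT.
by exists ((L + U) / 2)%R; split; split; lra.
Qed.

Variables (g al q th : R).
Hypotheses (N0 : (0 < N)%N) (g0 : (0 < g)%R) (gN : (g < N%:R)%R) (g2 : (g < 2)%R)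
  (al0 : (0 < al)%R) (q1 : (1 < q)%R) (th0 : (0 < th)%R)
  (thal : (th <= al + 1)%R) (thq : (th < q * (1 - g / N%:R))%R)
  (thb : (al + 1 - 2 * q / N%:R < th)%R) (thc : (1 - q * g / N%:R < th)%R)
  (thc1 : (th < 1 + q * (2 - g) / N%:R)%R) (qqc : (N%:R * al / (2 - g) < q)%R).
Let q0 : (0 < q)%R. Proof. exact: lt_trans q1. Qed.
Let a := (N%:R / (2 * q))%R.
Let a0 : (0 <= a)%R. Proof. by rewrite divr_ge0// mulr_ge0// ltW. Qed.
Let dl := (1 - g / 2 - a * al)%R.
Let dl0 : (0 < dl)%R. Proof. exact: dl_gt0. Qed.

Definition Lq_constant := Num.max (duhamel_constant (N := N) g al q th)
  (duhamel_sup_constant (N := N) g al q th).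
Let K := Lq_constant.

Lemma Lq_constant_gt0 : (0 < Lq_constant)%R.
Proof. by rewrite lt_max duhamel_constant_gt0. Qed.
Let K0 := Lq_constant_gt0.

Let smoothing (f : RN -> \bar R) (A t : R) x : nnmeas f -> (0 <= A)%R -> Lq_le q f A ->
  (0 < t)%R -> heate t f x <= (A * t `^ (- a))%:E.
Proof.
move=> [mf f0] A0 fA t0; apply: le_trans (heate_Lq_sup x (ltW q1) t0 mf f0 A0 fA) _.
by rewrite lee_fin mulrC ler_wpM2l// powR_4pi_le.
Qed.

Let duh_norm (M s t : R) (w : R -> RN -> \bar R) : (0 < M)%R -> (s < t)%R ->
  kap_class (Lq_le q) a M s t w ->
  Lq_le q (duh s t (fun r => kap g (al + 1) (w r))) (K * (M `^ (al + 1) * (t - s) `^ dl)).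
Proof.
move=> M0 st [mw w0 wM wL].
have nd : nnmeas (duh s t (fun r => kap g (al + 1) (w r))).
  by apply: nnmeas_duh; [exact: jmeasurable_kap|move=> r x; exact: kap_ge0].
have D0 := duhamel_constant_gt0 N0 g0 g2 q1 thb thc1 qqc.
apply: (hn_le (heat_norm_Lq (ltW q1)) nd nd _ _ _
  (duh_kap_Lq N0 g0 gN g2 al0 M0 mw w0 q1 th0 thal thq thb thc thc1 qqc wM wL st)) => //.
  by apply: mulr_ge0; [exact: ltW|rewrite mulr_ge0 ?powR_ge0].
by rewrite ler_wpM2r ?mulr_ge0 ?powR_ge0// le_max lexx.
Qed.

Let duh_sup (M s t : R) (w : R -> RN -> \bar R) x : (0 < M)%R -> (s < t)%R ->
  kap_class (Lq_le q) a M s t w ->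
  duh s t (fun r => kap g (al + 1) (w r)) x <=
  (K * (M `^ (al + 1) * (t - s) `^ dl) * (t - s) `^ (- a))%:E.
Proof.
move=> M0 st [mw w0 wM wL].
apply: le_trans (duh_kap_sup N0 g0 gN g2 al0 M0 mw w0 q1 th0 thal thq thb thc thc1 qqc wM wL st x) _.
rewrite lee_fin ler_wpM2r ?powR_ge0// ler_wpM2r ?mulr_ge0 ?powR_ge0//.
by rewrite le_max lexx orbT.
Qed.

Let norm_lim (f : nat -> RN -> R) (h : RN -> R) B : (0 <= B)%R ->
  (forall n, nnmeas (EFin \o f n)) -> (forall x, nondecreasing_seq (fun n => f n x)) ->
  (forall x, f n x @[n --> \oo] --> h x) -> (forall n, Lq_le q (EFin \o f n) B) ->
  Lq_le q (EFin \o h) B.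
Proof.
move=> B0 nf ndf fh fB.
have f0 n x : (0 <= f n x)%R by have := (nf n).2 x; rewrite lee_fin.
have fleh n x : (f n x <= h x)%R.
  rewrite -(cvg_lim _ (fh x))//; apply: nondecreasing_cvgn_le => //.
  by apply/cvg_ex; exists (h x).
have h0 x : (0 <= h x)%R := le_trans (f0 0%N x) (fleh 0%N x).
have cpow x : (f n x `^ q)%:E @[n --> \oo] --> (h x `^ q)%:E.
  (* The continuity of the power on [0, +oo[, the point 0 included, is taken from
     [continuous_oddpow]. *)
  have E y : (0 <= y)%R -> (y `^ q = oddpow (q - 1) y)%R.
    by move=> y0; rewrite oddpow_pos ?subrK// subr_gt0.
  have -> : (fun n => (f n x `^ q)%:E) = (fun n => (oddpow (q - 1) (f n x))%:E).
    by apply/funext => n; rewrite E.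
  rewrite E//; apply: cvg_EFin; first exact: nearW.
  apply: (@cvg_comp _ _ _ (fun n => f n x) (oddpow (q - 1)) _ (nbhs (h x))); first exact: fh.
  by apply: continuous_oddpow; rewrite subr_gt0.
rewrite /Lq_le (_ : \int[mu]_x _ = \int[mu]_x limn (fun n => (f n x `^ q)%:E)); last first.
  by apply: eq_integral => x _; apply/esym/cvg_lim.
have c : \int[mu]_x (f n x `^ q)%:E @[n --> \oo] --> \int[mu]_x limn (fun n => (f n x `^ q)%:E).
  apply: (@cvg_monotone_convergence _ _ _ mu setT measurableT (fun n x => (f n x `^ q)%:E)) => //.
  - move=> n; apply/measurable_EFinP; apply: (measurableT_comp (measurable_powR _)).
    by have [/measurable_EFinP mfn _] := nf n.
  - by move=> n x _; rewrite lee_fin powR_ge0.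
  - move=> x _ m n mn; rewrite lee_fin; apply: ge0_ler_powR; rewrite ?nnegrE ?(ltW q0)//.
    exact: ndf.
rewrite -(cvg_lim _ c)//; apply: lime_le; first by apply/cvg_ex; eexists; exact: c.
by apply: nearW => n; exact: fB.
Qed.

Lemma Lq_solution_exists (r A T : R) (u0 : RN -> R) : (q < r)%R ->
  measurable_fun [set: RN] u0 -> (0 < A)%R -> (0 < T)%R ->
  Lq_le q (fun x => `|u0 x|%:E) A -> (8 * K * (8 * A) `^ al * T `^ dl <= 1)%R ->
  exists u, Lq_solution q r (- g) al u0 T%:E u.
Proof.
move=> qr mu0 A0 T0 u0A AT; pose M := (8 * A)%R; have M0 : (0 < M)%R by rewrite mulr_gt0.
have HN := @heat_norm_Lq R N q (ltW q1).
have [w [u [k1 [k2 D]]]] := mild_data_exists HN N0 g0 gN al0 a0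
  dl0 (ltW K0) smoothing duh_sup duh_norm norm_lim A0 T0 AT mu0 u0A.
have r0 : (0 < r)%R by exact: lt_trans qr.
have k10 s x : 0 <= k1 s x by rewrite (md_kernel D); exact: kap_ge0.
have n1 : nnmeas (fun x => `|u0 x|%:E).
  split; last by move=> x; rewrite lee_fin.
  by apply/measurable_EFinP; apply: measurableT_comp => //; exact: normr_measurable.
have n2 : nnmeas (fun x => (`|u0 x| - u0 x)%:E).
  split; last by move=> x; rewrite lee_fin subr_ge0 ler_norm.
  apply/measurable_EFinP; apply: measurable_funB => //.
  by apply: measurableT_comp => //; exact: normr_measurable.
have SCm (b : RN -> \bar R) k t B : nnmeas b -> jmeasurable k -> (forall s x, 0 <= k s x) ->
    (forall x, mild b k t x \is a fin_num) -> Lq_le q (mild b k t) B -> SC (Lq_le q) (mild b k t).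
  move=> nb jk kk0 fin mB; have [mm m0] := nnmeas_mild nb jk kk0 t.
  have E : mild b k t = EFin \o (fun x => fine (mild b k t x)).
    by apply/funext => x /=; rewrite fineK.
  rewrite E; apply: SC_Lq; first exact: ltW.
  - by apply: measurableT_comp.
  - by move=> x; exact/fine_ge0.
  - apply: (le_lt_trans _ (ltry (B `^ q))); apply: le_trans mB.
    rewrite le_eqVlt; apply/orP; left; apply/eqP; apply: eq_integral => x _.
    by rewrite -[in RHS](fineK (fin x)) poweR_EFin.
have SW s : (0 <= s)%R -> (s < T)%R -> SC (Lq_le q) (mild (fun x => `|u0 x|%:E) k1 s).
  move=> s0 sT; apply: (SCm _ _ _ M n1 (md_jk1 D) k10); last exact: (md_w_norm D).
  by move=> x; exact: (md_w_fin D).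
have SZ s : (0 <= s)%R -> (s < T)%R -> SC (Lq_le q) (mild (fun x => (`|u0 x| - u0 x)%:E) k2 s).
  move=> s0 sT; apply: (SCm _ _ _ (2 * M)%R n2 (md_jk2 D) (md_k2_ge0 D)).
    by move=> x; exact: (md_z_fin D).
  have nw := nnmeas_mild n1 (md_jk1 D) k10 s; have nz := nnmeas_mild n2 (md_jk2 D) (md_k2_ge0 D) s.
  apply: (hn_le HN nz (nnmeasZ (ler0n _ 2) nw) _ _ (lexx _)
    (hn_scale HN nw (ltW M0) (ler0n _ 2) (md_w_norm D s0 sT))).
    by move=> x; exact: (md_z_le D).
  by rewrite mulr_ge0// ltW.
exists u; split; first by rewrite lte_fin.
- split.
    move=> t [t0]; rewrite lte_fin => tT; have [h [_ uh hM]] := md_norm D t0 tT.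
    rewrite /Lp/= inE; apply/andP; split; first by rewrite inE; exact: (md_meas D).
    rewrite inE /= /finite_norm; apply: le_lt_trans (ltry M).
    exact: (Lnorm_le_Lq q0 (ltW M0) uh hM).
  move=> t [t0]; rewrite lte_fin => tT.
  apply: cvg_within_to0 => [s|e e0]; first exact: Lnorm_ge0.
  have [d d0 dP] := md_continuous D t0 tT e0 SW SZ.
  exists d => // s [s0]; rewrite lte_fin => sT st.
  have [h [_ uh hB]] := dP s s0 sT st.
  exact: (@Lnorm_le_Lq R N q (fun x => u s x - u t x)%R h e q0 (ltW e0) uh hB).
- split.
    move=> t [t0]; rewrite lte_fin => tT; have [h [nh uh hM]] := md_norm D (ltW t0) tT.
    rewrite /Lp/= inE; apply/andP; split; first by rewrite inE; exact: (md_meas D).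
    rewrite inE /= /finite_norm; apply: le_lt_trans (ltry _).
    have S0 : (0 <= M * t `^ (- a))%R by rewrite mulr_ge0 ?powR_ge0// ltW.
    exact: (Lnorm_le_interp q0 qr (ltW M0) S0 nh uh (fun x => md_sup D x t0 tT) hM).
  move=> t [t0]; rewrite lte_fin => tT.
  apply: cvg_within_to0 => [s|e e0]; first exact: Lnorm_ge0.
  have t20 : (0 < t / 2)%R by rewrite divr_gt0.
  pose S := (M * (t / 2) `^ (- a) + M * (t / 2) `^ (- a))%R.
  have S0 : (0 < S)%R by rewrite addr_gt0// mulr_gt0// powR_gt0.
  (* For |s - t| < t/2 the pointwise decay bounds the difference by S; e' is the L^q distance for
     which the interpolation with S yields exactly e in L^r. *)
  pose e' := ((e `^ r / S `^ (r - q)) `^ q^-1)%R.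
  have Sp : (0 < S `^ (r - q))%R by rewrite powR_gt0.
  have eS : (0 < e `^ r / S `^ (r - q))%R by rewrite divr_gt0// powR_gt0.
  have e'0 : (0 < e')%R by rewrite powR_gt0.
  have [d d0 dP] := md_continuous D (ltW t0) tT e'0 SW SZ.
  exists (Num.min d (t / 2))%R; first by rewrite lt_min d0.
  move=> s [s0]; rewrite lte_fin => sT; rewrite lt_min => /andP[sd st2].
  have [h [nh uh hB]] := dP s (ltW s0) sT sd.
  have uS v x : (t / 2 <= v)%R -> (v < T)%R -> (`|u v x| <= M * (t / 2) `^ (- a))%R.
    move=> tv vT; apply: le_trans (md_sup D x (lt_le_trans t20 tv) vT) _.
    by rewrite ler_wpM2l ?(ltW M0)// powR_antitone.
  have uu x : (`|u s x - u t x| <= S)%R.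
    apply: le_trans (ler_normB _ _) _; apply: lerD; apply: uS => //.
      by move: st2; rewrite ltr_norml; lra.
    by lra.
  apply: le_trans (@Lnorm_le_interp R N q r (fun x => u s x - u t x)%R h e' S q0 qr (ltW e'0) (ltW S0) nh uh uu hB) _.
  rewrite /e' -(powRrM _ q^-1) mulVf ?gt_eqF// powRr1 ?(ltW eS)//.
  by rewrite mulrC divfK ?gt_eqF// -powRrM divff ?gt_eqF// powRr1// ltW.
- move=> t [t0]; rewrite lte_fin => tT; split; last first.
    by apply: aeW => x; exact: (md_eq D).
  move: t0; rewrite le_eqVlt => /predU1P[<-|t0].
    by rewrite set_itv_ge ?bnd_simp ?ltxx// integral_set0 ltry.
  have [jw w0 wM wL] := md_class D (lexx 0%R) (ltW tT).
  apply: le_lt_trans (le_lt_trans (integral_heate_kap_Lq N0 g0 g2 al0 M q1 thal thb thc thc1 qqc t0) (ltry _)).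
  apply: le_integral_nonmeasurable => s; first by move=> _; exact: Lnorm_ge0.
  rewrite /= in_itv/= => /[dup] st /andP[s0 st'].
  have hs := heate_kap_Lq_time N0 g0 gN al0 M0 jw w0 q1 th0 thal thq wM wL st.
  have hp := h_gt0 (N := N) g al M0 q th st.
  exact: (Lnorm_le_Lq q0 (ltW hp) (fun x => md_integrand D x s0 st' tT) hs).
Qed.

End Lq_instance.

(** * Lower bound of the existence time *)

Theorem theoremA1 (R : realType) (N : nat) (l alpha : R) :
  (0 < N)%N -> - Num.min 2 N%:R < l -> l < 0 -> 0 < alpha ->
  (forall q : R, 1 < q -> N%:R * alpha / (2 + l) < q ->
    exists2 C : R, 0 < C &
    forall r : R, q < r ->
      1 / (q * (alpha + 1)) + l / (N%:R * (alpha + 1)) < 1 / r ->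
      1 / r < (N%:R + l) / (N%:R * (alpha + 1)) ->
    forall phi : 'rV[R]_N -> R, Lp q%:E phi ->
    forall lambda : R, 0 < lambda ->
    forall (Tmax : \bar R) (u : R -> 'rV[R]_N -> R),
      maximal_solution
        (Lq_solution q r l alpha (fun x => lambda * phi x)) Tmax u ->
      (C%:E * ((lambda%:E * 'N[lebesgue_row N]_q%:E[EFin \o phi])
               `^ ((2 + l) / (2 * alpha) - N%:R / (2 * q))^-1%R)^-1
       <= Tmax)%E) /\
  (exists2 C : R, 0 < C &
    forall phi : 'rV[R]_N -> R, C0 phi ->
    forall lambda : R, 0 < lambda ->
    forall (Tmax : \bar R) (u : R -> 'rV[R]_N -> R),
      maximal_solution
        (C0_solution l alpha (fun x => lambda * phi x)) Tmax u ->
      (C%:E * ((lambda%:E * 'N[lebesgue_row N]_+oo[EFin \o phi])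
               `^ ((2 + l) / (2 * alpha))^-1%R)^-1
       <= Tmax)%E).
Proof.
move=> N0 lmin l0 al0; rewrite -(opprK l) in lmin l0 *; set g := - l in lmin l0 *.
have g0 : 0 < g by rewrite -oppr_lt0.
have [g2 gN] : g < 2 /\ g < N%:R by apply/andP; rewrite -lt_min -ltrN2.
have normZ p phi lambda (A : R) : 0 < lambda ->
    (lambda%:E * 'N[lebesgue_row N]_p[EFin \o phi] <= A%:E)%E ->
    ('N[lebesgue_row N]_p[EFin \o phi] <= (A / lambda)%:E)%E.
  move=> la0; have := Lnorm_ge0 (lebesgue_row N) p (EFin \o phi).
  case: ('N[_]_p[_])%E => [x||]//; last by rewrite gt0_muley.
  by move=> _; rewrite -EFinM !lee_fin ler_pdivlMr// mulrC.
split=> [q q1 qc|].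
  have q0 : 0 < q by exact: lt_trans q1.
  have [th [[th0 thal thq] [thb thc thc1]]] := duhamel_exponent_exists N0 g0 gN g2 al0 q1 qc.
  have K0 := Lq_constant_gt0 N0 g0 g2 q1 thb thc1 qc.
  have dl0 := dl_gt0 g2 q1 qc.
  have [C Cgt0 CP] := lifespan_constant al0 dl0 K0.
  (* The constant is fixed before r, phi and lambda. *)
  exists C => // r qr _ _ phi Lphi lambda la0 Tmax u [[T0 _ _ _] maxu].
  (* The exponent of the statement is al / dl, the one of [lifespan_constant]. *)
  have -> : ((2 - g) / (2 * alpha) - N%:R / (2 * q))^-1 =
      alpha / (1 - g / 2 - N%:R / (2 * q) * alpha).
    have -> : (2 - g) / (2 * alpha) - N%:R / (2 * q) =
        (1 - g / 2 - N%:R / (2 * q) * alpha) / alpha by field; rewrite !gt_eqF.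
    by rewrite invf_div.
  apply: lifespan_lower_bound => //.
  - by rewrite mule_ge0 ?Lnorm_ge0// lee_fin ltW.
  - by rewrite divr_gt0.
  move=> A A0 /(normZ _ _ _ _ la0) NA.
  have mphi : measurable_fun [set: 'rV[R]_N] phi.
    by move: Lphi; rewrite /Lp/= inE => /andP[]; rewrite inE.
  have nphi : nnmeas (fun x => `|phi x|%:E).
    split; last by move=> x; rewrite lee_fin.
    by apply/measurable_EFinP; apply: measurableT_comp => //; exact: normr_measurable.
  have Al0 : 0 <= A / lambda by rewrite divr_ge0// ltW.
  have := hn_scale (heat_norm_Lq (ltW q1)) nphi Al0 (ltW la0) (Lq_le_Lnorm q0 NA).
  rewrite mulrC divfK ?gt_eqF// => uA.
  have T1 : 0 < C * (A `^ (alpha / (1 - g / 2 - N%:R / (2 * q) * alpha)))^-1.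
    by rewrite mulr_gt0// invr_gt0 powR_gt0.
  have mu0 : measurable_fun [set: 'rV[R]_N] (fun x => lambda * phi x).
    exact: measurable_funM.
  have u0A : Lq_le q (fun x => `|lambda * phi x|%:E) A.
    by under eq_fun do rewrite normrM (gtr0_norm la0) EFinM.
  (* The solution v need not be compared with u: maximality bounds the lifetime of every solution
     with the same datum. *)
  have [v vsol] := Lq_solution_exists N0 g0 gN g2 al0 q1 th0 thal thq thb thc thc1 qc qr mu0 A0 T1 u0A (CP A A0).
  exact: maxu vsol.
have dl0 : 0 < 1 - g / 2 by rewrite subr_gt0 ltr_pdivrMr// mul1r.
have K0 : 0 < (1 + Kball (N := N) g) / (1 - g / 2).
  by rewrite divr_gt0// ltr_pwDl// (Kball_ge0 N0)// ltW.
have [C Cgt0 CP] := lifespan_constant al0 dl0 K0.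
exists C => // phi Cphi lambda la0 Tmax u [[T0 _ _] maxu].
have -> : ((2 - g) / (2 * alpha))^-1 = alpha / (1 - g / 2).
  have -> : (2 - g) / (2 * alpha) = (1 - g / 2) / alpha by field; rewrite !gt_eqF.
  by rewrite invf_div.
apply: lifespan_lower_bound => //.
- by rewrite mule_ge0 ?Lnorm_ge0// lee_fin ltW.
- by rewrite divr_gt0.
move=> A A0 /(normZ _ _ _ _ la0) NA.
have T1 : 0 < C * (A `^ (alpha / (1 - g / 2)))^-1.
  by rewrite mulr_gt0// invr_gt0 powR_gt0.
have uA x : `|lambda * phi x| <= A.
  by rewrite normrM (gtr0_norm la0) mulrC -ler_pdivlMr//; exact: Lnorm_sup_lt.
have [v vsol] := C0_solution_exists N0 g0 gN g2 al0 (C0_scale lambda Cphi) A0 T1 uA (CP A A0).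
exact: maxu vsol.
Qed.
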